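(* Let $Z_1,\dots,Z_p\in\mathbb{R}^n$ be i.i.d. random vectors with a spherical distribution around $0$, with $\Pr(Z_i=0)=0$. Let $V_1\ge V_2$ be the first two order statistics (the largest and second largest values) of the absolute values $|S_{ij}|$, $1\le i<j\le p$, of the pairwise sample correlations of $Z_1,\dots,Z_p$. Then, as $n,p\to\infty$ with $\frac{\log p}{n}\to 0$, $$nV_1(V_1-V_2)\xrightarrow{d}\mathrm{Exp}(1).$$
   Context: A random vector $Z\in\mathbb{R}^n$ has a spherical distribution around $0$ if $OZ$ has the same distribution as $Z$ for every orthogonal $n\times n$ matrix $O$. The sample correlation of $Z_i,Z_j$ is the (centered) Pearson correlation $S_{ij}=\frac{(Z_i-\bar Z_i\mathbf 1)^T(Z_j-\bar Z_j\mathbf 1)}{\|Z_i-\bar Z_i\mathbf 1\|_2\,\|Z_j-\bar Z_j\mathbf 1\|_2}$, where $\bar Z_i$ is the average of the $n$ coordinates of $Z_i$ and $\mathbf 1\in\mathbb{R}^n$ is the all-ones vector. $\mathrm{Exp}(\mu)$ denotes the exponential distribution with mean $\mu$. The limit is along any sequence $p=p_n$ with $p_n\to\infty$ and $\frac{\log p_n}{n}\to0$ as $n\to\infty$. *)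

(* Defs.v *)
From HB Require Import structures.
From mathcomp Require Import all_boot all_order all_algebra.
From mathcomp Require Import all_classical all_reals all_analysis.
From mathcomp Require Import measurable_realfun.

Set Implicit Arguments.
Unset Strict Implicit.
Unset Printing Implicit Defensive.

Import Order.TTheory GRing.Theory Num.Theory.
Import numFieldNormedType.Exports.

Local Open Scope classical_set_scope.
Local Open Scope ring_scope.

(* R^n is n.-tuple R with its product sigma-algebra; the law of a random
   element is compared on measurable sets only, since the library's measures
   are arbitrary on the other sets. *)

Definition eq_law d (S : measurableType d) (R : realType)
    (mu nu : set S -> \bar R) : Prop :=
  forall A, measurable A -> mu A = nu A.

Section random_elements.
Context d (T : measurableType d) (R : realType) (P : probability T R).

Definition mutually_independent d' (S : measurableType d') (I : finType)
    (X : I -> {RV P >-> S}) : Prop :=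
  forall (J : {set I}) (B : I -> set S), (forall i, measurable (B i)) ->
    P (\bigcap_(i in [set` J]) X i @^-1` B i) =
    (\prod_(i in J) P (X i @^-1` B i))%E.

Definition iid d' (S : measurableType d') (I : finType)
    (X : I -> {RV P >-> S}) : Prop :=
  mutually_independent X /\
  forall i j, eq_law (distribution P (X i)) (distribution P (X j)).

Definition tuple_mulmx n (O : 'M[R]_n) (z : n.-tuple R) : n.-tuple R :=
  [tuple (O *m \col_j tnth z j) i 0 | i < n].

Definition spherical n (X : {RV P >-> n.-tuple R}) : Prop :=
  forall O : 'M[R]_n, O *m O^T = 1%:M ->
    eq_law (pushforward P (tuple_mulmx O \o X)) (distribution P X).

End random_elements.
Arguments mutually_independent {d T R} P {d' S I} X.
Arguments iid {d T R} P {d' S I} X.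
Arguments spherical {d T R} P {n} X.

Section sample_correlation.
Context {R : realType}.

Definition sample_mean n (z : n.-tuple R) : R := n%:R^-1 * \sum_(k < n) tnth z k.

Definition centered n (z : n.-tuple R) : n.-tuple R :=
  [tuple tnth z k - sample_mean z | k < n].

Definition dot n (x y : n.-tuple R) : R := \sum_(k < n) tnth x k * tnth y k.

Definition norm2 n (x : n.-tuple R) : R := Num.sqrt (dot x x).

(* 0 if a centered vector vanishes *)
Definition sample_corr n (x y : n.-tuple R) : R :=
  dot (centered x) (centered y) / (norm2 (centered x) * norm2 (centered y)).

(* k-th largest element counted with multiplicity, starting from k = 0;
   0 if s has at most k elements *)
Definition ostat (s : seq R) (k : nat) : R := nth 0 (sort >=%R s) k.

Definition pairs p : seq ('I_p * 'I_p) :=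
  [seq q : 'I_p * 'I_p <- enum {: 'I_p * 'I_p} | (q.1 < q.2)%N].

End sample_correlation.

Section correlation_statistics.
Context d (T : measurableType d) (R : realType) (P : probability T R).
Context (n p : nat) (Z : 'I_p -> {RV P >-> n.-tuple R}).

Definition abs_corrs (w : T) : seq R :=
  [seq `|sample_corr (Z q.1 w) (Z q.2 w)| | q <- pairs p].

Definition V1 (w : T) : R := ostat (abs_corrs w) 0.
Definition V2 (w : T) : R := ostat (abs_corrs w) 1.

Definition nV1_gap (w : T) : R := n%:R * V1 w * (V1 w - V2 w).

End correlation_statistics.

Section measurability.
Context d (T : measurableType d) (R : realType).

Lemma ostat_ge (s : seq R) k y : (k < size s)%N ->
  (y <= ostat s k) = (k < count (>= y) s)%N.
Proof.
move=> ks; rewrite /ostat -(count_sort >=%R).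
have : sorted >=%R (sort >=%R s) by apply: sort_sorted => a b; exact: le_total.
move: ks; rewrite -(size_sort >=%R); elim: (sort _ s) k => // a {}s IH k ks.
rewrite /= (path_sortedE (rev_trans le_trans)) => /andP[/allP sa ss].
have [ya|ay] := leP y a; first by case: k ks => //= k ks; rewrite add1n ltnS IH.
rewrite add0n (_ : count _ _ = 0%N).
  case: k ks => [|k] ks /=; first by rewrite leNgt ay.
  by apply/negbTE; rewrite -ltNge (le_lt_trans _ ay)// sa// mem_nth.
apply/eqP; rewrite -leqn0 leqNgt -has_count; apply/hasPn => b /sa ba /=.
by rewrite -ltNge (le_lt_trans ba).
Qed.

Lemma measurable_ostat (I : Type) (r : seq I) (f : I -> T -> R) k :
  (forall i, measurable_fun setT (f i)) ->
  measurable_fun setT (fun w => ostat [seq f i w | i <- r] k).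
Proof.
move=> mf; have [rk|kr] := leqP (size r) k.
  rewrite (_ : (fun _ => _) = cst 0)//; apply/funext => w /=.
  by rewrite /ostat nth_default// size_sort size_map.
apply: (measurability _ (RGenCInfty.measurableE R)) => _ [_ [y ->] <-].
rewrite (_ : _ `&` _ = setT `&`
    (fun w => \sum_(i <- r) \1_(f i @^-1` `[y, +oo[%classic) w : R)
      @^-1` `]k%:R, +oo[%classic).
  apply: measurable_sum => // i; apply: measurable_indic.
  by rewrite -[X in measurable X]setTI; apply: mf.
congr (_ `&` _); apply/seteqP.
have E w : (\sum_(i <- r) \1_(f i @^-1` `[y, +oo[%classic) w : R) =
    (count (>= y) [seq f i w | i <- r])%:R.
  elim: r {kr} => [|i r IH]; first by rewrite big_nil.
  rewrite big_cons IH /= natrD indicE; congr (_%:R + _).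
  congr nat_of_bool; apply/idP/idP => [/set_mem|H]; last apply/mem_set; by rewrite /preimage/= in_itv/= andbT.
by split=> w; rewrite /preimage/= !in_itv/= !andbT E ltr_nat ostat_ge// size_map.
Qed.

Lemma measurable_dot n (f g : T -> n.-tuple R) :
  measurable_fun setT f -> measurable_fun setT g ->
  measurable_fun setT (fun w => dot (f w) (g w)).
Proof.
move=> /measurable_fun_tnthP mf /measurable_fun_tnthP mg.
by apply: measurable_sum => k; apply: measurable_funM; [exact: mf|exact: mg].
Qed.

Lemma measurable_centered n (f : T -> n.-tuple R) :
  measurable_fun setT f -> measurable_fun setT (fun w => centered (f w)).
Proof.
move=> /measurable_fun_tnthP mf; apply/measurable_fun_tnthP => k.
rewrite (_ : _ \o _ = fun w => tnth (f w) k - sample_mean (f w)).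
  apply: measurable_funB; first exact: mf.
  by apply: measurable_funM => //; apply: measurable_sum => l; exact: mf.
by apply/funext => w /=; rewrite tnth_mktuple.
Qed.

Lemma measurable_norm2 n (f : T -> n.-tuple R) :
  measurable_fun setT f -> measurable_fun setT (fun w => norm2 (f w)).
Proof.
move=> mf; apply: (measurableT_comp (f := @Num.sqrt R)); last exact: measurable_dot.
by apply: continuous_measurable_fun; exact: sqrt_continuous.
Qed.

Lemma measurable_sample_corr n (f g : T -> n.-tuple R) :
  measurable_fun setT f -> measurable_fun setT g ->
  measurable_fun setT (fun w => sample_corr (f w) (g w)).
Proof.
move=> /measurable_centered mf /measurable_centered mg.
apply: measurable_funM; first exact: measurable_dot.
rewrite (_ : (fun _ => _) = (@powR R ^~ (-1)) \o
    (fun w => norm2 (centered (f w)) * norm2 (centered (g w)))).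
  apply: measurableT_comp; first exact: measurable_powR.
  by apply: measurable_funM; exact: measurable_norm2.
by apply/funext => w /=; rewrite powR_inv1// mulr_ge0// sqrtr_ge0.
Qed.

Lemma measurable_nV1_gap (P : probability T R) n p
    (Z : 'I_p -> {RV P >-> n.-tuple R}) : measurable_fun setT (nV1_gap Z).
Proof.
have mV k : measurable_fun setT (fun w => ostat (abs_corrs Z w) k).
  apply: measurable_ostat => q; apply: measurableT_comp => //.
  exact: measurable_sample_corr.
apply: measurable_funM; first by apply: measurable_funM => //; exact: mV.
by apply: measurable_funB; exact: mV.
Qed.

HB.instance Definition _ (P : probability T R) n p
    (Z : 'I_p -> {RV P >-> n.-tuple R}) :=
  isMeasurableFun.Build _ _ _ _ (nV1_gap Z) (measurable_nV1_gap Z).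

End measurability.

(* The probability space may change along the sequence. *)
Definition cvg_in_distribution (R : realType) (d : nat -> measure_display)
    (T : forall n, measurableType (d n)) (P : forall n, probability (T n) R)
    (X : forall n, {RV (P n) >-> R}) (mu : set R -> \bar R) : Prop :=
  forall x : R, {for x, continuous (fun r : R => mu `]-oo, r]%classic)} ->
    cdf (X n) x @[n --> \oo] --> mu `]-oo, x]%classic.
Arguments cvg_in_distribution {R d T} P X mu.

(* the library parametrizes the exponential law by its rate *)
Definition exp_law (R : realType) (mean : R) : set R -> \bar R :=
  exponential_prob mean^-1.

(* Main.v *)
(* After centering and normalization the Z_i are independent and uniform on the unit
   sphere of an (n-1)-dimensional space. Hence the |S_ij| have a common tail H, two
   correlations sharing one index are independent, and S_ij is independent of the
   correlations between the other vectors.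

   Invariance under rotations of a coordinate plane is a Stein identity for the law of
   S_ij; read on truncated moments it is a differential equation, which gives
     (n-2) t <= - H'(t) / H(t) <= (n-2) / (1 - t^2) * (t + 1 / sqrt (n-1)).
   Let N be the number of pairs. As log p / n tends to 0, N H(v) = a forces v -> 0 and
   n v^2 -> oo, and then N H(v - x / (n v)) -> a e^x.

   Decomposing according to the pair that realizes V1, and neglecting the pairs that meet
   it, Phi(a) = P(N H(V1) > a) satisfies Phi' = - Phi up to o(1), so Phi(a) -> e^-a: no
   Poisson approximation is needed. In the same way n V1 (V1 - V2) > x means that all the
   other pairs lie below V1 - x / (n V1), which has probability
     int_0^oo Phi(a e^x) da -> e^-x. *)

Require Import Defs.
From HB Require Import structures.
From mathcomp Require Import all_boot all_order all_algebra.
From mathcomp Require Import all_classical all_reals all_analysis.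
From mathcomp Require Import measurable_realfun ring lra zify.

Set Implicit Arguments.
Unset Strict Implicit.
Unset Printing Implicit Defensive.

Import Order.TTheory GRing.Theory Num.Theory.
Import numFieldNormedType.Exports.

Local Open Scope classical_set_scope.
Local Open Scope ring_scope.

(** * Expectations of bounded random variables *)

Section bounded_expectation.
Context d (T : measurableType d) (R : realType) (P : probability T R).
Implicit Types (f g : T -> R) (A B : set T).

(** No density of a correlation is computed: the spherical law enters only through its invariance
    under reflections, so the radii of the Z_i may have any law. Neglecting the pairs that meet the
    maximal one is affordable because there are fewer than 2 p of them among N = p (p - 1) / 2: at a
    level r where N H(r) stays bounded, their expected number of exceedances is at most 2 p H(r) =
    (2 p / N) N H(r), which tends to 0. In the lower bound this error is summed over all N
    candidates for the maximal pair, so for each candidate it must keep the small factor H(s) -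
    H(t), the probability that the candidate falls between the levels s and t; this is where the
    independence of two correlations sharing an index is used. Phi is not known to be
    differentiable, so Phi' = - Phi is used in difference form, on a grid of levels that is fixed
    before n tends to infinity. The same kind of grid replaces the integral over a by Riemann
    sums. *)

Definition bounded_rv f := measurable_fun setT f /\ exists M, forall w, `|f w| <= M.

Definition Ex f : R := \int[P]_w f w.

Definition pr A : R := fine (P A).

Lemma bounded_rv_cst c : bounded_rv (fun=> c).
Proof. by split; [exact: measurable_cst|exists `|c|]. Qed.

Lemma bounded_rvD f g : bounded_rv f -> bounded_rv g ->
  bounded_rv (fun w => f w + g w).
Proof.
move=> [mf [M fM]] [mg [K gK]]; split; first exact: measurable_funD.
by exists (M + K) => w; rewrite (le_trans (ler_normD _ _))// lerD.
Qed.

Lemma bounded_rvM f g : bounded_rv f -> bounded_rv g ->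
  bounded_rv (fun w => f w * g w).
Proof.
move=> [mf [M fM]] [mg [K gK]]; split; first exact: measurable_funM.
by exists (M * K) => w; rewrite normrM ler_pM.
Qed.

Lemma bounded_rvZ c f : bounded_rv f -> bounded_rv (fun w => c * f w).
Proof. by move=> bf; apply: bounded_rvM => //; exact: bounded_rv_cst. Qed.

Lemma bounded_rvN f : bounded_rv f -> bounded_rv (fun w => - f w).
Proof.
move=> /(bounded_rvZ (-1)) bf.
by rewrite (_ : (fun _ => _) = fun w => -1 * f w)//; apply/funext => w; rewrite mulN1r.
Qed.

Lemma bounded_rvB f g : bounded_rv f -> bounded_rv g ->
  bounded_rv (fun w => f w - g w).
Proof. by move=> bf bg; apply: bounded_rvD => //; exact: bounded_rvN. Qed.

Lemma bounded_rvX k f : bounded_rv f -> bounded_rv (fun w => f w ^+ k).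
Proof.
move=> bf; elim: k => [|k IH]; first exact: bounded_rv_cst.
by under eq_fun do rewrite exprS; exact: bounded_rvM.
Qed.

Lemma bounded_rv_indic A : measurable A -> bounded_rv \1_A.
Proof.
move=> mA; split; first exact: measurable_indic.
by exists 1 => w; rewrite indicE; case: (_ \in _); rewrite ?normr1 ?normr0.
Qed.

Lemma bounded_rv_sum (I : Type) (r : seq I) (F : I -> T -> R) :
  (forall i, bounded_rv (F i)) -> bounded_rv (fun w => \sum_(i <- r) F i w).
Proof.
move=> bF; elim: r => [|i r IH].
  by under eq_fun do rewrite big_nil; exact: bounded_rv_cst.
by under eq_fun do rewrite big_cons; exact: bounded_rvD.
Qed.

Lemma bounded_rv_integrable f : bounded_rv f -> P.-integrable setT (EFin \o f).
Proof.
move=> [mf [M fM]]; apply: measurable_bounded_integrable => //=.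
  by rewrite -ge0_fin_numE// fin_num_measure.
by exists M; split; [exact: num_real|move=> x Mx w _ /=; exact: le_trans (ltW Mx)].
Qed.

Lemma ExD f g : bounded_rv f -> bounded_rv g ->
  Ex (fun w => f w + g w) = Ex f + Ex g.
Proof. by move=> bf bg; apply: RintegralD => //; exact: bounded_rv_integrable. Qed.

Lemma ExZ c f : bounded_rv f -> Ex (fun w => c * f w) = c * Ex f.
Proof. by move=> bf; apply: RintegralZl => //; exact: bounded_rv_integrable. Qed.

Lemma ExB f g : bounded_rv f -> bounded_rv g ->
  Ex (fun w => f w - g w) = Ex f - Ex g.
Proof. by move=> bf bg; apply: RintegralB => //; exact: bounded_rv_integrable. Qed.

Lemma le_Ex f g : bounded_rv f -> bounded_rv g -> (forall w, f w <= g w) ->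
  Ex f <= Ex g.
Proof. by move=> bf bg fg; apply: le_Rintegral => //; exact: bounded_rv_integrable. Qed.

Lemma pr_setT : pr setT = 1. Proof. by rewrite /pr probability_setT. Qed.

Lemma Ex_cst c : Ex (fun=> c) = c.
Proof. by rewrite /Ex Rintegral_cst//= -[fine _]/(pr setT) pr_setT mulr1. Qed.

Lemma Ex_ge0 f : (forall w, 0 <= f w) -> 0 <= Ex f.
Proof. by move=> f0; apply: Rintegral_ge0. Qed.

Lemma Ex_sum (I : Type) (r : seq I) (F : I -> T -> R) :
  (forall i, bounded_rv (F i)) ->
  Ex (fun w => \sum_(i <- r) F i w) = \sum_(i <- r) Ex (F i).
Proof.
move=> bF; elim: r => [|i r IH].
  by under [X in Ex X]eq_fun do rewrite big_nil; rewrite Ex_cst big_nil.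
under [X in Ex X]eq_fun do rewrite big_cons.
by rewrite ExD ?IH ?big_cons//; exact: bounded_rv_sum.
Qed.

Lemma norm_Ex_le f c : bounded_rv f -> (forall w, `|f w| <= c) -> `|Ex f| <= c.
Proof.
move=> bf fc; rewrite ler_norml; apply/andP; split.
  rewrite -(Ex_cst (- c)); apply: le_Ex => [|//|w]; first exact: bounded_rv_cst.
  by have := fc w; rewrite ler_norml => /andP[].
rewrite -(Ex_cst c); apply: le_Ex => [//||w]; first exact: bounded_rv_cst.
by have := fc w; rewrite ler_norml => /andP[].
Qed.

Lemma Ex_indic A : measurable A -> Ex \1_A = pr A.
Proof. by move=> mA; rewrite /Ex /Rintegral integral_indic// setIT. Qed.

Lemma prE A : measurable A -> P A = (pr A)%:E.
Proof. by move=> mA; rewrite /pr fineK// fin_num_measure. Qed.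

Lemma pr_ge0 A : 0 <= pr A. Proof. exact: fine_ge0. Qed.

Lemma le_pr A B : measurable A -> measurable B -> A `<=` B -> pr A <= pr B.
Proof.
by move=> mA mB AB; rewrite -lee_fin -!prE//; apply: le_measure; rewrite ?inE.
Qed.

Lemma pr_set0 : pr set0 = 0. Proof. by rewrite /pr measure0. Qed.

Lemma prU A B : measurable A -> measurable B -> A `&` B = set0 ->
  pr (A `|` B) = pr A + pr B.
Proof.
by move=> mA mB AB; rewrite /pr measureU// fineD// fin_num_measure.
Qed.

Lemma pr_le_U A B : measurable A -> measurable B -> pr (A `|` B) <= pr A + pr B.
Proof.
move=> mA mB; rewrite -lee_fin EFinD -!prE//; last exact: measurableU.
exact: measureU2.
Qed.

Lemma prC A : measurable A -> pr (~` A) = 1 - pr A.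
Proof.
move=> mA; apply/eqP; rewrite eq_sym subr_eq addrC -pr_setT -(setUv A).
by rewrite prU ?setICr//; exact: measurableC.
Qed.

Lemma prID A B : measurable A -> measurable B ->
  pr A = pr (A `&` B) + pr (A `\` B).
Proof.
move=> mA mB; rewrite -prU; first by rewrite setUIDK.
- exact: measurableI.
- exact: measurableD.
- by rewrite setDE setIACA setICr setI0.
Qed.

Lemma pr_le_sum (I : eqType) (r : seq I) (A : set T) (B : I -> set T) :
  measurable A -> (forall i, measurable (B i)) ->
  (forall w, A w -> exists2 i, i \in r & B i w) ->
  pr A <= \sum_(i <- r) pr (B i).
Proof.
move=> mA mB AB; rewrite -(Ex_indic mA).
under eq_bigr do rewrite -Ex_indic//.
rewrite -Ex_sum; last by move=> i; exact: bounded_rv_indic.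
apply: le_Ex; first exact: bounded_rv_indic.
  by apply: bounded_rv_sum => i; exact: bounded_rv_indic.
move=> w; rewrite indicE; case: (boolP (w \in A)) => [/set_mem/AB[i ir Bi]|_].
  rewrite (big_rem i)//= {1}indicE mem_set// lerDl.
  by apply: sumr_ge0 => j _; rewrite indicE.
by apply: sumr_ge0 => j _; rewrite indicE.
Qed.

Lemma sum_le_pr (I : eqType) (r : seq I) (A : set T) (B : I -> set T) :
  measurable A -> (forall i, measurable (B i)) -> uniq r ->
  (forall i w, i \in r -> B i w -> A w) ->
  (forall i j w, i \in r -> j \in r -> B i w -> B j w -> i = j) ->
  \sum_(i <- r) pr (B i) <= pr A.
Proof.
move=> mA mB ur BA Bij; rewrite -(Ex_indic mA).
under eq_bigr do rewrite -Ex_indic//.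
rewrite -Ex_sum; last by move=> i; exact: bounded_rv_indic.
apply: le_Ex => [||w].
- by apply: bounded_rv_sum => i; exact: bounded_rv_indic.
- exact: bounded_rv_indic.
have [[i ir Bi]|nB] := pselect (exists2 i, i \in r & B i w).
  rewrite (big_rem i)//= !indicE mem_set// mem_set; last exact: BA Bi.
  rewrite big1_seq ?addr0// => j /= jr; rewrite indicE memNset// => Bj.
  have jr' : j \in r by exact: mem_rem jr.
  by move: jr; rewrite (Bij _ _ _ ir jr' Bi Bj) mem_rem_uniq// inE eqxx.
rewrite big1_seq; first by rewrite indicE.
by move=> j /= jr; rewrite indicE memNset// => Bj; apply: nB; exists j.
Qed.

Lemma measurable_gt f (mf : measurable_fun setT f) r : measurable [set w | r < f w].
Proof.
rewrite (_ : [set _ | _] = f @^-1` `]r, +oo[%classic).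
  by rewrite -[X in measurable X]setTI; exact: mf.
by apply/seteqP; split=> w; rewrite /= in_itv/= andbT.
Qed.

Lemma measurable_ge f (mf : measurable_fun setT f) r : measurable [set w | r <= f w].
Proof.
rewrite (_ : [set _ | _] = f @^-1` `[r, +oo[%classic).
  by rewrite -[X in measurable X]setTI; exact: mf.
by apply/seteqP; split=> w; rewrite /= in_itv/= andbT.
Qed.

Lemma measurable_le f (mf : measurable_fun setT f) r : measurable [set w | f w <= r].
Proof.
rewrite (_ : [set _ | _] = ~` [set w | r < f w]); first exact/measurableC/measurable_gt.
by apply/seteqP; split=> w /=; rewrite leNgt => /negP.
Qed.

Lemma measurable_between f (mf : measurable_fun setT f) s t :
  measurable [set w | s < f w <= t].
Proof.
rewrite (_ : [set _ | _] = f @^-1` `]s, t]%classic).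
  by rewrite -[X in measurable X]setTI; exact: mf.
by apply/seteqP; split=> w; rewrite /= in_itv.
Qed.

Lemma pr_between f (mf : measurable_fun setT f) s t : s <= t ->
  pr [set w | s < f w <= t] = pr [set w | s < f w] - pr [set w | t < f w].
Proof.
move=> st; apply/eqP; rewrite eq_sym subr_eq; apply/eqP; rewrite -prU//.
- congr pr; apply/seteqP; split=> w /=.
    by move=> ->; have [] := ltP t (f w); [right|left].
  by move=> [/andP[]//|/(le_lt_trans st)].
- exact: measurable_between.
- exact: measurable_gt.
- by apply/seteqP; split=> w //= [/andP[_ ft]]; rewrite ltNge ft.
Qed.

End bounded_expectation.

(** * The tail of a coordinate of a uniform point of the sphere *)

Section positive_part.
Context {R : realType}.
Implicit Types x d y h t : R.

Definition pos x : R := Num.max x 0.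

Lemma pos_id x : 0 <= x -> pos x = x. Proof. by move=> x0; exact: max_l. Qed.
Lemma pos0 x : x <= 0 -> pos x = 0. Proof. by move=> x0; exact: max_r. Qed.
Lemma pos_ge0 x : 0 <= pos x. Proof. by rewrite /pos le_max lexx orbT. Qed.
Lemma pos_le x c : 0 <= c -> x <= c -> pos x <= c.
Proof. by move=> c0 xc; rewrite /pos ge_max xc c0. Qed.

(** The cube of the positive part is twice differentiable with second derivative [6 * pos x], which
    is 6-Lipschitz; the third-order remainder therefore has constant 6 / 3! = 1, even across the
    kink at 0. *)
Lemma pos_cube_taylor x d :
  `|pos (x + d) ^+ 3 - pos x ^+ 3 - 3 * d * pos x ^+ 2 - 3 * d ^+ 2 * pos x|
  <= `|d| ^+ 3.
Proof.
have cube (a b : R) : 0 <= a -> a <= b -> a ^+ 3 <= b ^+ 3.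
  by move=> a0 ab; rewrite lerXn2r// nnegrE// (le_trans a0).
have [x0|x0] := leP 0 x; have [xd0|xd0] := leP 0 (x + d).
- rewrite !pos_id// -normrX le_eqVlt; apply/orP; left; apply/eqP; congr `|_|.
  by ring.
- rewrite (pos_id x0) (pos0 (ltW xd0)) (ler0_norm (_ : d <= 0)); last by lra.
  rewrite (_ : _ - _ = (- (x + d)) ^+ 3 - (- d) ^+ 3); last by ring.
  have := cube (- (x + d)) (- d) ltac:(lra) ltac:(lra).
  have : 0 <= (- (x + d)) ^+ 3 by rewrite exprn_ge0//; lra.
  by move=> h1 h2; rewrite ler0_norm; lra.
- rewrite (pos_id xd0) (pos0 (ltW x0)) !expr0n/= !mulr0 !subr0.
  by rewrite normrX cube// ger0_norm// ger0_norm; lra.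
- by rewrite (pos0 (ltW xd0)) (pos0 (ltW x0)) !expr0n/= !mulr0 !subr0 normr0 exprn_ge0.
Qed.

(** The constant 7 is 3 * 2 from the quadratic Taylor term plus 1 from the remainder. The range
    [|y| <= 2] is that of [X w - t] with both terms in [-1, 1]. *)
Lemma pos_cube_deriv y h : `|y| <= 2 -> `|h| <= 1 ->
  `|pos (y - h) ^+ 3 - pos y ^+ 3 + 3 * h * pos y ^+ 2| <= 7 * h ^+ 2.
Proof.
move=> y2 h1; have := pos_cube_taylor y (- h).
set D := _ - 3 * (- h) ^+ 2 * pos y => DE.
rewrite (_ : _ + 3 * h * _ = D + 3 * h ^+ 2 * pos y); last by rewrite /D; ring.
rewrite (le_trans (ler_normD _ _))//.
have p2 : pos y <= 2 by apply: pos_le => //; rewrite (le_trans (ler_norm _)).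
have : `|h| ^+ 3 <= h ^+ 2.
  by rewrite -[X in _ <= X]real_normK ?num_real// [_ ^+ 3]exprS ler_piMl// exprn_ge0.
rewrite [`|3 * _ * _|]ger0_norm; last first.
  by apply: mulr_ge0 (pos_ge0 _); apply: mulr_ge0 => //; exact: sqr_ge0.
have := sqr_ge0 h; have := pos_ge0 y; rewrite normrN in DE.
by nra.
Qed.

Lemma pos_sqr_deriv y h :
  `|pos (y - h) ^+ 2 - pos y ^+ 2 + 2 * h * pos y| <= h ^+ 2.
Proof.
have [y0|y0] := leP 0 y; have [yh|yh] := leP 0 (y - h).
- by rewrite !pos_id// (_ : _ + _ = h ^+ 2) ?ger0_norm ?sqr_ge0//; ring.
- rewrite (pos_id y0) (pos0 (ltW yh)) ler_norml.
  by apply/andP; split; nra.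
- by rewrite (pos0 (ltW y0)) (pos_id yh) ler_norml; apply/andP; split; nra.
- rewrite (pos0 (ltW y0)) (pos0 (ltW yh)) expr0n/= subr0 mulr0 addr0 normr0.
  exact: sqr_ge0.
Qed.

(** An expectation is differentiated by expanding its integrand with a uniform quadratic error; no
    exchange of limit and integral is then needed. *)
Lemma is_derive_quad (f : R -> R) (x l C e : R) : 0 < e ->
  (forall h, `|h| <= e -> `|f (x + h) - f x - h * l| <= C * h ^+ 2) ->
  is_derive x 1 f l.
Proof.
move=> e0 fq.
have cf : (fun h : R => h^-1 *: (f (h *: (1 : R^o) + x) - f x)) @ 0^' --> l.
  have C0 : 0 <= C.
    have := fq e; rewrite (ger0_norm (ltW e0)) => /(_ (lexx _)) /(le_trans (normr_ge0 _)).
    by rewrite (pmulr_lge0 _ (exprn_gt0 2 e0)).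
  apply/cvgrPdist_le => /= d d0.
  near=> h.
  have h0 : h != 0 by near: h; exact: nbhs_dnbhs_neq.
  rewrite [h *: _]mulr1 distrC /GRing.scale/= -[l in _ - l](mulKf h0) -mulrBr normrM normfV.
  rewrite ler_pdivrMl ?normr_gt0// (addrC h).
  apply: (le_trans (fq h _)).
    by near: h; apply: dnbhs0_le.
  rewrite -real_normK ?num_real// expr2 mulrA [C * _]mulrC -mulrA ler_pM2l ?normr_gt0//.
  have : `|h| <= d / (C + 1) by near: h; apply: dnbhs0_le; rewrite divr_gt0// ltr_wpDl.
  rewrite ler_pdivlMr ?ltr_wpDl// => hd; have := normr_ge0 h; nra.
apply: DeriveDef; first by apply/cvg_ex; exists l.
exact: (@cvg_lim R^o).
Unshelve. all: by end_near. Qed.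

Lemma is_derive_lin_approx (f : R -> R) (x l e : R) : is_derive x 1 f l -> 0 < e ->
  exists2 r, 0 < r & forall h, `|h| <= r -> `|f (x + h) - f x - h * l| <= e * `|h|.
Proof.
move=> [df dl] e0; rewrite -dl; move: df => /cvgrPdist_le/(_ _ e0)/nbhs_ballP[r /= r0 fr].
exists (r / 2) => [|h hr]; first by rewrite divr_gt0.
have [->|h0] := eqVneq h 0; first by rewrite addr0 subrr mul0r subr0 normr0 mulr0.
have : ball 0 r h by rewrite /ball/= sub0r normrN (le_lt_trans hr)// ltr_pdivrMr// ltr_pMr// ltr1n.
move=> /fr/(_ h0); rewrite [h *: _]mulr1 distrC (addrC h) /GRing.scale/=.
rewrite -[D in `|_ - D| <= e -> _](mulKf h0) -mulrBr normrM normfV.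
by rewrite ler_pdivrMl ?normr_gt0// [e * _]mulrC [h * lim _]mulrC.
Qed.

Lemma is_derive_right_ge (f : R -> R) (x l c : R) : is_derive x 1 f l ->
  (forall h, 0 < h -> c * h <= f (x + h) - f x) -> c <= l.
Proof.
move=> df fc; apply/ler_addgt0Pr => e e0.
have [r r0 /(_ r)] := is_derive_lin_approx df e0.
rewrite gtr0_norm// => /(_ (lexx _)); rewrite ler_norml => /andP[_ h1].
have := fc _ r0 => h2; rewrite -(ler_pM2r r0); nra.
Qed.

Lemma is_derive_left_le (f : R -> R) (x l c : R) : is_derive x 1 f l ->
  (forall h, 0 < h -> f x - f (x - h) <= c * h) -> l <= c.
Proof.
move=> df fc; apply/ler_addgt0Pr => e e0.
have [r r0 /(_ (- r))] := is_derive_lin_approx df e0.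
rewrite normrN gtr0_norm// => /(_ (lexx _)); rewrite ler_norml => /andP[_ h1].
have := fc _ r0 => h2; rewrite -(ler_pM2r r0); nra.
Qed.

End positive_part.

(** * Differential equations for truncated moments and the tail *)

Section tail_equations.
Context d (T : measurableType d) (R : realType) (P : probability T R).
Variables (X : T -> R) (m : R).
Hypotheses (mX : measurable_fun setT X) (X1 : forall w, `|X w| <= 1).

Definition pos_moment (k : nat) (t : R) : R := Ex P (fun w => pos (X w - t) ^+ k).
Definition tail (t : R) : R := pr P [set w | t < X w].

Local Notation A := pos_moment.
Local Notation G := tail.

Lemma bounded_rv_X : bounded_rv X.
Proof. by split => //; exists 1. Qed.

Lemma bounded_rv_pos (f : T -> R) : bounded_rv f -> bounded_rv (fun w : T => pos (f w)).
Proof.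
move=> [mf [M fM]]; split; first exact: measurable_maxr.
exists M => w; rewrite (ger0_norm (pos_ge0 _)) (le_trans _ (fM w))//.
by apply: pos_le => //; exact: ler_norm.
Qed.

Lemma bounded_rv_pos_moment k t : bounded_rv (fun w => pos (X w - t) ^+ k).
Proof.
apply/bounded_rvX/bounded_rv_pos/bounded_rvB; first exact: bounded_rv_X.
exact: bounded_rv_cst.
Qed.
Hint Resolve bounded_rv_pos_moment : core.

Lemma bounded_rv_pos_moment1 t : bounded_rv (fun w => pos (X w - t)).
Proof. exact: (bounded_rv_pos_moment 1). Qed.
Hint Resolve bounded_rv_pos_moment1 : core.

Lemma is_derive_pos_moment2 (t : R) : is_derive t 1 (A 2) (- 2 * A 1 t).
Proof.
apply: (@is_derive_quad _ _ _ _ 1 1) => // h _.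
rewrite (_ : _ - _ =
    Ex P (fun w => pos (X w - t - h) ^+ 2 - pos (X w - t) ^+ 2 + 2 * h * pos (X w - t))).
  rewrite mul1r; apply: norm_Ex_le => [|w]; last exact: pos_sqr_deriv.
  under eq_fun do rewrite -[_ - _ - h]addrA -opprD.
  by apply: bounded_rvD; [exact: bounded_rvB|exact: bounded_rvZ].
under [in RHS]eq_fun do rewrite -[_ - _ - h]addrA -opprD.
rewrite ExD; [|exact: bounded_rvB|exact: bounded_rvZ].
by rewrite ExB// ExZ// /A; ring.
Qed.

Lemma is_derive_pos_moment3 (t : R) : `|t| <= 1 -> is_derive t 1 (A 3) (- 3 * A 2 t).
Proof.
move=> t1; apply: (@is_derive_quad _ _ _ _ 7 1) => // h h1.
rewrite (_ : _ - _ =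
    Ex P (fun w => pos (X w - t - h) ^+ 3 - pos (X w - t) ^+ 3 + 3 * h * pos (X w - t) ^+ 2)).
  apply: norm_Ex_le => [|w].
    under eq_fun do rewrite -[_ - _ - h]addrA -opprD.
    by apply: bounded_rvD; [exact: bounded_rvB|exact: bounded_rvZ].
  apply: pos_cube_deriv => //.
  by rewrite (le_trans (ler_normB _ _))// -[2]/(1 + 1) lerD.
under [in RHS]eq_fun do rewrite -[_ - _ - h]addrA -opprD.
rewrite ExD; [|exact: bounded_rvB|exact: bounded_rvZ].
by rewrite ExB// ExZ// /A; ring.
Qed.

(* The Stein equation [E[(1 - X^2) f'(X)] = (m - 1) E[X f(X)]] for [f x = ((x - t)^+)^2]. *)
Hypothesis stein : forall t, (1 - t ^+ 2) * A 1 t =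
  (m + 3) / 2 * t * A 2 t + (m + 1) / 2 * A 3 t.

Lemma sqr_lt1 t : `|t| < 1 -> 0 < 1 - t ^+ 2 :> R.
Proof. by move=> t1; rewrite subr_gt0 -real_normK ?num_real// expr_lt1. Qed.

Lemma near_lt1 (t : R) : `|t| < 1 -> \forall x \near t, `|x| < 1.
Proof.
move=> t1; near=> x.
rewrite -(subrK t x) (le_lt_trans (ler_normD _ _))// -ltrBrDr distrC.
by near: x; apply: cvgr_dist_lt => //; rewrite subr_gt0.
Unshelve. all: by end_near. Qed.

Lemma is_derive_inv_1Bsqr (t : R) : `|t| < 1 ->
  is_derive t 1 (fun x : R => (1 - x ^+ 2)^-1) (2 * t / (1 - t ^+ 2) ^+ 2).
Proof.
move=> t1; have t0 := lt0r_neq0 (sqr_lt1 t1).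
have h : is_derive t 1 (fun x : R => 1 - x ^+ 2) (- (2 * t)).
  rewrite (_ : (fun _ => _) = cst 1 - (@id R) ^+ 2); last by apply/funext.
  by apply: is_derive_eq; rewrite scaler1 /GRing.scale/=; ring.
have -> : 2 * t / (1 - t ^+ 2) ^+ 2 = - ((1 - t ^+ 2) ^- 2) *: (- (2 * t)).
  by rewrite /GRing.scale/= mulrNN mulrC.
exact: is_deriveV.
Qed.

(** The integrand of [A 1] has a kink in [t], so the expansion that serves for [A 2] and [A 3] fails
    here. The Stein equation replaces [A 1] by a combination of these two, which are
    differentiable. *)
Lemma is_derive_pos_moment1 (t : R) : `|t| < 1 ->
  is_derive t 1 (A 1) (- (((m + 1) * t * A 1 t + m * A 2 t) / (1 - t ^+ 2))).
Proof.
move=> t1; have t0 := lt0r_neq0 (sqr_lt1 t1).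
pose f : R -> R := (((m + 3) / 2) *: ((@id R) * A 2) + ((m + 1) / 2) *: A 3) *
  (fun x : R => (1 - x ^+ 2)^-1).
apply: (@near_eq_is_derive _ _ _ f).
  near=> x.
  have x1 : `|x| < 1 by near: x; exact: near_lt1.
  have -> : f x = ((m + 3) / 2 * x * A 2 x + (m + 1) / 2 * A 3 x) / (1 - x ^+ 2).
    by rewrite /f/= -[_ * x * _]mulrA.
  by rewrite -stein mulrC mulKf// lt0r_neq0// sqr_lt1.
have d2 := is_derive_pos_moment2 t.
have d3 := is_derive_pos_moment3 (ltW t1).
have di := is_derive_inv_1Bsqr t1.
have := is_deriveM (is_deriveD (is_deriveZ ((m + 3) / 2) (is_deriveM (is_derive_id t (1 : R)) d2))
  (is_deriveZ ((m + 1) / 2) d3)) di.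
move=> /is_derive_eq; apply; set a3 := A 3 t; set a2 := A 2 t.
transitivity (((m + 3) / 2 * t * a2 + (m + 1) / 2 * a3) * (2 * t / (1 - t ^+ 2) ^+ 2) +
    (1 - t ^+ 2)^-1 * ((m + 3) / 2 * (t * (- 2 * A 1 t) + a2) + (m + 1) / 2 * (- 3 * a2))).
  by rewrite -[_ * t * a2]mulrA -[X in _ * (_ + X)]mulr1.
by rewrite -stein -/a2; field.
Unshelve. all: by end_near. Qed.

(* The tail is squeezed between the one-sided difference quotients of [A 1], which the
   Stein equation shows to be differentiable; in particular the law has no atom. *)
Lemma tail_derive_eq t : `|t| < 1 ->
  G t = ((m + 1) * t * A 1 t + m * A 2 t) / (1 - t ^+ 2) /\
  pr P [set w | t <= X w] = G t.
Proof.
move=> t1; have dA := is_derive_pos_moment1 t1.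
set l := _ / _ in dA *.
have lG : l <= G t.
  rewrite -lerN2; apply: is_derive_right_ge dA _ => h h0.
  rewrite mulrC -lerN2 mulrN opprB opprK -ExB// /G -Ex_indic; last exact: measurable_gt.
  rewrite -ExZ; last by apply: bounded_rv_indic; exact: measurable_gt.
  apply: le_Ex => [||w]; first exact: bounded_rvB.
    by apply/bounded_rvZ/bounded_rv_indic; exact: measurable_gt.
  rewrite !expr1 indicE opprD addrA; have [tX|Xt] := ltP t (X w).
    rewrite mem_set// mulr1 (@pos_id _ (X w - t)); last by lra.
    suff : X w - t - h <= pos (X w - t - h) by lra.
    by rewrite /pos le_max lexx.
  rewrite memNset ?mulr0; last by apply/negP; rewrite -leNgt.
  by rewrite !pos0// ?subrr//; lra.
have Gl : pr P [set w | t <= X w] <= l.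
  rewrite -lerN2; apply: is_derive_left_le dA _ => h h0.
  rewrite mulrC -lerN2 mulrN opprB opprK -ExB// -Ex_indic; last exact: measurable_ge.
  rewrite -ExZ; last by apply: bounded_rv_indic; exact: measurable_ge.
  apply: le_Ex => [||w]; last 1 first.
  - rewrite !expr1 indicE; have [tX|Xt] := leP t (X w).
      rewrite mem_set// mulr1 /= !pos_id; lra.
    rewrite memNset ?mulr0; last by apply/negP; rewrite -ltNge.
    by rewrite (@pos0 _ (X w - t)) ?subr0 ?pos_ge0//; lra.
  - by apply/bounded_rvZ/bounded_rv_indic; exact: measurable_ge.
  - exact: bounded_rvB.
have GG : G t <= pr P [set w | t <= X w].
  by apply: le_pr => [||w /ltW//]; [exact: measurable_gt|exact: measurable_ge].
by split; apply/eqP; rewrite eq_le; apply/andP; split => //; rewrite (le_trans GG, le_trans Gl).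
Qed.

Lemma tailE t : `|t| < 1 -> G t = ((m + 1) * t * A 1 t + m * A 2 t) / (1 - t ^+ 2).
Proof. by move=> /tail_derive_eq[]. Qed.

Lemma tail_geE t : `|t| < 1 -> pr P [set w | t <= X w] = G t.
Proof. by move=> /tail_derive_eq[]. Qed.

(** Regularity is gained a second time: [tailE] writes the tail through [A 1] and [A 2], both
    differentiable by now. Dividing by [G t] gives the hazard rate, in which only the ratio of [A 1]
    to [G] remains to be estimated. *)
Lemma is_derive_tail (t : R) : `|t| < 1 ->
  is_derive t 1 G (- ((m - 1) / (1 - t ^+ 2) * (t * G t + A 1 t))).
Proof.
move=> t1; have t0 := lt0r_neq0 (sqr_lt1 t1).
pose f : R -> R := ((m + 1) *: ((@id R) * A 1) + m *: A 2) *
  (fun x : R => (1 - x ^+ 2)^-1).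
have fE x : f x = ((m + 1) * x * A 1 x + m * A 2 x) / (1 - x ^+ 2).
  by rewrite /f/= -[_ * x * _]mulrA.
apply: (@near_eq_is_derive _ _ _ f).
  near=> x.
  have x1 : `|x| < 1 by near: x; exact: near_lt1.
  by rewrite tailE.
have d2 := is_derive_pos_moment2 t.
have d1 := is_derive_pos_moment1 t1.
have di := is_derive_inv_1Bsqr t1.
have := is_deriveM (is_deriveD (is_deriveZ (m + 1) (is_deriveM (is_derive_id t (1 : R)) d1))
  (is_deriveZ m d2)) di.
move=> /is_derive_eq; apply; rewrite -tailE//; set a1 := A 1 t; set a2 := A 2 t.
transitivity (((m + 1) * t * a1 + m * a2) * (2 * t / (1 - t ^+ 2) ^+ 2) +
    (1 - t ^+ 2)^-1 * ((m + 1) * (t * - G t + a1) + m * (- 2 * a1))).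
  by rewrite -[_ * t * a1]mulrA -[X in _ * (_ + X)]mulr1.
have -> : (m + 1) * t * a1 + m * a2 = G t * (1 - t ^+ 2) by rewrite tailE// mulfVK.
by field.
Unshelve. all: by end_near. Qed.

End tail_equations.

(* The two-sided bound integrates estimates of the hazard rate [- H' / H]. *)
Definition regular_tail (R : realType) (m : R) (H : R -> R) : Prop :=
  [/\ H 0 = 1, {within `[0, 2^-1], continuous H},
     forall v, 0 <= v <= 2^-1 -> 0 < H v &
     forall u v, 0 <= u -> u < v -> v <= 2^-1 ->
       (m - 1) * u * (v - u) <= ln (H u) - ln (H v) <=
       (m - 1) / (1 - v ^+ 2) * (v + (Num.sqrt m)^-1) * (v - u)].

(** * Bounds for the hazard rate of a symmetric variable *)

Section tail_bounds.
Context d (T : measurableType d) (R : realType) (P : probability T R).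
Variables (X : T -> R) (m : R).
Hypotheses (mX : measurable_fun setT X) (X1 : forall w, `|X w| <= 1).
Hypothesis m1 : 1 <= m.
Hypothesis stein : forall t, (1 - t ^+ 2) * pos_moment P X 1 t =
  (m + 3) / 2 * t * pos_moment P X 2 t + (m + 1) / 2 * pos_moment P X 3 t.
Hypothesis X_sym : forall t, pr P [set w | t < - X w] = pr P [set w | t < X w].

Local Notation A := (pos_moment P X).
Local Notation G := (tail P X).
Local Notation s := (Num.sqrt m).

Let m0 : 0 < m. Proof. exact: lt_le_trans m1. Qed.
Let s0 : 0 < s. Proof. by rewrite sqrtr_gt0. Qed.
Let ss : s * s = m. Proof. by rewrite -expr2 sqr_sqrtr// ltW. Qed.

Lemma pos_moment_ge0 k t : 0 <= A k t.
Proof. by apply: Ex_ge0 => w; rewrite exprn_ge0// pos_ge0. Qed.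

(* AM-GM: [2 s x^+ <= s^2 (x^+)^2 + 1_(x > 0)], and [tailE] bounds [s^2 A 2] by [G] *)
Lemma pos_moment1_le t : 0 <= t < 1 -> s * A 1 t <= G t.
Proof.
move=> /andP[t0 t1].
have nt1 : `|t| < 1 by rewrite ger0_norm.
have bA k := bounded_rv_pos_moment mX X1 k t.
have bG : bounded_rv (\1_[set w | t < X w] : T -> R).
  by apply: bounded_rv_indic; exact: measurable_gt.
have amgm : 2 * s * A 1 t <= m * A 2 t + G t.
  rewrite /A /G -Ex_indic; last exact: measurable_gt.
  rewrite -!ExZ// -ExD//; last exact: bounded_rvZ.
  apply: le_Ex => [||w]; [exact: bounded_rvZ|by apply: bounded_rvD => //; exact: bounded_rvZ|].
  rewrite expr1 indicE; have [tX|Xt] := ltP t (X w).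
    rewrite mem_set//; set y := pos _.
    have -> : m * y ^+ 2 = (s * y) ^+ 2 by rewrite exprMn [s ^+ 2]expr2 ss.
    rewrite -mulrA; have := sqr_ge0 (s * y - 1); move: (s * y) => z.
    by rewrite sqrrB1 /= mulr_natl => h; lra.
  by rewrite memNset ?pos0 ?expr0n/= ?mulr0 ?addr0 ?subr_le0//; apply/negP; rewrite -leNgt.
have := tailE mX X1 stein nt1 => /(congr1 ( *%R^~ (1 - t ^+ 2))) /=.
rewrite mulfVK ?lt0r_neq0 ?sqr_lt1// -/(G t) => GE.
have GG : 0 <= G t by exact: pr_ge0.
have := sqr_ge0 t; have := pos_moment_ge0 1 t => A1 t2.
have : 0 <= (m + 1) * t * A 1 t by rewrite !mulr_ge0// addr_ge0// ltW.
nra.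
Qed.

Let hz v := (m - 1) / (1 - v ^+ 2) * (v + s^-1).

(** Below, [A 1] and the factor [1 - t ^+ 2 <= 1] are dropped. Above, [A 1] is at most [G / s], and
    [t] is replaced by the right end [v] so that the rate is constant on the interval. *)
Lemma tail_derive_bounds t v : 0 <= t <= v -> v < 1 ->
  (m - 1) * t * G t <= (m - 1) / (1 - t ^+ 2) * (t * G t + A 1 t) <= hz v * G t.
Proof.
move=> /andP[t0 tv] v1.
have nt1 : `|t| < 1 by rewrite ger0_norm// (le_lt_trans tv).
have nv1 : `|v| < 1 by rewrite ger0_norm// (le_trans t0).
have GG : 0 <= G t by exact: pr_ge0.
have AA := pos_moment_ge0 1 t.
have tD := sqr_lt1 nt1; have vD := sqr_lt1 nv1.
have AG : A 1 t <= s^-1 * G t.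
  by rewrite ler_pdivlMl// pos_moment1_le// t0/= (le_lt_trans tv).
have mm : 0 <= m - 1 by rewrite subr_ge0.
apply/andP; split.
  rewrite -!mulrA ler_wpM2l// ler_pdivlMl//.
  have := sqr_ge0 t; have : 0 <= t * G t by exact: mulr_ge0.
  by nra.
rewrite /hz -!mulrA ler_wpM2l//.
have -> : (v + s^-1) * G t = v * G t + s^-1 * G t by rewrite mulrDl.
apply: ler_pM.
- by rewrite invr_ge0 ltW.
- by rewrite addr_ge0// mulr_ge0.
- rewrite lef_pV2 ?posrE// lerD2l lerN2 lerXn2r// nnegrE//; exact: le_trans tv.
- by rewrite lerD// ler_wpM2r.
Qed.

Lemma continuous_tail t : `|t| < 1 -> {for t, continuous G}.
Proof.
move=> t1; have [dG _] := is_derive_tail mX X1 stein t1.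
by apply: differentiable_continuous; apply/derivable1_diffP.
Qed.

Lemma within_continuous_itv (f : R -> R) (a b : R) :
  (forall t, a <= t <= b -> {for t, continuous f}) -> {within `[a, b], continuous f}.
Proof.
move=> fc; apply: continuous_in_subspaceT => t.
by rewrite inE/= in_itv/= => /fc.
Qed.

(** Symmetry splits the mass evenly because, by [tail_geE], there is no atom at 0. *)
Lemma tail0 : G 0 = 2^-1.
Proof.
have n01 : `|0 : R| < 1 by rewrite normr0.
have := tail_geE mX X1 stein n01.
rewrite (_ : [set _ | _] = ~` [set w | 0 < - X w]); last first.
  by apply/seteqP; split => w /=; rewrite oppr_gt0 leNgt => /negP.
rewrite prC ?X_sym; last by exact: measurable_gt (measurable_funN mX) _.
rewrite -/(G 0) => /eqP; rewrite subr_eq => /eqP h.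
by apply: (mulfI (_ : 2 != 0)) => //; rewrite mulfV// mulr_natl mulr2n.
Qed.

(** Positivity has to precede any use of [ln (G t)]. It follows from a Gronwall argument: the decay
    rate is at most [b] on [0, v], so [G t * expR (b * t)] is nondecreasing there and starts at
    1/2. *)
Lemma tail_gt0 v : 0 <= v < 1 -> 0 < G v.
Proof.
move=> /andP[v0 v1]; set b := hz v.
have [->|vn0] := eqVneq v 0; first by rewrite tail0.
have vp : 0 < v by rewrite lt_neqAle eq_sym vn0.
have lt1 t : 0 <= t <= v -> `|t| < 1.
  by move=> /andP[t0 tv]; rewrite ger0_norm// (le_lt_trans tv).
pose f : R -> R := G * (fun t => expR (b * t)).
have df t : t \in `]0, v[ -> is_derive t 1 f
    ((b * G t - (m - 1) / (1 - t ^+ 2) * (t * G t + A 1 t)) * expR (b * t)).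
  rewrite in_itv/= => /andP[t0 tv].
  have dG := is_derive_tail mX X1 stein (lt1 t _).
  have {}dG := dG ltac:(by rewrite !ltW).
  have de : is_derive t 1 (fun t : R => expR (b * t)) (b * expR (b * t)).
    have db : is_derive t 1 (b *: (@id R)) (b *: (1 : R)) by apply: is_deriveZ.
    by have := is_derive1_comp (is_derive_expR (b * t)) db; rewrite [b *: 1]mulr1 mulrC.
  apply: is_derive_eq.
  transitivity (G t * (b * expR (b * t)) +
    expR (b * t) * - ((m - 1) / (1 - t ^+ 2) * (t * G t + A 1 t))) => //.
  by ring.
have cf : {within `[0, v], continuous f}.
  apply: within_continuous_itv => t t0v.
  apply: continuousM; first by apply: continuous_tail; exact: lt1.
  apply: continuous_comp; last exact: continuous_expR.
  by apply: continuousM; [exact: cst_continuous|exact: id].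
have [c] := MVT vp df cf.
rewrite in_itv/= => /andP[c0 cv]; rewrite /f/= => fv.
have /andP[_] := @tail_derive_bounds c v ltac:(by rewrite !ltW) v1.
rewrite -subr_ge0 -/b => bc.
have : 0 <= G v * expR (b * v) - G 0 * expR (b * 0).
  by rewrite -[X in 0 <= X]/((G * (fun t => expR (b * t))) v - (G * (fun t => expR (b * t))) 0)
    fv !mulr_ge0 ?subr0// expR_ge0.
rewrite mulr0 expR0 mulr1 tail0 subr_ge0 => h.
by rewrite -(pmulr_lgt0 _ (expR_gt0 (b * v))) (lt_le_trans _ h).
Qed.

Lemma tail_ln_bounds u v : 0 <= u -> u < v -> v < 1 ->
  (m - 1) * u * (v - u) <= ln (G u) - ln (G v) <=
  (m - 1) / (1 - v ^+ 2) * (v + s^-1) * (v - u).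
Proof.
move=> u0 uv v1.
have G0 t : u <= t <= v -> 0 < G t.
  by move=> /andP[ut tv]; rewrite tail_gt0// (le_trans u0)// (le_lt_trans tv).
have lt1 t : u <= t <= v -> `|t| < 1.
  move=> /andP[ut tv]; rewrite ger0_norm ?(le_lt_trans tv)//; exact: le_trans ut.
pose df t := (G t)^-1 * - ((m - 1) / (1 - t ^+ 2) * (t * G t + A 1 t)).
have dln t : t \in `]u, v[ -> is_derive t 1 (fun t => ln (G t)) (df t).
  rewrite in_itv/= => /andP[ut tv].
  have tuv : u <= t <= v by rewrite !ltW.
  have dG := is_derive_tail mX X1 stein (lt1 t tuv).
  exact: is_derive1_comp (is_derive1_ln (G0 t tuv)) dG.
have cf : {within `[u, v], continuous (fun t => ln (G t))}.
  apply: within_continuous_itv => t tuv.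
  apply: continuous_comp; first by apply: continuous_tail; exact: lt1.
  by apply: continuous_ln; exact: G0.
have [c] := MVT uv dln cf.
rewrite in_itv/= => /andP[uc cv] cE.
have cuv : u <= c <= v by rewrite !ltW.
have /andP[h1 h2] := @tail_derive_bounds c v ltac:(by rewrite (le_trans u0) ltW) v1.
have -> : ln (G u) - ln (G v) = - df c * (v - u) by rewrite mulNr -cE opprB.
have vu : 0 <= v - u by rewrite subr_ge0 ltW.
rewrite /df mulrN opprK; apply/andP; split; apply: ler_wpM2r => //.
  rewrite ler_pdivlMl ?G0// (le_trans _ h1)// [G c * _]mulrC ler_wpM2r//; first exact/ltW/G0.
  by rewrite ler_wpM2l ?subr_ge0// ltW.
by rewrite ler_pdivrMl ?G0// [G c * _]mulrC.
Qed.

Lemma pr_norm_tail t : 0 <= t -> pr P [set w | t < `|X w|] = 2 * G t.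
Proof.
move=> t0; rewrite (_ : [set _ | _] = [set w | t < X w] `|` [set w | t < - X w]).
  rewrite prU ?X_sym.
  - by rewrite -/(G t) mulr_natl mulr2n.
  - exact: measurable_gt.
  - exact: measurable_gt (measurable_funN mX) _.
  - by apply/seteqP; split => w //= []; lra.
apply/seteqP; split => w /=; rewrite ltr_normr.
  by move=> /orP[]; [left|right].
by move=> [|] ->; rewrite ?orbT.
Qed.

Lemma regular_tail_two_sided : regular_tail m (fun t => 2 * G t).
Proof.
have h1 : 2^-1 < 1 :> R by rewrite invf_lt1// ltr1n.
split.
- by rewrite tail0 mulfV.
- apply: within_continuous_itv => t /andP[t0 t2].
  apply: continuousM; first exact: cst_continuous.
  by apply: continuous_tail; rewrite ger0_norm// (le_lt_trans t2).
- move=> v /andP[v0 v2]; rewrite mulr_gt0// tail_gt0// v0/=; exact: le_lt_trans h1.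
- move=> u v u0 uv v2.
  have v1 : v < 1 by exact: le_lt_trans h1.
  rewrite !lnM ?posrE ?tail_gt0 ?u0 ?(lt_trans uv)//; last by rewrite v1 (le_trans u0)// ltW.
  by rewrite opprD addrACA subrr add0r tail_ln_bounds.
Qed.

End tail_bounds.

(** * High quantiles *)

Definition regular_tails (R : realType) (H : nat -> R -> R) (N : nat -> R) : Prop :=
  [/\ \forall n \near \oo, regular_tail (n%:R - 1) (H n),
     N n @[n --> \oo] --> +oo & ln (N n) / n%:R @[n --> \oo] --> (0 : R)].

Definition quantile (R : realType) (H : nat -> R -> R) (N : nat -> R) (s : R) (v : nat -> R) :
  Prop := \forall n \near \oo, 0 < v n <= 2^-1 /\ N n * H n (v n) = s.

Lemma regular_tail_le1 (R : realType) (m : R) (f : R -> R) v : 1 <= m -> regular_tail m f ->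
  0 <= v <= 2^-1 -> ln (f v) <= 0.
Proof.
move=> m1 [f0 _ _ fb] /andP[v0 v2]; have [->|vn0] := eqVneq v 0; first by rewrite f0 ln1.
have /andP[] := fb 0 v (lexx _) ltac:(by rewrite lt_neqAle eq_sym vn0) v2.
by rewrite mulr0 mul0r f0 ln1 sub0r oppr_ge0.
Qed.

Lemma near_natr_ge (R : realType) (c : R) : \forall n \near \oo, c <= n%:R.
Proof. exact: nbhs_infty_ger. Qed.

(** Intermediate value theorem on [0, 1/2]. At the right end the hazard bound between 1/4 and 1/2
    gives [ln (H n 2^-1) <= - (n - 2) / 16], which beats [ln (N n) <= n / 64] together with the
    fixed [ln s]. *)
Lemma exists_quantile (R : realType) (H : nat -> R -> R) (N : nat -> R) (s : R) :
  regular_tails H N -> 0 < s -> \forall n \near \oo,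
  exists2 v, 0 < v <= 2^-1 & N n * H n v = s.
Proof.
move=> [H_regular N_infty ln_N] s0; near=> n.
have Hn : regular_tail (n%:R - 1) (H n) by near: n.
have n2 : 2 + 64 * (`|ln s| + 1) <= n%:R by near: n; exact: near_natr_ge.
have Ns : s < N n by near: n; move/cvgryPgt : N_infty; apply.
have lnN : `|ln (N n) / n%:R| <= 64^-1.
  near: n; have /cvgr0Pnorm_le := ln_N; apply.
  by rewrite invr_gt0.
have n0 : 0 < n%:R :> R by rewrite (lt_le_trans _ n2)// ltr_pwDl// mulr_ge0// addr_ge0.
have m1 : 1 <= n%:R - 1 :> R.
  by rewrite lerBrDr (le_trans _ n2)// lerDl mulr_ge0// addr_ge0.
have N0 : 0 < N n by exact: lt_trans Ns.
have [H0 Hc Hp Hb] := Hn.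
have Hs : N n * H n 2^-1 < s.
  have H2 : 0 < H n 2^-1 by apply: Hp; rewrite lexx invr_ge0 ler0n.
  rewrite -ltr_ln ?posrE ?mulr_gt0// lnM ?posrE//.
  have q0 : 0 <= (4^-1 : R) <= 2^-1 by clear; apply/andP; split; lra.
  have q2 : (4^-1 : R) < 2^-1 by clear; lra.
  have := @regular_tail_le1 _ _ _ _ m1 Hn q0.
  have /andP[+ _] := Hb 4^-1 2^-1 (proj1 (elimT andP q0)) q2 (lexx _).
  rewrite (_ : (_ - _) * _ * _ = (n%:R - 2) / 16); last by field.
  move: lnN; rewrite normrM normfV (ger0_norm (ltW n0)) ler_pdivrMr// => lnN.
  have := ler_norm (ln (N n)); have := ler_norm (- ln s); rewrite normrN.
  have := normr_ge0 (ln s); move: lnN n2.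
  move: (`|ln s|) (`|ln (N n)|) (ln s) (ln (N n)) (ln (H n 4^-1)) (ln (H n 2^-1)) n%:R.
  by clear => *; lra.
have [|||v] := @IVT R (H n) 0 2^-1 (s / N n).
- by rewrite invr_ge0.
- exact: Hc.
- rewrite H0 ge_min le_max [X in _ || X]ler_pdivlMr// [_ * N n]mulrC (ltW Hs) orbT/=.
  by rewrite ler_pdivrMr// mul1r (ltW Ns).
rewrite in_itv/= => /andP[v0 v2] vE.
exists v; last by rewrite vE mulrCA mulfV ?mulr1// gt_eqF.
rewrite v2 andbT lt_neqAle v0 andbT; apply/eqP => v0E.
by move: vE; rewrite -v0E H0 => /esym/divr1_eq sN; move: Ns; rewrite sN ltxx.
Unshelve. all: by end_near. Qed.

Lemma quantile_ln (R : realType) (H : nat -> R -> R) (N : nat -> R)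
  (s : R) (v : nat -> R) : regular_tails H N -> 0 < s -> quantile H N s v ->
  \forall n \near \oo, - ln (H n (v n)) = ln (N n) - ln s.
Proof.
move=> HN s0 v_quantile; have [H_regular N_infty ln_N] := HN.
near=> n.
have [/andP[v0 v2] <-] : 0 < v n <= 2^-1 /\ N n * H n (v n) = s by near: n.
have [_ _ Hp _] : regular_tail (n%:R - 1) (H n) by near: n.
have N0 : 0 < N n by near: n; move/cvgryPgt : N_infty; apply.
have Hv := Hp (v n) ltac:(by rewrite ltW).
by rewrite lnM ?posrE// opprD addrA subrr sub0r.
Unshelve. all: by end_near. Qed.

(** The lower hazard bound between v / 2 and v gives (n - 2) v^2 / 4 <= - ln H(v) = ln N - ln s, and
    the right-hand side is o(n). *)
Lemma quantile_cvg0 (R : realType) (H : nat -> R -> R) (N : nat -> R)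
  (s : R) (v : nat -> R) : regular_tails H N -> 0 < s -> quantile H N s v ->
  v n @[n --> \oo] --> (0 : R).
Proof.
move=> HN s0 v_quantile; have [H_regular N_infty ln_N] := HN.
(* Both ln N and - ln s will be at most c n, while (n - 2) v^2 / 4 is at least n v^2 / 8 once n >=
   4; hence 16 = 2 * 8. *)
apply/cvgr0Pnorm_le => e e0; pose c := e ^+ 2 / 16.
have c0 : 0 < c by rewrite divr_gt0// exprn_gt0.
near=> n.
have [/andP[v0 v2] _] : 0 < v n <= 2^-1 /\ N n * H n (v n) = s by near: n.
have Hn : regular_tail (n%:R - 1) (H n) by near: n.
have lE : - ln (H n (v n)) = ln (N n) - ln s by near: n; exact: quantile_ln HN s0 v_quantile.
have lnN : `|ln (N n) / n%:R| <= c by near: n; have /cvgr0Pnorm_le := ln_N; apply.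
have n2 : 4 <= n%:R :> R by near: n; exact: near_natr_ge.
have nc : `|ln s| / c <= n%:R by near: n; exact: near_natr_ge.
have [H0 _ _ Hb] := Hn.
have q0 : 0 <= v n / 2 <= 2^-1 by move: v0 v2; clear => *; lra.
have q1 : v n / 2 < v n by move: v0; clear => *; lra.
have m1 : 1 <= n%:R - 1 :> R by move: n2; clear => *; lra.
have /andP[+ _] := Hb (v n / 2) (v n) (proj1 (elimT andP q0)) q1 v2.
have := @regular_tail_le1 _ _ _ _ m1 Hn q0.
rewrite ler_pdivrMr// in nc; have := ler_norm (- ln s); rewrite normrN => ls.
move: lnN; rewrite normrM normfV (@ger0_norm _ n%:R) ?ler_pdivrMr//; last first.
  by move: n2; clear => *; lra.
have := ler_norm (ln (N n)) => lN lnN h1 h2.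
rewrite (ger0_norm (ltW v0)) -(@ler_pXn2r _ 2) ?nnegrE//; [|exact: ltW|exact: ltW].
have h3 : n%:R * v n ^+ 2 <= n%:R * e ^+ 2.
  have : c * n%:R = n%:R * e ^+ 2 / 16 by rewrite /c; field.
  have v20 := sqr_ge0 (v n).
  have E1 : (n%:R - 1 - 1) * (v n / 2) * (v n - v n / 2) = (n%:R - 2) * v n ^+ 2 / 4 by field.
  have E2 : 4 * v n ^+ 2 <= n%:R * v n ^+ 2 by rewrite ler_wpM2r.
  have E3 : (n%:R - 2) * v n ^+ 2 = n%:R * v n ^+ 2 - 2 * v n ^+ 2 by ring.
  move: h1 h2 lE lnN lN nc ls E2 v20; rewrite E1 E3.
  move: (ln (N n)) (ln s) (ln (H n (v n))) (ln (H n (v n / 2))) (`|ln (N n)|) (`|ln s|).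
  move: (n%:R * v n ^+ 2) (v n ^+ 2) (n%:R * e ^+ 2) => a b a'.
  rewrite [_ * c]mulrC; move: (c * n%:R); clear => *; lra.
by rewrite -(@ler_pM2l _ n%:R)//; move: n2; clear => *; lra.
Unshelve. all: by end_near. Qed.

(** If sqrt (n - 1) v stayed below B, the upper hazard bound between 0 and v would bound - ln H(v)
    by 2 (B^2 + B), whereas this quantity is ln N - ln s and tends to infinity. *)
Lemma quantile_sqrt_cvgy (R : realType) (H : nat -> R -> R) (N : nat -> R)
  (s : R) (v : nat -> R) : regular_tails H N -> 0 < s -> quantile H N s v ->
  Num.sqrt (n%:R - 1) * v n @[n --> \oo] --> +oo.
Proof.
move=> HN s0 v_quantile; have [H_regular N_infty ln_N] := HN.
apply/cvgryPge => B; near=> n.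
have [/andP[v0 v2] _] : 0 < v n <= 2^-1 /\ N n * H n (v n) = s by near: n.
have [H0 _ _ Hb] : regular_tail (n%:R - 1) (H n) by near: n.
have lE : - ln (H n (v n)) = ln (N n) - ln s by near: n; exact: quantile_ln HN s0 v_quantile.
have n2 : 4 <= n%:R :> R by near: n; exact: near_natr_ge.
have lnN : expR (ln s + 2 * (`|B| ^+ 2 + `|B|)) < N n by near: n; move/cvgryPgt : N_infty; apply.
have {}lnN : ln s + 2 * (`|B| ^+ 2 + `|B|) < ln (N n).
  by rewrite -[ltLHS]expRK ltr_ln ?posrE ?expR_gt0// (lt_trans _ lnN)// expR_gt0.
rewrite leNgt; apply/negP => yB.
have /andP[_] := Hb 0 (v n) (lexx _) v0 v2.
rewrite H0 ln1 sub0r lE subr0.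
set q := Num.sqrt _ in yB *.
have m0 : 0 < n%:R - 1 :> R by move: n2; clear => *; lra.
have q0 : 0 < q by rewrite sqrtr_gt0.
have qq : q ^+ 2 = n%:R - 1 by rewrite sqr_sqrtr// ltW.
have yB' : q * v n <= `|B| by rewrite (le_trans (ltW yB))// ler_norm.
apply/negP; rewrite -ltNge.
(* The factor 2 absorbs 1 / (1 - v^2), which is at most 4 / 3 for v <= 1/2. *)
have : (n%:R - 1 - 1) / (1 - v n ^+ 2) * (v n + q^-1) * v n <=
    2 * ((q * v n) ^+ 2 + q * v n).
  have -> : 2 * ((q * v n) ^+ 2 + q * v n) = 2 * q ^+ 2 * (v n + q^-1) * v n.
    by field; rewrite gt_eqF.
  rewrite !ler_pM2r//; last by rewrite addr_gt0// invr_gt0.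
  have v22 : v n ^+ 2 <= 4^-1 by move: v0 v2; clear => *; nra.
  rewrite qq ler_pdivrMr; last by move: v22; clear => *; lra.
  move: v22 m0; clear => *; nra.
have : (q * v n) ^+ 2 <= `|B| ^+ 2 by rewrite lerXn2r// nnegrE// mulr_ge0// ltW.
move: lnN yB'; move: (q * v n) (ln s) (`|B|) (ln (N n)) (_ / _ * _ * _).
by clear => *; lra.
Unshelve. all: by end_near. Qed.

Lemma quantile_shift_ge0 (R : realType) (H : nat -> R -> R) (N : nat -> R)
  (s x : R) (v : nat -> R) : regular_tails H N -> 0 < s -> quantile H N s v -> 0 <= x ->
  \forall n \near \oo, 0 <= v n - x / (n%:R * v n).
Proof.
move=> HN s0 v_quantile x0; have [H_regular N_infty ln_N] := HN.
near=> n.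
have [/andP[v0 v2] _] : 0 < v n <= 2^-1 /\ N n * H n (v n) = s by near: n.
have yB : x + 1 <= Num.sqrt (n%:R - 1) * v n.
  by near: n; move/cvgryPge : (quantile_sqrt_cvgy HN s0 v_quantile); apply.
have n2 : 4 <= n%:R :> R by near: n; exact: near_natr_ge.
have n0 : 0 < n%:R :> R by move: n2; clear => *; lra.
rewrite subr_ge0 ler_pdivrMr ?mulr_gt0//.
set q := Num.sqrt _ in yB.
have qq : q ^+ 2 = n%:R - 1 by rewrite sqr_sqrtr//; move: n2; clear => *; lra.
have : (x + 1) ^+ 2 <= (q * v n) ^+ 2.
  by rewrite lerXn2r// nnegrE ?addr_ge0// (le_trans _ yB)// addr_ge0.
rewrite exprMn qq => h; have v20 := sqr_ge0 (v n).
have -> : v n * (n%:R * v n) = n%:R * v n ^+ 2 by ring.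
have x20 := sqr_ge0 x.
apply: (@le_trans _ _ ((x + 1) ^+ 2)); first by move: x0 x20; clear => *; lra.
by apply: (le_trans h); rewrite ler_wpM2r// gerBl.
Unshelve. all: by end_near. Qed.

(** Over a step of length x / (n v) the hazard rate is n v up to a factor tending to 1. Besides 2 /
    n, the relative errors are x / (n v^2) from the left end of the step, v^2 from the denominator 1
    - v^2, and 1 / (sqrt (n - 1) v) from the term [A 1]; the two preceding limits of v make them all
    vanish. *)
Lemma quantile_shift_cvg (R : realType) (H : nat -> R -> R) (N : nat -> R)
  (s x : R) (v : nat -> R) : regular_tails H N -> 0 < s -> quantile H N s v -> 0 <= x ->
  N n * H n (v n - x / (n%:R * v n)) @[n --> \oo] --> s * expR x.
Proof.
move=> HN s0 v_quantile x0; have [H_regular N_infty ln_N] := HN.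
pose y n := Num.sqrt (n%:R - 1) * v n.
pose D n := ln (H n (v n - x / (n%:R * v n))) - ln (H n (v n)).
have y1 : (y n)^-1 @[n --> \oo] --> (0 : R).
  rewrite gtr0_cvgV0; first exact: quantile_sqrt_cvgy HN s0 v_quantile.
  by move/cvgryPgt : (quantile_sqrt_cvgy HN s0 v_quantile); apply.
have n1 : (n%:R : R)^-1 @[n --> \oo] --> (0 : R).
  rewrite gtr0_cvgV0; first exact: cvgr_idn.
  by near=> n; rewrite ltr0n; near: n; exact: nbhs_infty_gt.
have Dx : D n @[n --> \oo] --> x.
  apply: (@squeeze_cvgr _ _ _ _ (fun n => (1 - 2 * n%:R^-1) * x * (1 - x * (y n)^-1 * (y n)^-1))
    (fun n => (1 - v n * v n)^-1 * (1 + (y n)^-1) * x)).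
  - near=> n.
    have [/andP[v0 v2] _] : 0 < v n <= 2^-1 /\ N n * H n (v n) = s by near: n.
    have Hn : regular_tail (n%:R - 1) (H n) by near: n.
    have n2 : 4 <= n%:R :> R by near: n; exact: near_natr_ge.
    have u0 : 0 <= v n - x / (n%:R * v n) by near: n; exact: quantile_shift_ge0 HN s0 v_quantile x0.
    have n0 : 0 < n%:R :> R by move: n2; clear => *; lra.
    have m0 : 0 < n%:R - 1 :> R by move: n2; clear => *; lra.
    pose q : R := Num.sqrt (n%:R - 1); have q0 : 0 < q by rewrite sqrtr_gt0.
    have qq : q ^+ 2 = n%:R - 1 by rewrite sqr_sqrtr// ltW.
    (* [regular_tail] compares two distinct points, and the shifted point coincides with [v n] when
       x = 0. *)
    have [x00|xn0] := eqVneq x 0.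
      by rewrite /D x00 !(mulr0, mul0r, subr0, subrr) lexx.
    have xp : 0 < x by rewrite lt_neqAle eq_sym xn0.
    have [_ _ _ Hb] := Hn.
    set u := v n - x / (n%:R * v n) in u0.
    have vu : v n - u = x / (n%:R * v n) by rewrite /u; ring.
    have uv : u < v n by rewrite -subr_gt0 vu divr_gt0// mulr_gt0.
    have /andP[h1 h2] := Hb u (v n) u0 uv v2.
    apply/andP; split.
      apply: le_trans h1; rewrite vu /u /y -/q.
      have -> : (n%:R - 1 - 1) * (v n - x / (n%:R * v n)) * (x / (n%:R * v n)) =
          (1 - 2 * n%:R^-1) * x * (1 - x / (n%:R * v n ^+ 2)).
        by field; rewrite !gt_eqF.
      apply: ler_wpM2l.
        by rewrite mulr_ge0// subr_ge0 ler_pdivrMr// mul1r (le_trans _ n2)// ler_nat.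
      have a1 : 0 < n%:R * v n ^+ 2 by rewrite mulr_gt0// exprn_gt0.
      have a2 : 0 < (q * v n) ^+ 2 by rewrite exprn_gt0// mulr_gt0.
      rewrite lerD2l lerN2 -mulrA ler_wpM2l// -invfM -expr2 lef_pV2 ?posrE//.
      by rewrite exprMn qq ler_wpM2r ?sqr_ge0// gerBl.
    apply: (le_trans h2); rewrite vu /y -/q.
    have v21 : 0 < 1 - v n ^+ 2 by move: v0 v2; clear => *; nra.
    have -> : (n%:R - 1 - 1) / (1 - v n ^+ 2) * (v n + q^-1) * (x / (n%:R * v n)) =
        (1 - 2 * n%:R^-1) * ((1 - v n * v n)^-1 * (1 + (q * v n)^-1) * x).
      by rewrite -expr2; field; rewrite !gt_eqF.
    apply: ler_piMl; last by rewrite gerBl mulr_ge0// invr_ge0 ltW.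
    rewrite mulr_ge0// mulr_ge0//; first by rewrite invr_ge0 -expr2 ltW.
    by rewrite addr_ge0// invr_ge0 mulr_ge0// ltW.
  - rewrite -[X in _ --> X](_ : (1 - 2 * 0) * x * (1 - x * 0 * 0) = x); last by ring.
    apply: cvgM; last first.
      by apply: cvgB; [exact: cvg_cst|apply: cvgM => //; apply: cvgM => //; exact: cvg_cst].
    apply: cvgM; last exact: cvg_cst.
    apply: cvgB; first exact: cvg_cst.
    by apply: cvgM; [exact: cvg_cst|exact: n1].
  - rewrite -[X in _ --> X](_ : (1 - 0 * 0)^-1 * (1 + 0) * x = x); last first.
      by rewrite mulr0 subr0 invr1 addr0 !mul1r.
    apply: cvgM; last exact: cvg_cst.
    apply: cvgM; last by apply: cvgD => //; exact: cvg_cst.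
    apply: cvgV; first by rewrite mulr0 subr0 oner_eq0.
    by apply: cvgB; [exact: cvg_cst|apply: cvgM; exact: quantile_cvg0 HN s0 v_quantile].
have : s * expR (D n) @[n --> \oo] --> s * expR x.
  apply: cvgM; first exact: cvg_cst.
  by apply: continuous_cvg => //; exact: continuous_expR.
apply: cvg_trans; apply: near_eq_cvg; near=> n.
have [/andP[v0 v2] vE] : 0 < v n <= 2^-1 /\ N n * H n (v n) = s by near: n.
have [_ _ Hp _] : regular_tail (n%:R - 1) (H n) by near: n.
have u0 : 0 <= v n - x / (n%:R * v n) by near: n; exact: quantile_shift_ge0 HN s0 v_quantile x0.
have n2 : 4 <= n%:R :> R by near: n; exact: near_natr_ge.
have Hv := Hp (v n) ltac:(by rewrite ltW).
have Hu : 0 < H n (v n - x / (n%:R * v n)).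
  by apply: Hp; rewrite u0 (le_trans _ v2)// gerBl divr_ge0// mulr_ge0// ltW.
by rewrite expRB !lnK ?posrE// -vE -!mulrA; congr (_ * _); rewrite mulrCA mulfV ?mulr1// gt_eqF.
Unshelve. all: by end_near. Qed.

(** * The two largest correlations *)

Section order_statistics.
Context {R : realType} (I : eqType).

(** The indices are sorted by their values, not the values alone; a maximal index and a runner-up
    are thus obtained as distinct indices even when their values are tied. *)
Lemma ostat01_witness (r : seq I) (f : I -> R) : uniq r -> (1 < size r)%N ->
  exists q0 q1, [/\ q0 \in r, q1 \in r, q1 != q0,
    ostat (map f r) 0 = f q0 & ostat (map f r) 1 = f q1 /\ f q1 <= f q0 /\
    forall q, q \in r -> q != q0 -> f q <= f q1].
Proof.
move=> ur sr; pose r' := sort (relpre f >=%R) r.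
have E k : ostat (map f r) k = nth 0 (map f r') k by rewrite /ostat sort_map.
have rr' : r' =i r by move=> q; rewrite mem_sort.
have : uniq r' by rewrite sort_uniq.
have : sorted (relpre f >=%R) r' by apply: sort_sorted => a b; exact: le_total.
have : (1 < size r')%N by rewrite size_sort.
case: r' => [|q0 [|q1 l]] // in E rr' * => _ /= /andP[q10 sl].
rewrite inE negb_or => /andP[/andP[q01 q0l] _].
exists q0, q1; split.
- by rewrite -rr' inE eqxx.
- by rewrite -rr' !inE eqxx orbT.
- by rewrite eq_sym.
- by rewrite E.
- split; first by rewrite E.
  split => // q; rewrite -rr' !inE => /orP[/eqP->|/orP[/eqP->//|ql]]; first by rewrite eqxx.
  move=> _; have tr : transitive (relpre f >=%R) by move=> a b c /= ab /le_trans; apply.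
  by move: sl; rewrite (path_sortedE tr) => /andP[/allP/(_ _ ql)].
Qed.

End order_statistics.

(** * Decomposition over the pair that attains the maximum *)

Section pair_events.
Context d (T : measurableType d) (R : realType) (P : probability T R) (p : nat).
Variables (X : 'I_p -> 'I_p -> T -> R) (H : R -> R).

Local Notation Xq q := (X q.1 q.2).
Local Notation N := ((size (pairs p))%:R : R).

Definition top k (w : T) : R := ostat [seq Xq q w | q <- pairs p] k.

Definition below (l : seq ('I_p * 'I_p)) (r : R) : set T :=
  [set w | all (fun q => Xq q w <= r) l].

Definition slab (q : 'I_p * 'I_p) (s t : R) : set T := [set w | s < Xq q w <= t].

Definition disjoint_pairs (q : 'I_p * 'I_p) : seq ('I_p * 'I_p) :=
  [seq q' <- pairs p | [&& q'.1 != q.1, q'.1 != q.2, q'.2 != q.1 & q'.2 != q.2]].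

Hypothesis mX : forall i j, measurable_fun setT (X i j).
Hypothesis X_sym : forall i j w, X i j w = X j i w.
Hypothesis p2 : (1 < size (pairs p))%N.
Hypothesis tail_pair : forall i j r, i != j -> 0 <= r ->
  pr P [set w | r < X i j w] = H r.
Hypothesis adjacent_indep : forall i j k s t r, i != j -> i != k -> j != k ->
  0 <= s -> s <= t -> 0 <= r ->
  pr P [set w | s < X i j w <= t /\ r < X i k w] = (H s - H t) * H r.
Hypothesis disjoint_indep : forall q s t r, q.1 != q.2 -> 0 <= s -> s <= t ->
  pr P (slab q s t `&` below (disjoint_pairs q) r) =
  (H s - H t) * pr P (below (disjoint_pairs q) r).

Definition max_below r : R := pr P (below (pairs p) r).

Lemma pairs_uniq : uniq (pairs p).
Proof. by rewrite filter_uniq// enum_uniq. Qed.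

Lemma mem_pairs q : (q \in pairs p) = (q.1 < q.2)%N.
Proof. by rewrite mem_filter mem_enum andbT. Qed.

Lemma pairs_neq q : q \in pairs p -> q.1 != q.2.
Proof. by rewrite mem_pairs => h; apply/eqP => E; rewrite E ltnn in h. Qed.

Lemma measurable_slab q s t : measurable (slab q s t).
Proof. exact: measurable_between. Qed.

Lemma measurable_below l r : measurable (below l r).
Proof.
elim: l => [|q l IH]; first by rewrite (_ : below _ _ = setT)//; apply/seteqP; split.
rewrite (_ : below _ _ = [set w | Xq q w <= r] `&` below l r).
  by apply: measurableI => //; exact: measurable_le.
by apply/seteqP; split=> w /=; rewrite /below/= => /andP.
Qed.

Lemma tail_ge0 r : 0 <= r -> 0 <= H r.
Proof.
move=> r0; case: (pairs p) p2 pairs_neq => [//|q l] _ /(_ q (mem_head _ _)) q12.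
by rewrite -(tail_pair q12 r0) pr_ge0.
Qed.

Lemma tail_nincr s t : 0 <= s -> s <= t -> H t <= H s.
Proof.
move=> s0 st; case: (pairs p) p2 pairs_neq => [//|q l] _ /(_ q (mem_head _ _)) q12.
rewrite -(tail_pair q12 s0) -(tail_pair q12 (le_trans s0 st)).
by apply: le_pr => [||w /= /(le_lt_trans st)//]; exact: measurable_gt.
Qed.

Lemma sumr_seq_const (I : Type) (l : seq I) (c : R) :
  \sum_(q <- l) c = (size l)%:R * c.
Proof. by rewrite big_const_seq count_predT iter_addr addr0 mulr_natl. Qed.

Lemma sum_over_indices_le (a : pred 'I_p) (F : 'I_p -> R) (c : R) : 0 <= c ->
  (forall k, a k -> F k <= c) -> \sum_(k <- enum 'I_p | a k) F k <= p%:R * c.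
Proof.
move=> c0 Fc; apply: (@le_trans _ _ (\sum_(k <- enum 'I_p) c)).
  rewrite [leRHS](bigID a)/= -[leLHS]addr0 lerD//.
    by apply: ler_sum.
  exact: sumr_ge0.
by rewrite sumr_seq_const size_enum_ord.
Qed.

Lemma max_below_le q r : max_below r <= pr P (below (disjoint_pairs q) r).
Proof.
apply: le_pr => [||w]; do ?exact: measurable_below.
by rewrite /below/= => /allP h; apply/allP => q'; rewrite mem_filter => /andP[_ /h].
Qed.

(* a pair meeting [q] without being disjoint from it contains [q.1] or [q.2] *)
Lemma below_le_max_below q r : q.1 != q.2 -> 0 <= r ->
  pr P (below (disjoint_pairs q) r) <= max_below r + 2 * p%:R * H r.
Proof.
move=> q12 r0.
pose B i := [set w | has (fun k => (k != i) && (r < X i k w)) (enum 'I_p)].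
have mB i : measurable (B i).
  rewrite (_ : B i = ~` below [seq (i, k) | k <- enum 'I_p & k != i] r).
    exact/measurableC/measurable_below.
  apply/seteqP; split=> w /=; rewrite /B/below/=.
    move=> /hasP[k _ /andP[ki kr]] /allP/(_ (i, k)) /=; rewrite leNgt kr => h.
    by apply/notF/h/mapP; exists k => //; rewrite mem_filter ki mem_enum.
  move=> /negP; rewrite -has_predC => /hasP[_ /mapP[k + ->]] /=.
  rewrite mem_filter => /andP[ki _]; rewrite -ltNge => kr.
  by apply/hasP; exists k; rewrite ?mem_enum// ki.
have BH i : pr P (B i) <= p%:R * H r.
  apply: (le_trans (@pr_le_sum _ _ _ P _ [seq k <- enum 'I_p | k != i] (B i)
    (fun k => [set w | r < X i k w]) _ _ _)) => //.
  - by move=> k; exact: measurable_gt.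
  - move=> w; rewrite /B/= => /hasP[k _ /andP[ki kr]].
    by exists k => //; rewrite mem_filter ki mem_enum.
  rewrite big_filter; apply: sum_over_indices_le; first exact: tail_ge0.
  by move=> k ki; rewrite tail_pair// eq_sym.
apply: (@le_trans _ _ (pr P (below (pairs p) r `|` (B q.1 `|` B q.2)))).
  apply: le_pr => [||w].
  - exact: measurable_below.
  - by apply: measurableU; [exact: measurable_below|exact: measurableU].
  rewrite /below/= => /allP h.
  have [hB|nB] := pselect ((B q.1 `|` B q.2) w); [by right|left].
  apply/allP => q' qp; rewrite leNgt; apply/negP => rq.
  have q'12 := pairs_neq qp.
  apply: nB; rewrite /B/=.
  have [E|n11] := eqVneq q'.1 q.1.
    by left; apply/hasP; exists q'.2; rewrite ?mem_enum// -E rq eq_sym q'12.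
  have [E|n12] := eqVneq q'.1 q.2.
    by right; apply/hasP; exists q'.2; rewrite ?mem_enum// -E rq eq_sym q'12.
  have [E|n21] := eqVneq q'.2 q.1.
    by left; apply/hasP; exists q'.1; rewrite ?mem_enum// -E X_sym rq q'12.
  have [E|n22] := eqVneq q'.2 q.2.
    by right; apply/hasP; exists q'.1; rewrite ?mem_enum// -E X_sym rq q'12.
  have := h q'; rewrite mem_filter n11 n12 n21 n22 qp leNgt rq => /(_ isT).
  by [].
apply: (le_trans (pr_le_U _ _ _)); [exact: measurable_below|exact: measurableU|].
rewrite lerD2l (le_trans (pr_le_U _ _ _))// (le_trans (lerD (BH _) (BH _)))//.
by rewrite (_ : 2 * _ * _ = p%:R * H r + p%:R * H r)//; ring.
Qed.

Lemma measurable_top k : measurable_fun setT (top k).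
Proof. by apply: measurable_ostat => q; exact: mX. Qed.

Definition top_event s t r := [set w | s < top 0 w <= t /\ top 1 w <= r].

Lemma measurable_top_event s t r : measurable (top_event s t r).
Proof.
rewrite (_ : top_event _ _ _ = top 0 @^-1` `]s, t] `&` top 1 @^-1` `]-oo, r]).
  by apply: measurableI; rewrite -[X in measurable X]setTI; exact: measurable_top.
by apply/seteqP; split=> w; rewrite /= !in_itv.
Qed.

Definition isolated q s t r := slab q s t `&` below [seq q' <- pairs p | q' != q] r.

Lemma measurable_isolated q s t r : measurable (isolated q s t r).
Proof. by apply: measurableI; [exact: measurable_slab|exact: measurable_below]. Qed.

Lemma top_event_sub s t r w : top_event s t r w ->
  exists2 q, q \in pairs p & isolated q s t r w.
Proof.
move=> [st tr].
have [q0 [q1 [q0p q1p q10 E0 [E1 [_ h]]]]] := ostat01_witness (fun q => Xq q w) pairs_uniq p2.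
exists q0 => //; split; first by rewrite /slab/= -E0.
rewrite /below/=; apply/allP => q; rewrite mem_filter => /andP[qq0 qp].
by rewrite (le_trans (h _ qp qq0))// -E1.
Qed.

(** With [r <= s] no other pair can exceed s, so [q] is the pair attaining the maximum. Without this
    condition an isolated [q] need not be maximal, which is why only the lower bound assumes it. *)
Lemma isolated_sub q s t r w : r <= s -> q \in pairs p -> isolated q s t r w ->
  top_event s t r w.
Proof.
move=> rs qp [sq /allP/= qr].
have [q0 [q1 [q0p q1p q10 E0 [E1 [q1q0 h]]]]] :=
  ostat01_witness (fun q => Xq q w) pairs_uniq p2.
have /andP[sXq Xqt] := sq.
have qq0 : q0 = q.
  apply/eqP; apply: contraT => q0q.
  have := qr q0; rewrite mem_filter q0q q0p => /(_ isT) q0r.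
  rewrite eq_sym in q0q; have qq1 := h _ qp q0q.
  have := lt_le_trans sXq (le_trans qq1 (le_trans q1q0 (le_trans q0r rs))).
  by rewrite ltxx.
split; first by rewrite /top E0 -qq0 in sXq Xqt *; rewrite sXq.
by rewrite /top E1; apply: qr; rewrite mem_filter -qq0 q10.
Qed.

(** A union bound over the maximal pair, so overlaps do no harm. Among the constraints on the other
    pairs, those that meet [q] are dropped; the rest is independent of [q] and costs only
    [below_le_max_below]. *)
Lemma pair_upper s t r : 0 <= s -> s <= t -> 0 <= r ->
  pr P (top_event s t r) <= N * (H s - H t) * (max_below r + 2 * p%:R * H r).
Proof.
move=> s0 st r0.
apply: (@le_trans _ _ (\sum_(q <- pairs p) pr P (isolated q s t r))).
  apply: pr_le_sum => [|q|w]; [exact: measurable_top_event|exact: measurable_isolated|].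
  exact: top_event_sub.
rewrite -mulrA -sumr_seq_const big_seq [leRHS]big_seq; apply: ler_sum => q qp.
have q12 := pairs_neq qp.
apply: (@le_trans _ _ (pr P (slab q s t `&` below (disjoint_pairs q) r))).
  apply: le_pr => [||w [? /allP qr]].
  - exact: measurable_isolated.
  - by apply: measurableI; [exact: measurable_slab|exact: measurable_below].
  split => //; apply/allP => q'; rewrite mem_filter => /andP[/and4P[n11 _ _ _] q'p].
  by apply: qr; rewrite mem_filter q'p andbT; apply: contraNneq n11 => ->.
rewrite disjoint_indep// ler_wpM2l ?below_le_max_below// subr_ge0.
exact: tail_nincr.
Qed.

(** The constraints on the disjoint pairs fail to isolate [q] only if some pair (i, k), with i in
    [q] and k outside, exceeds r while [q] lies in the slab. There are at most 2 p such events, and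
    [adjacent_indep] gives each the probability (H s - H t) H r. *)
Lemma isolated_lower q s t r : q \in pairs p -> 0 <= s -> s <= t -> 0 <= r ->
  (H s - H t) * (max_below r - 2 * p%:R * H r) <= pr P (isolated q s t r).
Proof.
move=> qp s0 st r0; have q12 := pairs_neq qp.
have Hst : 0 <= H s - H t by rewrite subr_ge0 tail_nincr.
pose notq := [pred k | (k != q.1) && (k != q.2)].
pose E i k := [set w | s < Xq q w <= t /\ r < X i k w].
have mE i k : measurable (E i k).
  by apply: measurableI; [exact: measurable_slab|exact: measurable_gt].
pose B i := [set w | slab q s t w /\ ~ below [seq (i, k) | k <- enum 'I_p & notq k] r w].
have mB i : measurable (B i).
  by apply: measurableI; [exact: measurable_slab|exact/measurableC/measurable_below].
have BH i : i \in [:: q.1; q.2] -> pr P (B i) <= p%:R * ((H s - H t) * H r).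
  move=> iq.
  apply: (le_trans (@pr_le_sum _ _ _ P _ [seq k <- enum 'I_p | notq k] (B i) (E i) _ _ _)) => //.
    move=> w [sq] /negP; rewrite -has_predC => /hasP[_ /mapP[k kn ->]] /=.
    by rewrite -ltNge => kr; exists k.
  rewrite big_filter; apply: sum_over_indices_le; first by rewrite mulr_ge0// tail_ge0.
  move=> k /andP[k1 k2]; move: iq; rewrite !inE => /orP[] /eqP->.
    by rewrite /E adjacent_indep// eq_sym.
  rewrite /E; under eq_set do rewrite X_sym.
  by rewrite adjacent_indep// eq_sym.
have sub : slab q s t `&` below (disjoint_pairs q) r `<=`
    isolated q s t r `|` (B q.1 `|` B q.2).
  move=> w [sq /allP h].
  have [hB|nB] := pselect ((B q.1 `|` B q.2) w); [by right|left; split => //].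
  have nr i k : i \in [:: q.1; q.2] -> notq k -> X i k w <= r.
    move=> iq nk; rewrite leNgt; apply/negP => kr; apply: nB.
    suff : B i w by move: iq; rewrite !inE => /orP[] /eqP->; [left|right].
    split => // /allP/(_ (i, k)) /=; rewrite leNgt kr => h'; apply/notF/h'/mapP.
    by exists k => //; rewrite mem_filter mem_enum andbT.
  apply/allP => q'; rewrite mem_filter => /andP[q'q q'p].
  have q'12 := pairs_neq q'p; move: (q'p) (qp); rewrite !mem_pairs => lt' lt.
  have [E11|n11] := eqVneq q'.1 q.1.
    rewrite E11; apply: nr; rewrite ?inE ?eqxx//= -E11 eq_sym q'12/=.
    apply: contraNneq q'q => E22; apply/eqP.
    by rewrite (surjective_pairing q') E11 E22 -surjective_pairing.
  have [E12|n12] := eqVneq q'.1 q.2.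
    rewrite E12; apply: nr; rewrite ?inE ?eqxx ?orbT//= -E12 [_ == q'.1]eq_sym q'12 andbT.
    (* Here [q'] would be [q] reversed, which the ordering inside [pairs] excludes. *)
    by apply/eqP => E21; move: lt'; rewrite E12 E21 ltnNge (ltnW lt).
  have [E21|n21] := eqVneq q'.2 q.1.
    by rewrite X_sym E21; apply: nr; rewrite ?inE ?eqxx//= n11 n12.
  have [E22|n22] := eqVneq q'.2 q.2.
    by rewrite X_sym E22; apply: nr; rewrite ?inE ?eqxx ?orbT//= n11 n12.
  by apply: h; rewrite mem_filter n11 n12 n21 n22.
have mI : measurable (slab q s t `&` below (disjoint_pairs q) r).
  by apply: measurableI; [exact: measurable_slab|exact: measurable_below].
have mBB : measurable (B q.1 `|` B q.2) by exact: measurableU.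
have := le_pr P mI (measurableU _ _ (measurable_isolated q s t r) mBB) sub.
have := pr_le_U P (measurable_isolated q s t r) mBB.
have := pr_le_U P (mB q.1) (mB q.2).
have := BH q.1 (mem_head _ _); have := BH q.2; rewrite !inE eqxx orbT => /(_ isT).
rewrite disjoint_indep//.
have : (H s - H t) * max_below r <= (H s - H t) * pr P (below (disjoint_pairs q) r).
  by rewrite ler_wpM2l// max_below_le.
by move=> *; lra.
Qed.

(** For [r <= s] at most one pair can be isolated at a given outcome, so the probabilities add
    up. *)
Lemma pair_lower s t r : 0 <= s -> s <= t -> 0 <= r -> r <= s ->
  N * (H s - H t) * (max_below r - 2 * p%:R * H r) <= pr P (top_event s t r).
Proof.
move=> s0 st r0 rs.
rewrite -mulrA -sumr_seq_const.
apply: (@le_trans _ _ (\sum_(q <- pairs p) pr P (isolated q s t r))).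
  by rewrite big_seq [leRHS]big_seq; apply: ler_sum => q qp; exact: isolated_lower.
apply: sum_le_pr => [|q||q w qp|q q' w qp q'p].
- exact: measurable_top_event.
- exact: measurable_isolated.
- exact: pairs_uniq.
- exact: isolated_sub.
move=> [sq _] [/andP[sq' _] /allP h]; apply/eqP; apply: contraT => qq'.
have /= := h q; rewrite mem_filter qq' qp => /(_ isT) qr.
by move: sq => /andP[/lt_le_trans/(_ (le_trans qr rs))]; rewrite ltxx.
Qed.

Lemma max_below_top r : max_below r = pr P [set w | top 0 w <= r].
Proof.
congr (pr P _); apply/seteqP; split => w /=.
all: have [q0 [q1 [q0p q1p q10 E0 [E1 [q1q0 h]]]]] :=
  ostat01_witness (fun q => Xq q w) pairs_uniq p2; rewrite /top E0.
  by move=> /allP/(_ _ q0p).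
move=> q0r; apply/allP => q qp; apply: le_trans q0r.
by have [->//|/(h _ qp)/le_trans] := eqVneq q q0; apply.
Qed.

End pair_events.

(** * Limit laws of the maximum and of the gap *)

Lemma near_forall_lt (J : nat) (Q : nat -> nat -> Prop) :
  (forall j, (j < J)%N -> \forall n \near \oo, Q j n) ->
  \forall n \near \oo, forall j, (j < J)%N -> Q j n.
Proof.
elim: J => [|J IH] QJ; first by near=> n.
have h1 := IH (fun j jJ => QJ j (ltnW jJ)).
have h2 := QJ J (ltnSn J).
near=> n => j; rewrite ltnS leq_eqVlt => /orP[/eqP->|]; first by near: n.
by move: j; near: n.
Unshelve. all: by end_near. Qed.

(* A discrete Gronwall estimate for [f' = - f] with step [a]. *)
Lemma expR_recurrence (R : realType) (f : nat -> R) (a D : R) (K : nat) :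
  0 < a <= 2^-1 -> 0 <= D -> f 0%N = 1 -> (forall j, 0 <= f j) ->
  (forall j, (j < K)%N -> f j - f j.+1 <= a * (f j + D)) ->
  (forall j, (j < K)%N -> a * (f j.+1 - D) <= f j - f j.+1) ->
  expR (- (K%:R * (a + 2 * a ^+ 2))) - K%:R * (a * D) <= f K <=
  expR (- (K%:R * (a - a ^+ 2))) + K%:R * (a * D).
Proof.
move=> /andP[a0 a2] D0 f0 fge fu fl.
have aD : 0 <= a * D by rewrite mulr_ge0// ltW.
(* The hypotheses read f(j+1) >= (1 - a) f(j) - a D and (1 + a) f(j+1) <= f(j) + a D. The bounds
   [e1] and [e2] compare the factors 1 - a and 1 / (1 + a) with exponentials, losing only
   second-order terms in a. *)
have e1 : expR (- (a + 2 * a ^+ 2)) <= 1 - a.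
  have := expR_ge1Dx (a + 2 * a ^+ 2); rewrite expRN => h.
  have h0 : 0 < 1 + (a + 2 * a ^+ 2) by have := sqr_ge0 a; lra.
  rewrite -(@ler_pM2r _ (expR (a + 2 * a ^+ 2))) ?expR_gt0// mulVf ?gt_eqF ?expR_gt0//.
  apply: (@le_trans _ _ ((1 - a) * (1 + (a + 2 * a ^+ 2)))); last by rewrite ler_wpM2l//; lra.
  have -> : (1 - a) * (1 + (a + 2 * a ^+ 2)) = 1 + a ^+ 2 * (1 - 2 * a) by ring.
  by rewrite lerDl mulr_ge0 ?sqr_ge0//; lra.
have e2 : 1 <= (1 + a) * expR (- (a - a ^+ 2)).
  have := expR_ge1Dx (- (a - a ^+ 2)) => h.
  apply: (@le_trans _ _ ((1 + a) * (1 + - (a - a ^+ 2)))); last by rewrite ler_wpM2l//; lra.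
  have -> : (1 + a) * (1 + - (a - a ^+ 2)) = 1 + a ^+ 3 by ring.
  by rewrite lerDl exprn_ge0// ltW.
have e3 : expR (- (a - a ^+ 2)) <= 1.
  by rewrite expR_le1 oppr_le0 subr_ge0 expr2 ler_piMl//; lra.
elim: K fu fl => [|K IH] fu fl; first by rewrite !mul0r oppr0 expR0 f0 !addr0 lexx.
have /andP[h1 h2] := IH (fun j jK => fu j (ltnW jK)) (fun j jK => fl j (ltnW jK)).
have {}fu := fu K (ltnSn K); have {}fl := fl K (ltnSn K).
have K0 : 0 <= K%:R :> R by [].
have KaD : 0 <= K%:R * (a * D) by rewrite mulr_ge0.
have nK c : K.+1%:R * c = K%:R * c + c :> R by rewrite -natr1 mulrDl mul1r.
rewrite !nK !(opprD (K%:R * _)) !expRD.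
apply/andP; split.
  set E := expR (- (K%:R * (a + 2 * a ^+ 2))) in h1 *.
  have E0 : 0 <= E by exact: expR_ge0.
  apply: (@le_trans _ _ (E * (1 - a) - (K%:R * (a * D) + a * D))).
    by rewrite -opprD lerD2r ler_wpM2l.
  have : (1 - a) * (E - K%:R * (a * D)) <= (1 - a) * f K by rewrite ler_wpM2l//; lra.
  nra.
set E := expR (- (K%:R * (a - a ^+ 2))) in h2 *.
set e := expR _ in e2 e3 *.
have e0 : 0 <= e by exact: expR_ge0.
have : f K.+1 * (1 + a) <= f K + a * D by lra.
rewrite -ler_pdivlMr; last by lra.
move=> /le_trans; apply; rewrite ler_pdivrMr; last by lra.
apply: (@le_trans _ _ (E + K%:R * (a * D) + a * D)); first by rewrite lerD2r.
have E0 : 0 <= E by exact: expR_ge0.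
have : E * 1 <= E * ((1 + a) * e) by rewrite ler_wpM2l.
nra.
Qed.

Definition top_cdf d (T : measurableType d) (R : realType) (P : probability T R)
  (V1 : T -> R) (r : R) : R := pr P [set w | V1 w <= r].

Definition slab_event (T : Type) (R : realType) (V1 V2 : T -> R) (s t r : R) : set T :=
  [set w | s < V1 w <= t /\ V2 w <= r].

(** All that the limit laws need from a single sample size. The two slab bounds say that the pair
    realizing [V1] behaves as if it were independent of all the others, up to the error
    [2 * p%:R * h r]. *)
Record pair_bounds d (T : measurableType d) (R : realType) (P : probability T R)
    (V1 V2 : T -> R) (h : R -> R) (N : R) (p : nat) : Prop := PairBounds {
  top_order : forall w, 0 <= V2 w <= V1 w /\ V1 w <= 1;
  tail_at1 : h 1 = 0;
  tail_antitone : forall s t, 0 <= s -> s <= t -> h t <= h s;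
  slab_lower : forall s t r, 0 <= s -> s <= t -> 0 <= r -> r <= s ->
    N * (h s - h t) * (top_cdf P V1 r - 2 * p%:R * h r) <= pr P (slab_event V1 V2 s t r);
  slab_upper : forall s t r, 0 <= s -> s <= t -> 0 <= r ->
    pr P (slab_event V1 V2 s t r) <= N * (h s - h t) * (top_cdf P V1 r + 2 * p%:R * h r) }.

(** * Limit law of the maximum *)

Section extreme_pairs.
Context (R : realType) (dd : nat -> measure_display) (T : forall n, measurableType (dd n)).
Variables (P : forall n, probability (T n) R) (V1 V2 : forall n, T n -> R).
Variables (H : nat -> R -> R) (N : nat -> R) (p : nat -> nat).

Local Notation max_cdf n := (top_cdf (P n) (@V1 n)).
Local Notation slab2 n := (slab_event (@V1 n) (@V2 n)).
Local Notation pair_bounds n := (pair_bounds (P n) (@V1 n) (@V2 n) (H n) (N n) (p n)).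

Record extreme_pairs : Prop := ExtremePairs {
  ep_tails : regular_tails H N;
  ep_ratio : 2 * (p n)%:R / N n @[n --> \oo] --> (0 : R);
  ep_V1 : forall n, measurable_fun setT (@V1 n);
  ep_V2 : forall n, measurable_fun setT (@V2 n);
  ep_bounds : \forall n \near \oo, pair_bounds n }.

Hypothesis E : extreme_pairs.

(* The point where the expected number of exceedances is [a]; [a = 0] corresponds to 1,
   the largest value of a correlation. *)
Definition level (a : R) (n : nat) : R :=
  if a == 0 then 1 else xget 1 [set v | 0 < v <= 2^-1 /\ N n * H n v = a].

Lemma near_N_gt0 : \forall n \near \oo, 0 < N n.
Proof. by have [_ /cvgryPgt + _] := ep_tails E; apply. Qed.

Lemma level_quantile a : 0 < a -> quantile H N a (level a).
Proof.
move=> a0; near=> n; rewrite /level gt_eqF//.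
have [v v2 vE] : exists2 v, 0 < v <= 2^-1 & N n * H n v = a.
  by near: n; exact: exists_quantile (ep_tails E) a0.
by case: xgetP => [y -> []//|/(_ v)]; case.
Unshelve. all: by end_near. Qed.

Lemma level_eq a : 0 <= a -> \forall n \near \oo,
  0 <= level a n <= 1 /\ N n * H n (level a n) = a.
Proof.
rewrite le_eqVlt => /orP[/eqP<-|a0]; near=> n.
  have B : pair_bounds n by near: n; exact: ep_bounds.
  by rewrite /level eqxx (tail_at1 B) mulr0 ler01 lexx.
have [/andP[v0 v2] vE] : 0 < level a n <= 2^-1 /\ N n * H n (level a n) = a.
  by near: n; exact: level_quantile.
by rewrite ltW// (le_trans v2)// invf_le1// ler1n.
Unshelve. all: by end_near. Qed.

Lemma measurable_top_le n r : measurable [set w : T n | V1 w <= r].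
Proof. by apply: measurable_le; exact: (ep_V1 E). Qed.

Lemma measurable_slab2 n s t r : measurable (slab2 n s t r).
Proof.
apply: measurableI; first by apply: measurable_between; exact: (ep_V1 E).
by apply: measurable_le; exact: (ep_V2 E).
Qed.

Lemma le_max_cdf n s t : s <= t -> max_cdf n s <= max_cdf n t.
Proof.
move=> st; apply: le_pr => [||w /= /le_trans]; last exact.
all: exact: measurable_top_le.
Qed.

(** On [s < V1 <= t] the condition [V2 <= t] is automatic, so increments of the law of the maximum
    are slab events with [r = t]. *)
Lemma max_cdfB n s t : pair_bounds n -> s <= t ->
  max_cdf n t - max_cdf n s = pr (P n) (slab2 n s t t).
Proof.
move=> B st; apply/eqP; rewrite subr_eq addrC; apply/eqP.
rewrite /top_cdf -prU; [|exact: measurable_top_le|exact: measurable_slab2|].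
  congr (pr _ _); apply/seteqP; split=> w /=.
    move=> Vt; have [Vs|sV] := leP (V1 w) s; [by left|right].
    have [/andP[_ V21] _] := top_order B w.
    by split; [rewrite sV Vt|exact: le_trans Vt].
  by move=> [/le_trans ->//|[/andP[]]].
by apply/seteqP; split=> w //= [Vs [/andP[]]]; rewrite ltNge Vs.
Qed.

Lemma antitone_le n a b u v : pair_bounds n -> 0 < N n -> 0 <= u -> 0 <= v ->
  N n * H n u = a -> N n * H n v = b -> a < b -> v <= u.
Proof.
move=> B N0 u0 v0 ua vb ab; rewrite leNgt; apply/negP => uv.
have := tail_antitone B u0 (ltW uv).
by rewrite -(ler_pM2l N0) ua vb leNgt ab.
Qed.

Lemma cvg_of_bounds (f : nat -> R) (l : R) :
  (forall e, 0 < e -> \forall n \near \oo, l - e <= f n <= l + e) -> f n @[n --> \oo] --> l.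
Proof.
move=> fl; apply/cvgrPdist_le => e /fl; apply: filterS => n /andP[h1 h2].
by rewrite ler_distlC h1 h2.
Qed.

(** Along the levels of 0, b, 2 b, ..., K b = a each cell has expected count b, so the slab bounds
    become the recurrence of [expR_recurrence]. It starts at 1 because the level of 0 is 1, which
    bounds [V1]. *)
Lemma max_cdf_level a : 0 < a -> max_cdf n (level a n) @[n --> \oo] --> expR (- a).
Proof.
move=> a0; apply: cvg_of_bounds => e e0.
(* The three summands ensure b <= 1/2, a b <= 1/2 and 2 a b <= e / 2, in this order. *)
pose K := (Num.truncn (2 * a + 2 * a ^+ 2 + 4 * a ^+ 2 / e)).+1.
have KK : 2 * a + 2 * a ^+ 2 + 4 * a ^+ 2 / e < K%:R by exact: truncnS_gt.
have a20 : 0 < a ^+ 2 by rewrite exprn_gt0.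
have ae0 : 0 < 4 * a ^+ 2 / e by rewrite divr_gt0// mulr_gt0.
have K0 : 0 < K%:R :> R by [].
pose b := a / K%:R.
have b0 : 0 < b by rewrite divr_gt0.
have Kb : K%:R * b = a by rewrite mulrC divfK// gt_eqF.
have b2 : b <= 2^-1 by rewrite ler_pdivrMr//; lra.
have ab2 : a * b <= 2^-1.
  by rewrite mulrA ler_pdivrMr// -expr2; lra.
have abe : 2 * (a * b) <= e / 2.
  have E1 : 4 * a ^+ 2 / e * e = 4 * a ^+ 2 by rewrite divfK// gt_eqF.
  have E2 : 4 * a ^+ 2 / e * e < K%:R * e by rewrite ltr_pM2r//; lra.
  have -> : 2 * (a * b) = 2 * a ^+ 2 / K%:R by rewrite /b; ring.
  by rewrite ler_pdivrMr//; lra.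
have grid : \forall n \near \oo, forall j, (j < K.+1)%N ->
    0 <= level (j%:R * b) n <= 1 /\ N n * H n (level (j%:R * b) n) = j%:R * b.
  by apply: near_forall_lt => j _; apply: level_eq; rewrite mulr_ge0// ltW.
near=> n.
have B : pair_bounds n by near: n; exact: ep_bounds.
have N0 : 0 < N n by near: n; exact: near_N_gt0.
have G : forall j, (j < K.+1)%N ->
    0 <= level (j%:R * b) n <= 1 /\ N n * H n (level (j%:R * b) n) = j%:R * b by near: n.
pose th := 2 * (p n)%:R / N n.
have th0 : 0 <= th by rewrite divr_ge0// ltW.
have th1 : th <= e / (2 * a ^+ 2).
  have : `|2 * (p n)%:R / N n| <= e / (2 * a ^+ 2).
    near: n; have /cvgr0Pnorm_le := ep_ratio E; apply.
    by rewrite divr_gt0// mulr_gt0.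
  by rewrite ger0_norm.
pose f j := if (j <= K)%N then max_cdf n (level (j%:R * b) n) else 0.
have thN u c : N n * H n u = c -> 2 * (p n)%:R * H n u = th * c.
  by move=> <-; rewrite /th mulrA divfK// gt_eqF.
have mono j : (j < K)%N -> level (j.+1%:R * b) n <= level (j%:R * b) n.
  move=> jK; have [/andP[l0 _] lE] := G j.+1 jK; have [/andP[m0 _] mE] := G j (ltnW jK).
  by apply: (antitone_le B N0 _ _ mE lE) => //; rewrite ltr_pM2r// ltr_nat.
have fE j : (j <= K)%N -> f j = max_cdf n (level (j%:R * b) n) by rewrite /f => ->.
have step j : (j < K)%N -> f j - f j.+1 =
    pr (P n) (slab2 n (level (j.+1%:R * b) n) (level (j%:R * b) n) (level (j%:R * b) n)).
  by move=> jK; rewrite !fE ?(ltnW jK)// max_cdfB// mono.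
have nKb j : (j <= K)%N -> th * (j%:R * b) <= th * a.
  by move=> jK; rewrite ler_wpM2l// -Kb ler_wpM2r ?ler_nat// ltW.
have width j : j.+1%:R * b - j%:R * b = b by rewrite -natr1; ring.
have /andP[h1 h2] : expR (- (K%:R * (b + 2 * b ^+ 2))) - K%:R * (b * (th * a)) <= f K <=
  expR (- (K%:R * (b - b ^+ 2))) + K%:R * (b * (th * a)).
  apply: expR_recurrence.
  - by rewrite b0.
  - by rewrite mulr_ge0// ltW.
  - rewrite fE// mul0r /level eqxx /top_cdf (_ : [set _ | _] = setT) ?pr_setT//.
    by apply/seteqP; split=> w //= _; have [] := top_order B w.
  - by move=> j; rewrite /f; case: ifP => // _; exact: pr_ge0.
  - move=> j jK; rewrite step//.
    have [/andP[l0 l1] lE] := G j.+1 jK; have [/andP[m0 m1] mE] := G j (ltnW jK).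
    apply: (le_trans (slab_upper B l0 (mono _ jK) m0)).
    rewrite mulrBr lE mE width (thN _ _ mE) -fE ?(ltnW jK)//.
    by apply: ler_wpM2l; [exact: ltW|rewrite lerD2l; exact/nKb/ltnW].
  - move=> j jK; rewrite step//.
    have [/andP[l0 l1] lE] := G j.+1 jK; have [/andP[m0 m1] mE] := G j (ltnW jK).
    (* Since [slab_lower] requires [r <= s], r is taken at the lower end of the cell; the bound then
       involves [f j.+1], which is the implicit form of the lower hypothesis in
       [expR_recurrence]. *)
    have h := slab_lower B l0 (mono _ jK) l0 (lexx _).
    rewrite [N n * (_ - _)]mulrBr lE mE width (thN _ _ lE) -fE// in h.
    apply: (le_trans (le_trans _ h)).
      by apply: ler_wpM2l; [exact: ltW|rewrite lerD2l lerN2; exact: nKb].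
    apply: le_pr => [||w [st Vl]]; do ?exact: measurable_slab2.
    by split => //; rewrite (le_trans Vl)// mono.
rewrite (_ : max_cdf n (level a n) = f K); last by rewrite fE// Kb.
have aba : K%:R * (b * (th * a)) <= e / 2.
  have -> : K%:R * (b * (th * a)) = th * a ^+ 2 by rewrite mulrA Kb; ring.
  have : th * a ^+ 2 <= e / (2 * a ^+ 2) * a ^+ 2 by rewrite ler_pM2r.
  by move=> /le_trans; apply; rewrite le_eqVlt; apply/orP; left; apply/eqP; field; rewrite gt_eqF.
have e1 : expR (- a) - e / 2 <= expR (- (K%:R * (b + 2 * b ^+ 2))).
  have -> : K%:R * (b + 2 * b ^+ 2) = a + 2 * (a * b) by rewrite -{1 2}Kb; ring.
  rewrite opprD expRD; have := expR_ge1Dx (- (2 * (a * b))) => h.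
  have ea1 : expR (- a) <= 1 by rewrite expR_le1 oppr_le0 ltW.
  have : expR (- a) * (1 - 2 * (a * b)) <= expR (- a) * expR (- (2 * (a * b))).
    by rewrite ler_wpM2l// expR_ge0.
  apply: le_trans; have : expR (- a) * (2 * (a * b)) <= 1 * (e / 2).
    by rewrite ler_pM ?expR_ge0// !mulr_ge0// ltW.
  by rewrite mulrBr mulr1 mul1r lerD2l lerN2.
have e2 : expR (- (K%:R * (b - b ^+ 2))) <= expR (- a) + e / 2.
  have -> : - (K%:R * (b - b ^+ 2)) = - a + a * b by rewrite -{1 2}Kb; ring.
  have ab0 : 0 <= a * b by rewrite mulr_ge0// ltW.
  have h : expR (a * b) <= 1 + 2 * (a * b).
    have := expR_ge1Dx (- (a * b)); rewrite expRN => h.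
    rewrite -[leLHS]invrK invf_ple ?posrE ?invr_gt0 ?expR_gt0//; last by lra.
    apply: le_trans h; rewrite -[leLHS]mul1r ler_pdivrMr; last by lra.
    by have := ab0; have := ab2; move: (a * b) => z; nra.
  have ea1 : expR (- a) <= 1 by rewrite expR_le1 oppr_le0 ltW.
  rewrite expRD; have : expR (- a) * expR (a * b) <= expR (- a) * (1 + 2 * (a * b)).
    by rewrite ler_wpM2l// expR_ge0.
  move=> /le_trans; apply; rewrite mulrDr mulr1 lerD2l -[e / 2]mul1r.
  by rewrite ler_pM ?expR_ge0// mulr_ge0.
apply/andP; split.
  by apply: le_trans h1; rewrite [e]splitr opprD addrA lerB.
by apply: (le_trans h2); rewrite [e in leRHS]splitr addrA lerD.
Unshelve. all: by end_near. Qed.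

(** The point [r n] has expected count c only in the limit; it is enclosed between the exact levels
    of c + k and c - k, where the limit is known, and the exponential is continuous. *)
Lemma max_cdf_cvg (r : nat -> R) (c : R) : 0 < c -> (\forall n \near \oo, 0 <= r n) ->
  N n * H n (r n) @[n --> \oo] --> c -> max_cdf n (r n) @[n --> \oo] --> expR (- c).
Proof.
move=> c0 r0 Nr; apply: cvg_of_bounds => e e0.
have e20 : 0 < e / 2 by rewrite divr_gt0.
have [k /andP[k0 kc] ke] : exists2 k, 0 < k < c & forall c', `|c - c'| <= k ->
    `|expR (- c) - expR (- c')| <= e / 2.
  have ec : {for c, continuous (fun c : R => expR (- c))}.
    by apply: continuous_comp; [exact: opp_continuous|exact: continuous_expR].
  have /cvgrPdist_le/(_ _ e20)/nbhs_ballP[d /= d0 de] := ec.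
  have m0 : 0 < Num.min c d by rewrite lt_min c0.
  exists (Num.min c d / 2).
    rewrite divr_gt0//= ltr_pdivrMr//; apply: (@le_lt_trans _ _ c).
      by rewrite ge_min lexx.
    by rewrite ltr_pMr// ltr1n.
  move=> c' cc'; apply: de => /=; rewrite /ball/= (le_lt_trans cc')// ltr_pdivrMr//.
  apply: (@le_lt_trans _ _ d); first by rewrite ge_min lexx orbT.
  by rewrite ltr_pMr// ltr1n.
have km0 : 0 < c - k by rewrite subr_gt0.
have kp0 : 0 < c + k by rewrite addr_gt0.
near=> n.
have B : pair_bounds n by near: n; exact: ep_bounds.
have N0 : 0 < N n by near: n; exact: near_N_gt0.
have rn0 : 0 <= r n by near: n.
have [/andP[lm0 _] lmE] : 0 <= level (c - k) n <= 1 /\ N n * H n (level (c - k) n) = c - k.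
  by near: n; apply: level_eq; exact: ltW.
have [/andP[lp0 _] lpE] : 0 <= level (c + k) n <= 1 /\ N n * H n (level (c + k) n) = c + k.
  by near: n; apply: level_eq; exact: ltW.
have : `|c - N n * H n (r n)| < k by near: n; apply: cvgr_dist_lt.
rewrite ltr_distlC => /andP[ck1 ck2].
have rm : r n <= level (c - k) n by exact: (antitone_le B N0 lm0 rn0 lmE erefl).
have rp : level (c + k) n <= r n by exact: (antitone_le B N0 rn0 lp0 erefl lpE).
have cm : `|expR (- (c - k)) - max_cdf n (level (c - k) n)| <= e / 2.
  by near: n; apply: cvgr_dist_le => //; exact: max_cdf_level.
have cp : `|expR (- (c + k)) - max_cdf n (level (c + k) n)| <= e / 2.
  by near: n; apply: cvgr_dist_le => //; exact: max_cdf_level.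
have /ke dm : `|c - (c - k)| <= k by rewrite opprB addrC subrK gtr0_norm.
have /ke dp : `|c - (c + k)| <= k by rewrite opprD addrA subrr sub0r normrN gtr0_norm.
have m1 := le_max_cdf n rm; have m2 := le_max_cdf n rp.
move: cm cp dm dp; rewrite !ler_distlC => /andP[_ h1] /andP[h2 _] /andP[_ h3] /andP[h4 _].
apply/andP; split.
  apply: le_trans m2; apply: le_trans h2.
  by rewrite [e in leLHS]splitr opprD addrA lerD2r.
apply: (le_trans m1); apply: (le_trans h1).
by rewrite [e in leRHS]splitr addrA lerD2r.
Unshelve. all: by end_near. Qed.

End extreme_pairs.

(** * Limit law of the gap *)

Section gap_limit.
Context (R : realType) (dd : nat -> measure_display) (T : forall n, measurableType (dd n)).
Variables (P : forall n, probability (T n) R) (V1 V2 : forall n, T n -> R).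
Variables (H : nat -> R -> R) (N : nat -> R) (p : nat -> nat).
Hypothesis E : extreme_pairs P V1 V2 H N p.
Variable x : R.
Hypothesis x0 : 0 <= x.

Local Notation level := (level H N).
Local Notation max_cdf n := (top_cdf (P n) (@V1 n)).
Local Notation slab2 n := (slab_event (@V1 n) (@V2 n)).

Definition gap_event n : set (T n) := [set w | x < n%:R * V1 w * (V1 w - V2 w)].

(** For [V1 > 0] the gap event means V2 < V1 - x / (n V1); this is the right-hand side when [V1]
    sits at the level of [a]. *)
Definition shift (a : R) n : R := level a n - x / (n%:R * level a n).

Lemma measurable_gap_event n : measurable (@gap_event n).
Proof.
apply: measurable_gt; apply: measurable_funM; last first.
  by apply: measurable_funB; [exact: (ep_V1 E)|exact: (ep_V2 E)].
by apply: measurable_funM; [exact: measurable_cst|exact: (ep_V1 E)].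
Qed.

Lemma shift_ge0 a : 0 < a -> \forall n \near \oo, 0 <= shift a n.
Proof. by move=> a0; exact: quantile_shift_ge0 (ep_tails E) a0 (level_quantile E a0) x0. Qed.

Lemma shift_cvg a : 0 < a -> N n * H n (shift a n) @[n --> \oo] --> a * expR x.
Proof. by move=> a0; exact: quantile_shift_cvg (ep_tails E) a0 (level_quantile E a0) x0. Qed.

Lemma max_cdf_shift a : 0 < a ->
  max_cdf n (shift a n) @[n --> \oo] --> expR (- (a * expR x)).
Proof.
move=> a0; apply: (max_cdf_cvg E) (shift_cvg a0); last exact: shift_ge0.
by rewrite mulr_gt0// expR_gt0.
Qed.

Lemma tail_shift_cvg0 a : 0 < a ->
  2 * (p n)%:R * H n (shift a n) @[n --> \oo] --> (0 : R).
Proof.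
move=> a0.
have : (2 * (p n)%:R / N n) * (N n * H n (shift a n)) @[n --> \oo] --> 0 * (a * expR x).
  by apply: cvgM; [exact: ep_ratio E|exact: shift_cvg].
rewrite mul0r; apply: cvg_trans; apply: near_eq_cvg; near=> n.
have N0 : 0 < N n by near: n; exact: near_N_gt0 E.
by rewrite mulrA divfK// gt_eqF.
Unshelve. all: by end_near. Qed.

Section cells.
Variables (b : R) (J : nat).
Hypothesis b0 : 0 < b.

Let jb0 j : (0 < j)%N -> 0 < j%:R * b.
Proof. by move=> j0; rewrite mulr_gt0// ltr0n. Qed.

(** Levels decrease with their index: cell j is []level (j.+1%:R * b) n, level (j%:R * b) n]]. Index
    0 is left out because the level of 0 is 1 by convention and not a quantile, so [shift] is not
    controlled there. *)
Record grid n : Prop := Grid {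
  grid_bounds : pair_bounds (P n) (@V1 n) (@V2 n) (H n) (N n) (p n);
  grid_n : (0 < n)%N;
  grid_N : 0 < N n;
  grid_level : forall j, (0 < j)%N -> (j <= J)%N ->
    [/\ 0 < level (j%:R * b) n, N n * H n (level (j%:R * b) n) = j%:R * b &
        0 <= shift (j%:R * b) n] }.

Lemma near_grid : \forall n \near \oo, grid n.
Proof.
have h : \forall n \near \oo, forall j, (j < J)%N ->
    [/\ 0 < level (j.+1%:R * b) n, N n * H n (level (j.+1%:R * b) n) = j.+1%:R * b &
        0 <= shift (j.+1%:R * b) n].
  apply: near_forall_lt => j _; near=> n.
  have [/andP[l0 _] lE] : 0 < level (j.+1%:R * b) n <= 2^-1 /\
      N n * H n (level (j.+1%:R * b) n) = j.+1%:R * b.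
    by near: n; exact: (level_quantile E (jb0 (ltn0Sn j))).
  by split => //; near: n; exact: (shift_ge0 (jb0 (ltn0Sn j))).
near=> n; split.
- by near: n; exact: ep_bounds E.
- by near: n; exact: nbhs_infty_gt.
- by near: n; exact: near_N_gt0 E.
- by move=> [//|j] _; move: j; near: n.
Unshelve. all: by end_near. Qed.

Lemma grid_mono n i j : grid n -> (0 < i)%N -> (i <= j)%N -> (j <= J)%N ->
  level (j%:R * b) n <= level (i%:R * b) n.
Proof.
move=> G i0 ij jJ; have [->//|inj] := eqVneq i j.
have lij : (i < j)%N by rewrite ltn_neqAle inj.
have [li lE _] := grid_level G i0 (leq_trans ij jJ).
have [lj lE' _] := grid_level G (leq_trans i0 ij) jJ.
apply: (antitone_le (grid_bounds G) (grid_N G) (ltW li) (ltW lj) lE lE').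
by rewrite ltr_pM2r// ltr_nat.
Qed.

Lemma cell_width n j : grid n -> (0 < j)%N -> (j < J)%N ->
  N n * (H n (level (j.+1%:R * b) n) - H n (level (j%:R * b) n)) = b.
Proof.
move=> G j0 jJ; have [_ lE _] := grid_level G j0 (ltnW jJ).
have [_ lE' _] := grid_level G (ltn0Sn j) jJ.
by rewrite mulrBr lE lE' -natr1; ring.
Qed.

Lemma cell_search (v : R) (f : nat -> R) K : v <= f 1%N -> f K < v -> (0 < K)%N ->
  exists2 j, (0 < j < K)%N & f j.+1 < v <= f j.
Proof.
elim: K => // K IH v1 vK _; case: K IH vK => [|K] IH vK.
  by move: v1; rewrite leNgt vK.
have [vK'|Kv] := ltP (f K.+1) v.
  have [j /andP[j0 jK] fj] := IH v1 vK' isT.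
  by exists j => //; rewrite j0 ltnS ltnW.
by exists K.+1; rewrite ?ltnSn// vK Kv.
Qed.

(** Values of [V1] above the first level or below the last one are given up entirely. Inside a cell
    v - x / (n v) increases with v, so the constraint on [V2] is weakened to the shift of the upper
    end. *)
Lemma gap_event_upper n : (0 < J)%N -> grid n -> pr (P n) (@gap_event n) <=
  (1 - max_cdf n (level b n)) + \sum_(1 <= j < J) b *
    (max_cdf n (shift (j%:R * b) n) + 2 * (p n)%:R * H n (shift (j%:R * b) n)) +
  max_cdf n (level (J%:R * b) n).
Proof.
move=> J0 G; have B := grid_bounds G; have mG := @measurable_gap_event n.
pose top := ~` [set w : T n | V1 w <= level b n].
pose bot := [set w : T n | V1 w <= level (J%:R * b) n].
have mtop : measurable top by apply: measurableC; exact: (measurable_top_le E).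
have mbot : measurable bot by exact: (measurable_top_le E).
pose mid := (@gap_event n `\` top) `\` bot.
have mmid : measurable mid by apply: measurableD => //; exact: measurableD.
have sub : @gap_event n `<=` (top `|` mid) `|` bot.
  move=> w gw; have [?|nt] := pselect (top w); first by left; left.
  by have [?|nb] := pselect (bot w); [right|left; right].
have mtm : measurable (top `|` mid) by exact: measurableU.
apply: (le_trans (le_pr _ mG (measurableU _ _ mtm mbot) sub)).
apply: (le_trans (pr_le_U _ mtm mbot)).
rewrite lerD2r (le_trans (pr_le_U _ mtop mmid))//.
rewrite prC; last by exact: (measurable_top_le E).
rewrite lerD2l.
apply: (@le_trans _ _ (\sum_(1 <= j < J)
    pr (P n) (slab2 n (level (j.+1%:R * b) n) (level (j%:R * b) n) (shift (j%:R * b) n)))).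
  apply: pr_le_sum => // [j|w]; first exact: (measurable_slab2 E).
  move=> [[gw /contrapT nt] /negP]; rewrite -ltNge => nb.
  have [|j /andP[j0 jJ] jw] := @cell_search (V1 w) (fun j => level (j%:R * b) n) J _ nb J0.
    by rewrite mul1r.
  exists j; first by rewrite mem_index_iota j0.
  split => //; move: jw => /andP[jw wj].
  have [lj _ _] := grid_level G j0 (ltnW jJ).
  have [lj' _ _] := grid_level G (ltn0Sn j) jJ.
  have V0 : 0 < V1 w by exact: lt_trans jw.
  have nV : 0 < n%:R * V1 w by rewrite mulr_gt0// ltr0n; exact: grid_n G.
  have : V2 w <= V1 w - x / (n%:R * V1 w).
    rewrite lerBrDr -lerBrDl ler_pdivrMr// mulrC; exact: ltW.
  move=> /le_trans; apply; rewrite /shift lerB// ler_wpM2l//.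
  rewrite lef_pV2 ?posrE// ?ler_wpM2l//.
  by rewrite mulr_gt0// ltr0n; exact: grid_n G.
rewrite big_nat [leRHS]big_nat; apply: ler_sum => j /andP[j0 jJ].
have [lj _ sj] := grid_level G j0 (ltnW jJ).
have [lj' _ _] := grid_level G (ltn0Sn j) jJ.
rewrite -[X in _ <= X * _](cell_width G j0 jJ).
by apply: (slab_upper B) => //; [exact: ltW|exact: grid_mono].
Qed.

(** The same monotonicity strengthens the constraint on [V2] to the shift of the lower end, which is
    also below the cell, as [slab_lower] requires; the cells are disjoint. *)
Lemma gap_event_lower n : grid n ->
  \sum_(1 <= j < J) b * (max_cdf n (shift (j.+1%:R * b) n) -
    2 * (p n)%:R * H n (shift (j.+1%:R * b) n)) <= pr (P n) (@gap_event n).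
Proof.
move=> G; have B := grid_bounds G.
apply: (@le_trans _ _ (\sum_(1 <= j < J)
    pr (P n) (slab2 n (level (j.+1%:R * b) n) (level (j%:R * b) n) (shift (j.+1%:R * b) n)))).
  rewrite big_nat [leRHS]big_nat; apply: ler_sum => j /andP[j0 jJ].
  have [lj _ sj] := grid_level G j0 (ltnW jJ).
  have [lj' _ sj'] := grid_level G (ltn0Sn j) jJ.
  rewrite -[X in X * _ <= _](cell_width G j0 jJ).
  apply: (slab_lower B) => //; [exact: ltW|exact: grid_mono|].
  by rewrite gerBl divr_ge0// mulr_ge0// ltW.
apply: sum_le_pr; first exact: measurable_gap_event.
- by move=> j; exact: (measurable_slab2 E).
- exact: iota_uniq.
- move=> j w; rewrite mem_index_iota => /andP[j0 jJ] [/andP[jw wj] V2w].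
  have [lj' _ _] := grid_level G (ltn0Sn j) jJ.
  have n0 : 0 < n%:R :> R by rewrite ltr0n; exact: grid_n G.
  have V0 : 0 < V1 w by exact: lt_trans jw.
  rewrite /gap_event/= mulrC -ltr_pdivrMr ?mulr_gt0// ltrBrDr -ltrBrDl.
  apply: (le_lt_trans V2w); rewrite /shift ltr_leB// ler_wpM2l//.
  by rewrite lef_pV2 ?posrE ?mulr_gt0// ler_wpM2l// ltW.
- move=> i j w; rewrite !mem_index_iota => /andP[i0 iJ] /andP[j0 jJ].
  move=> [/andP[iw wi] _] [/andP[jw wj] _]; apply/eqP; rewrite eqn_leq.
  apply/andP; split; rewrite leqNgt; apply/negP => lt.
    have := grid_mono G (ltn0Sn j) lt (ltnW iJ).
    by rewrite leNgt (lt_le_trans jw wi).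
  have := grid_mono G (ltn0Sn i) lt (ltnW jJ).
  by rewrite leNgt (lt_le_trans iw wj).
Qed.

(* As the mesh [b] tends to 0, the right-hand side becomes the integral of
   [a |-> expR (- a * expR x)] over the positive reals, that is [expR (- x)]. *)
Lemma gap_event_upper_cvg : (0 < J)%N ->
  (1 - max_cdf n (level b n)) + \sum_(1 <= j < J) b *
    (max_cdf n (shift (j%:R * b) n) + 2 * (p n)%:R * H n (shift (j%:R * b) n)) +
  max_cdf n (level (J%:R * b) n) @[n --> \oo] -->
  (1 - expR (- b)) + \sum_(1 <= j < J) b * expR (- (j%:R * b * expR x)) +
  expR (- (J%:R * b)).
Proof.
move=> J0; apply: cvgD; last by apply: (max_cdf_level E); exact: jb0.
apply: cvgD; first by apply: cvgB; [exact: cvg_cst|exact: (max_cdf_level E)].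
rewrite [X in _ --> X]big_nat; under eq_fun do rewrite big_nat.
apply: cvg_big => [|j /andP[j0 _]]; first exact: add_continuous.
apply: cvgM; first exact: cvg_cst.
rewrite -[X in _ --> X]addr0; apply: cvgD.
  by apply: max_cdf_shift; exact: jb0.
by apply: tail_shift_cvg0; exact: jb0.
Qed.

Lemma gap_event_lower_cvg :
  \sum_(1 <= j < J) b * (max_cdf n (shift (j.+1%:R * b) n) -
    2 * (p n)%:R * H n (shift (j.+1%:R * b) n)) @[n --> \oo] -->
  \sum_(1 <= j < J) b * expR (- (j.+1%:R * b * expR x)).
Proof.
apply: cvg_big => [|j _]; first exact: add_continuous.
apply: cvgM; first exact: cvg_cst.
rewrite -[X in _ --> X]subr0; apply: cvgB.
  by apply: max_cdf_shift; exact: jb0.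
by apply: tail_shift_cvg0; exact: jb0.
Qed.

End cells.

(** Each term is compared with an increment of - exp (- a c) / c, an antiderivative of exp (- a c),
    and the increments telescope; a single comparison is the inequality 1 + y <= exp y with y = b
    c. *)
Lemma riemann_sum_le (b c : R) J : 0 < b -> 0 < c ->
  \sum_(1 <= j < J) b * expR (- (j%:R * b * c)) <= c^-1.
Proof.
move=> b0 c0.
have step (j : nat) : b * expR (- (j.+1%:R * b * c)) <=
    c^-1 * (expR (- (j%:R * b * c)) - expR (- (j.+1%:R * b * c))).
  rewrite ler_pdivlMl// -natr1 !mulrDl mul1r opprD expRD.
  set e := expR (- (j%:R * b * c)); have e0 : 0 <= e by exact: expR_ge0.
  have h : (1 + b * c) * expR (- (b * c)) <= 1.
    by rewrite expRN ler_pdivrMr ?expR_gt0// mul1r expR_ge1Dx.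
  have : e * ((1 + b * c) * expR (- (b * c))) <= e * 1 by rewrite ler_wpM2l.
  by rewrite mulr1 => h'; rewrite lerBrDr; apply: le_trans h'; rewrite le_eqVlt; apply/orP; left; apply/eqP; ring.
case: J => [|J]; first by rewrite big_geq// invr_ge0 ltW.
rewrite big_add1/=.
apply: (@le_trans _ _ (\sum_(0 <= j < J)
    c^-1 * (expR (- (j%:R * b * c)) - expR (- (j.+1%:R * b * c))))).
  by apply: ler_sum.
rewrite -mulr_sumr; under eq_bigr do rewrite -opprB.
rewrite sumrN telescope_sumr// opprB !mul0r oppr0 expR0.
by rewrite -[leRHS]mulr1 ler_wpM2l// ?gerBl ?expR_ge0// invr_ge0 ltW.
Qed.

Lemma riemann_sum_ge (b c : R) J : 0 < b -> 0 < c ->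
  c^-1 * (expR (- (2 * b * c)) - expR (- (J%:R * b * c))) <=
  \sum_(1 <= j < J) b * expR (- (j.+1%:R * b * c)).
Proof.
move=> b0 c0.
have step (j : nat) : c^-1 * (expR (- (j%:R * b * c)) - expR (- (j.+1%:R * b * c))) <=
    b * expR (- (j%:R * b * c)).
  rewrite ler_pdivrMl// -natr1 !mulrDl mul1r opprD expRD.
  set e := expR (- (j%:R * b * c)); have e0 : 0 <= e by exact: expR_ge0.
  have h : 1 - b * c <= expR (- (b * c)) by exact: expR_ge1Dx.
  have : e * (1 - b * c) <= e * expR (- (b * c)) by rewrite ler_wpM2l.
  by rewrite mulrBr mulr1 => h'; rewrite lerBlDr -lerBlDl; apply: le_trans h';
    rewrite le_eqVlt; apply/orP; left; apply/eqP; ring.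
have [J1|J1] := leqP J 1.
  rewrite big_geq//; rewrite pmulr_rle0 ?invr_gt0// subr_le0 ler_expR lerN2.
  by rewrite !ler_pM2r// ler_nat (leq_trans J1).
apply: (@le_trans _ _ (\sum_(1 <= j < J)
    c^-1 * (expR (- (j.+1%:R * b * c)) - expR (- (j.+2%:R * b * c))))); last first.
  by apply: ler_sum.
rewrite -mulr_sumr; under eq_bigr do rewrite -opprB.
rewrite sumrN (@telescope_sumr_eq _ 1 J (fun j => expR (- (j.+1%:R * b * c))))//; last exact: ltnW.
rewrite opprB ler_wpM2l//; first by rewrite invr_ge0 ltW.
rewrite lerD2l lerN2 ler_expR lerN2.
by rewrite !ler_pM2r// ler_nat.
Qed.

Lemma gap_event_cvg : pr (P n) (@gap_event n) @[n --> \oo] --> expR (- x).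
Proof.
apply: cvg_of_bounds => e e0.
pose c := expR x; have c1 : 1 <= c by rewrite -expR0 ler_expR.
have c0 : 0 < c by exact: lt_le_trans c1.
have cV : c^-1 = expR (- x) by rewrite expRN.
(* Here b c = e / 8 controls the error of the Riemann sums and b <= e / 8 the mass above the first
   level. Taking J b >= 1 / b brings the mass below the last level, about exp (- J b), under b as
   well. *)
pose b := e / (8 * c).
have b0 : 0 < b by rewrite divr_gt0// mulr_gt0.
have bc : b * c = e / 8 by rewrite /b; field; rewrite gt_eqF.
have be : b <= e / 8 by rewrite -bc ler_peMr// ltW.
pose J := (Num.truncn ((b * b)^-1)).+1.
have JJ : (b * b)^-1 < J%:R by exact: truncnS_gt.
have Jb : b^-1 <= J%:R * b.
  by rewrite -ler_pdivrMr// -invfM ltW.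
have eJ : expR (- (J%:R * b)) <= b.
  rewrite expRN -[leRHS]invrK lef_pV2 ?posrE ?invr_gt0 ?expR_gt0//.
  by apply: (le_trans Jb); rewrite (le_trans _ (expR_ge1Dx _))// lerDr.
have e4 : 0 < e / 4 by rewrite divr_gt0.
have /cvgrPdist_le/(_ _ e4) hU := @gap_event_upper_cvg b J b0 isT.
have /cvgrPdist_le/(_ _ e4) hL := @gap_event_lower_cvg b J b0.
move: (near_grid J b0) hU hL; apply: filterS3 => n G.
have := gap_event_upper b0 (ltn0Sn _) G; have := gap_event_lower b0 G.
move=> lo up; rewrite !ler_distlC => /andP[_ hu] /andP[hl _].
have s1 := riemann_sum_le J b0 c0; have s2 := riemann_sum_ge J b0 c0.
have eb := expR_ge1Dx (- b).
have cV1 : c^-1 <= 1 by rewrite invf_le1.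
have l1 : c^-1 * (expR (- (2 * b * c)) - expR (- (J%:R * b * c))) >= c^-1 - (2 * (b * c) + b).
  have h1 := expR_ge1Dx (- (2 * b * c)).
  have h2 : expR (- (J%:R * b * c)) <= b.
    by apply: le_trans eJ; rewrite ler_expR lerN2 ler_peMr// mulr_ge0// ltW.
  have h3 : c^-1 * (1 - (2 * b * c) - b) <=
      c^-1 * (expR (- (2 * b * c)) - expR (- (J%:R * b * c))).
    by apply: ler_wpM2l; [rewrite invr_ge0 ltW|exact: lerB h1 h2].
  apply: le_trans h3; rewrite -!addrA -!opprD mulrBr mulr1 lerD2l lerN2 -mulrA.
  rewrite ler_piMl//; apply: addr_ge0; last exact: ltW.
  by apply: mulr_ge0 => //; rewrite bc divr_ge0// ltW.
rewrite -cV; apply/andP; split.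
  apply: le_trans lo; apply: le_trans hl; rewrite -/c.
  move: (le_trans l1 s2) be; rewrite bc; move: c^-1 => c'; move: (\sum_(_ <= _ < _) _) => sm.
  lra.
apply: (le_trans up); apply: (le_trans hu); rewrite -/c.
move: s1 eJ eb be e0; move: c^-1 => c'; move: (\sum_(_ <= _ < _) _) => sm.
move: (expR _) (expR _) => *; lra.
Qed.

End gap_limit.

(** * Spherical laws *)

Section orthogonal.
Context {R : realType} {n : nat}.
Implicit Types (u v x y : 'cV[R]_n) (O : 'M[R]_n).

Definition inner x y : R := \sum_k x k 0 * y k 0.

Lemma innerE x y : (x^T *m y) = (inner x y)%:M.
Proof.
rewrite [LHS]mx11_scalar mxE; congr (_%:M).
by apply: eq_bigr => k _; rewrite mxE.
Qed.

Lemma innerC x y : inner x y = inner y x.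
Proof. by apply: eq_bigr => k _; rewrite mulrC. Qed.

Lemma innerBl x y v : inner (x - y) v = inner x v - inner y v.
Proof. by rewrite -sumrB; apply: eq_bigr => k _; rewrite !mxE mulrBl. Qed.

Lemma innerBr x y v : inner v (x - y) = inner v x - inner v y.
Proof. by rewrite innerC innerBl !(innerC v). Qed.

Lemma innerZl a x y : inner (a *: x) y = a * inner x y.
Proof. by rewrite mulr_sumr; apply: eq_bigr => k _; rewrite !mxE mulrA. Qed.

Lemma inner_ge0 x : 0 <= inner x x.
Proof. by apply: sumr_ge0 => k _; rewrite -expr2 sqr_ge0. Qed.

Lemma inner_eq0 x : (inner x x == 0) = (x == 0).
Proof.
apply/eqP/eqP => [|->]; last by rewrite /inner big1// => k _; rewrite mxE mul0r.
move=> /eqP; rewrite psumr_eq0 => [|k _]; last by rewrite -expr2 sqr_ge0.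
move=> /allP x0; apply/colP => k; rewrite mxE; apply/eqP.
by have := x0 k (mem_index_enum _); rewrite /= mulf_eq0 orbb.
Qed.

Lemma inner_delta x k : inner x (delta_mx k 0) = x k 0.
Proof.
rewrite /inner (bigD1 k)//= big1 => [|j jk]; first by rewrite mxE !eqxx mulr1 addr0.
by rewrite mxE (negbTE jk) mulr0.
Qed.

Lemma inner_mul O x y : O *m O^T = 1%:M -> inner (O *m x) (O *m y) = inner x y.
Proof.
move=> /mulmx1C OO; have := innerE (O *m x) (O *m y).
rewrite trmx_mul -mulmxA (mulmxA _ O y) OO mul1mx innerE.
by move=> /matrixP/(_ 0 0); rewrite !mxE !eqxx.
Qed.

Definition householder v : 'M[R]_n := 1%:M - (2 / inner v v) *: (v *m v^T).

Lemma householder_mul v x : householder v *m x = x - (2 * inner v x / inner v v) *: v.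
Proof.
rewrite mulmxBl mul1mx -scalemxAl -mulmxA innerE mul_mx_scalar scalerA.
by rewrite mulrAC.
Qed.

Lemma householder_orthogonal v : v != 0 -> householder v *m (householder v)^T = 1%:M.
Proof.
move=> v0; have vv : inner v v != 0 by rewrite inner_eq0.
have -> : (householder v)^T = householder v.
  by rewrite /householder linearB/= linearZ/= trmx_mul trmxK trmx1.
rewrite {2}/householder mulmxBr mulmx1 -scalemxAr mulmxA householder_mul.
rewrite -mulrA mulfV// mulr1 [2 *: v]scaler_nat mulr2n opprD addrA subrr sub0r.
by rewrite mulNmx scalerN opprK /householder subrK.
Qed.

(** The reflection along x - y exchanges two vectors of equal norm and fixes everything orthogonal
    to both. *)
Lemma exists_reflection x y : inner x x = inner y y ->
  exists O : 'M[R]_n, [/\ O *m O^T = 1%:M, O *m x = y &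
    forall u, inner u x = 0 -> inner u y = 0 -> O *m u = u].
Proof.
move=> xy; have [->|nxy] := eqVneq x y.
  by exists 1%:M; split; rewrite ?trmx1 ?mul1mx// => u _ _; rewrite mul1mx.
have vn0 : x - y != 0 by rewrite subr_eq0.
have vv : inner (x - y) (x - y) != 0 by rewrite inner_eq0.
exists (householder (x - y)); split; first exact: householder_orthogonal.
  have E : 2 * inner (x - y) x / inner (x - y) (x - y) = 1.
    apply: (mulIf vv); rewrite divfK// mul1r innerBr !innerBl xy (innerC y x).
    by move: (inner x y) (inner y y) => a b; ring.
  by rewrite householder_mul E scale1r opprB addrC subrK.
move=> u ux uy; rewrite householder_mul innerC innerBr ux uy subrr mulr0 mul0r.
by rewrite scale0r subr0.
Qed.

(** Two reflections suffice: the second, which carries the image of y to its target, leaves the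
    image of x in place because that image is orthogonal to both. *)
Lemma exists_orthonormal_map x y (i j : 'I_n) : i != j ->
  inner x x = 1 -> inner y y = 1 -> inner x y = 0 ->
  exists O : 'M[R]_n, [/\ O *m O^T = 1%:M, O *m x = delta_mx i 0 & O *m y = delta_mx j 0].
Proof.
move=> ij x1 y1 xy.
have delta1 k : inner (delta_mx k 0) (delta_mx k 0) = 1 by rewrite inner_delta mxE !eqxx.
have [A1 [A1A A1x _]] := @exists_reflection x (delta_mx i 0) ltac:(by rewrite x1 delta1).
have [A2 [A2A A2y A2id]] := @exists_reflection (A1 *m y) (delta_mx j 0)
  ltac:(by rewrite inner_mul// y1 delta1).
exists (A2 *m A1); split.
- by rewrite trmx_mul mulmxA -(mulmxA A2) A1A mulmx1.
- rewrite -mulmxA A1x A2id//; first by rewrite -A1x inner_mul.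
  by rewrite inner_delta mxE eq_sym (negbTE ij).
- by rewrite -mulmxA.
Qed.

End orthogonal.

(** * Centering as projection along a coordinate axis *)

Section axis_coordinates.
Context {R : realType} {n : nat}.
Implicit Types (z : n.-tuple R) (O : 'M[R]_n).

Definition tuple_col z : 'cV[R]_n := \col_j tnth z j.

(* Up to rotation the axis [i0] is the line of constant vectors, and [axis_dist i0 z]
   is the norm of the centered vector. *)
Definition axis_dist (i0 : 'I_n) z : R :=
  Num.sqrt (\sum_(k | k != i0) tnth z k ^+ 2).

(** After the constants have been rotated onto the axis [i0], this is a coordinate of the centered
    and normalized vector; it is 0 if the centered vector vanishes. *)
Definition axis_coord (i0 k : 'I_n) z : R := tnth z k / axis_dist i0 z.

Lemma tuple_col_mulmx O z : tuple_col (tuple_mulmx O z) = O *m tuple_col z.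
Proof. by apply/colP => i; rewrite mxE tnth_mktuple. Qed.

Lemma dotE x y : dot x y = inner (tuple_col x) (tuple_col y).
Proof. by apply: eq_bigr => k _; rewrite !mxE. Qed.

Lemma axis_dist_sqr (i0 : 'I_n) z :
  axis_dist i0 z ^+ 2 = dot z z - tnth z i0 ^+ 2.
Proof.
rewrite sqr_sqrtr; last by apply: sumr_ge0 => k _; exact: sqr_ge0.
rewrite /dot [X in _ = X - _](bigD1 i0)//= -[tnth z i0 * _]expr2 [X in _ = X - _]addrC addrK.
by apply: eq_bigr => k _; rewrite expr2.
Qed.

Lemma axis_dist_ge0 i0 z : 0 <= axis_dist i0 z. Proof. exact: sqrtr_ge0. Qed.

Lemma axis_dist_eq0 i0 z : axis_dist i0 z = 0 <-> forall k, k != i0 -> tnth z k = 0.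
Proof.
split=> [/eqP|z0].
  rewrite sqrtr_eq0 => le0 k ki.
  have : \sum_(k | k != i0) tnth z k ^+ 2 == 0.
    by rewrite eq_le le0 sumr_ge0// => j _; exact: sqr_ge0.
  rewrite psumr_eq0 => [/allP/(_ k (mem_index_enum _))|j _]; last exact: sqr_ge0.
  by rewrite ki sqrf_eq0 => /eqP.
by rewrite /axis_dist big1 ?sqrtr0// => k /z0 ->; rewrite expr0n.
Qed.

Lemma axis_coord_norm i0 k z : k != i0 -> `|axis_coord i0 k z| <= 1.
Proof.
move=> ki; have [z0|nz0] := eqVneq (axis_dist i0 z) 0.
  by rewrite /axis_coord z0 invr0 mulr0 normr0.
have z0 : 0 < axis_dist i0 z by rewrite lt_neqAle eq_sym nz0 axis_dist_ge0.
rewrite normrM normfV (gtr0_norm z0) ler_pdivrMr// mul1r.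
rewrite -(@ler_pXn2r _ 2) ?nnegrE ?normr_ge0 ?axis_dist_ge0//.
rewrite real_normK ?num_real// sqr_sqrtr; last by apply: sumr_ge0 => j _; exact: sqr_ge0.
by rewrite (bigD1 k)//= lerDl sumr_ge0// => j _; exact: sqr_ge0.
Qed.

Lemma axis_coord_sqr_sum i0 z : axis_dist i0 z != 0 ->
  \sum_(k | k != i0) axis_coord i0 k z ^+ 2 = 1.
Proof.
move=> z0; under eq_bigr do rewrite expr_div_n.
rewrite -mulr_suml -[X in X / _](@sqr_sqrtr _ (\sum_(k | _) _)); last first.
  by apply: sumr_ge0 => k _; exact: sqr_ge0.
by rewrite mulfV// sqrf_eq0.
Qed.

Lemma axis_dist_fix O i0 z : O *m O^T = 1%:M ->
  tnth (tuple_mulmx O z) i0 = tnth z i0 -> axis_dist i0 (tuple_mulmx O z) = axis_dist i0 z.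
Proof.
move=> OO Oi0; apply/eqP; rewrite -(@eqrXn2 _ 2) ?axis_dist_ge0//.
by rewrite !axis_dist_sqr Oi0 !dotE tuple_col_mulmx inner_mul.
Qed.

Definition unit_cst : 'cV[R]_n := const_mx (Num.sqrt n%:R)^-1.

Lemma tuple_col_centered z :
  tuple_col (centered z) = tuple_col z - const_mx (sample_mean z).
Proof. by apply/colP => k; rewrite !mxE tnth_mktuple. Qed.

Lemma inner_cst z a : (0 < n)%N ->
  inner (tuple_col z) (const_mx a) = a * n%:R * sample_mean z.
Proof.
move=> n0; rewrite /inner /sample_mean mulrA mulfK ?pnatr_eq0 -?lt0n// mulr_sumr.
by apply: eq_bigr => k _; rewrite !mxE mulrC.
Qed.

Lemma inner_cst_cst (a b : R) : inner (const_mx a : 'cV[R]_n) (const_mx b) = a * b * n%:R.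
Proof.
by rewrite /inner; under eq_bigr do rewrite !mxE; rewrite sumr_const card_ord mulr_natr.
Qed.

Lemma inner_centered_cst z a : (0 < n)%N ->
  inner (tuple_col (centered z)) (const_mx a) = 0.
Proof.
by move=> n0; rewrite tuple_col_centered innerBl inner_cst// inner_cst_cst; ring.
Qed.

Lemma inner_unit_cst : (0 < n)%N -> inner unit_cst unit_cst = 1.
Proof.
move=> n0; rewrite inner_cst_cst -invfM -expr2 sqr_sqrtr ?ler0n// mulVf//.
by rewrite pnatr_eq0 -lt0n.
Qed.

Lemma axis_dist_centered Q (i0 : 'I_n) z : Q *m Q^T = 1%:M ->
  Q *m unit_cst = delta_mx i0 0 -> axis_dist i0 (tuple_mulmx Q z) = norm2 (centered z).
Proof.
move=> QQ Qu; have n0 : (0 < n)%N by exact: leq_ltn_trans (ltn_ord i0).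
have nn0 : 0 < n%:R :> R by rewrite ltr0n.
apply/eqP; rewrite -(@eqrXn2 _ 2) ?axis_dist_ge0 ?sqrtr_ge0//.
rewrite axis_dist_sqr sqr_sqrtr; last by rewrite dotE inner_ge0.
have -> : tnth (tuple_mulmx Q z) i0 = inner (tuple_col z) unit_cst.
  by rewrite -(inner_mul _ _ QQ) Qu inner_delta -tuple_col_mulmx mxE.
rewrite !dotE tuple_col_mulmx inner_mul//.
rewrite {2}tuple_col_centered innerBr inner_centered_cst// subr0.
rewrite tuple_col_centered innerBl (innerC (const_mx _)) !inner_cst//.
have -> : (Num.sqrt n%:R)^-1 * n%:R * sample_mean z = Num.sqrt n%:R * sample_mean z.
  rewrite -[X in _ * X * _](sqr_sqrtr (ltW nn0)) expr2 mulKf//.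
  by rewrite gt_eqF// sqrtr_gt0.
by rewrite exprMn sqr_sqrtr ?ler0n//; apply/eqP; ring.
Qed.

Lemma exists_centering (i0 : 'I_n) : exists Q, Q *m Q^T = 1%:M /\
  forall z, axis_dist i0 (tuple_mulmx Q z) = norm2 (centered z).
Proof.
have n0 : (0 < n)%N by exact: leq_ltn_trans (ltn_ord i0).
have [|Q [QQ Qu _]] := @exists_reflection _ _ unit_cst (delta_mx i0 0).
  by rewrite inner_unit_cst// inner_delta mxE !eqxx.
by exists Q; split => // z; exact: axis_dist_centered.
Qed.

(** The map Q sends the unit constant vector to the axis [i0] and the normalized centered [z'] to
    the axis [i1]. A correlation with a fixed vector thus becomes a coordinate; no condition on z is
    needed since both sides are 0 when its centered vector vanishes. *)
Lemma sample_corr_axis_coord z' (i0 i1 : 'I_n) : i0 != i1 ->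
  norm2 (centered z') != 0 ->
  exists Q, Q *m Q^T = 1%:M /\
    forall z, sample_corr z z' = axis_coord i0 i1 (tuple_mulmx Q z).
Proof.
move=> i01 cz'0; have n0 : (0 < n)%N by exact: leq_ltn_trans (ltn_ord i0).
pose e : 'cV[R]_n := (norm2 (centered z'))^-1 *: tuple_col (centered z').
have ee : inner e e = 1.
  rewrite innerZl innerC innerZl -dotE -[dot _ _]sqr_sqrtr -/(norm2 _).
    by rewrite mulrA -invfM -expr2 mulVf// sqrf_eq0.
  by rewrite dotE inner_ge0.
have ue : inner unit_cst e = 0 by rewrite innerC innerZl inner_centered_cst// mulr0.
have [Q [QQ Qu Qe]] := exists_orthonormal_map i01 (inner_unit_cst n0) ee ue.
exists Q; split => // z; rewrite /axis_coord (axis_dist_centered z QQ Qu).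
have -> : tnth (tuple_mulmx Q z) i1 = inner (tuple_col z) e.
  by rewrite -(inner_mul _ _ QQ) Qe inner_delta -tuple_col_mulmx mxE.
rewrite innerC innerZl innerC /sample_corr dotE tuple_col_centered innerBl.
by rewrite (innerC (const_mx _)) inner_centered_cst// subr0 [LHS]mulrC invfM; ring.
Qed.

End axis_coordinates.

Section spherical_laws.
Context d (T : measurableType d) (R : realType) (P : probability T R) (n : nat).
Variable X : {RV P >-> n.-tuple R}.
Hypothesis X_spherical : spherical P X.

Lemma measurable_tuple_mulmx (O : 'M[R]_n) : measurable_fun setT (tuple_mulmx O).
Proof.
apply/measurable_fun_tnthP => i.
rewrite (_ : _ \o _ = fun z => \sum_j O i j * tnth z j).
  by apply: measurable_sum => j; apply: measurable_funM => //; exact: measurable_tnth.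
apply/funext => z /=; rewrite tnth_mktuple mxE.
by apply: eq_bigr => j _; rewrite mxE.
Qed.

Lemma measurable_funV d' (T' : measurableType d') (f : T' -> R) :
  (forall z, 0 <= f z) -> measurable_fun setT f -> measurable_fun setT (fun z => (f z)^-1).
Proof.
move=> f0 mf; rewrite (_ : (fun _ => _) = (@powR R ^~ (-1)) \o f).
  exact: measurableT_comp (measurable_powR _) mf.
by apply/funext => z /=; rewrite powR_inv1.
Qed.

Lemma measurable_axis_dist (i0 : 'I_n) : measurable_fun setT (@axis_dist R n i0).
Proof.
apply: (measurableT_comp (f := @Num.sqrt R)).
  by apply: continuous_measurable_fun; exact: sqrt_continuous.
rewrite (_ : (fun _ => _) = fun z : n.-tuple R => dot z z - tnth z i0 ^+ 2).
  apply: measurable_funB; first exact: measurable_dot.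
  by apply: measurable_funX; exact: measurable_tnth.
apply/funext => z; rewrite -axis_dist_sqr sqr_sqrtr//.
by apply: sumr_ge0 => k _; exact: sqr_ge0.
Qed.

Lemma measurable_axis_coord (i0 k : 'I_n) : measurable_fun setT (@axis_coord R n i0 k).
Proof.
apply: measurable_funM; first exact: measurable_tnth.
by apply: measurable_funV => [z|]; [exact: axis_dist_ge0|exact: measurable_axis_dist].
Qed.

Lemma spherical_pr (O : 'M[R]_n) (A : set (n.-tuple R)) : O *m O^T = 1%:M ->
  measurable A -> pr P [set w | A (tuple_mulmx O (X w))] = pr P [set w | A (X w)].
Proof. by move=> OO mA; rewrite /pr; congr fine; exact: X_spherical. Qed.

Lemma spherical_Ex (O : 'M[R]_n) (f : n.-tuple R -> R) : O *m O^T = 1%:M ->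
  bounded_rv f -> Ex P (fun w => f (tuple_mulmx O (X w))) = Ex P (fun w => f (X w)).
Proof.
move=> OO [mf [M fM]].
have mOX : measurable_fun setT (tuple_mulmx O \o X).
  by apply: measurableT_comp; [exact: measurable_tuple_mulmx|].
pose OX : {mfun T >-> n.-tuple R} :=
  HB.pack (tuple_mulmx O \o X) (isMeasurableFun.Build _ _ _ _ _ mOX).
have h (phi : {mfun T >-> n.-tuple R}) :
    Ex P (fun w => f (phi w)) = fine (\int[pushforward P phi]_z (f z)%:E)%E.
  have mphi : measurable_fun setT phi by [].
  rewrite (@integral_pushforward _ _ _ _ _ phi mphi P setT (EFin \o f))//.
    exact/measurable_EFinP.
  rewrite preimage_setT.
  apply: (@bounded_rv_integrable _ _ _ P (f \o phi)); split; first exact: measurableT_comp.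
  by exists M => w; exact: fM.
rewrite (h OX) (h X); congr fine.
by apply: (eq_measure_integral (pushforward P X)) => A mA _; exact: X_spherical.
Qed.

End spherical_laws.

Section plane_reflection.
Context {R : realType} {n : nat}.
Variables (a b : 'I_n).
Hypothesis ab : a != b.

(** For small h the reflection along this vector is a perturbation of the one along the axis b: it
    nearly changes the sign of coordinate b but moves coordinate a by only O(h). Its entries are
    rational in h. *)
Definition plane_vector (h : R) : 'cV[R]_n := \col_j (h * (j == a)%:R + (j == b)%:R).

Lemma inner_plane_vector h (x : 'cV[R]_n) : inner (plane_vector h) x = h * x a 0 + x b 0.
Proof.
rewrite /inner (bigD1 a)//= (bigD1 b)/=; last by rewrite eq_sym.
rewrite big1 => [|j /andP[/negbTE ja /negbTE jb]]; last by rewrite mxE ja jb mulr0 add0r mul0r.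
by rewrite !mxE !eqxx [b == a]eq_sym (negbTE ab) /=; ring.
Qed.

Lemma plane_vector_neq0 h : plane_vector h != 0.
Proof.
apply/eqP => /colP/(_ b); rewrite !mxE eqxx eq_sym (negbTE ab) mulr0 add0r => /eqP.
by rewrite oner_eq0.
Qed.

Lemma plane_reflectionE h (z : n.-tuple R) j :
  tnth (tuple_mulmx (householder (plane_vector h)) z) j =
  tnth z j - 2 * (h * tnth z a + tnth z b) / (1 + h ^+ 2) * (h * (j == a)%:R + (j == b)%:R).
Proof.
rewrite tnth_mktuple -/(tuple_col z) householder_mul !inner_plane_vector !mxE.
rewrite !eqxx (negbTE ab) [b == a]eq_sym (negbTE ab) !mulr0 !mulr1 add0r addr0.
by rewrite [h * h + 1]addrC expr2.
Qed.

End plane_reflection.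

(** * The Stein identity from reflections in coordinate planes *)

Section spherical_stein.
Context d (T : measurableType d) (R : realType) (P : probability T R) (n : nat).
Variable X : {RV P >-> n.-tuple R}.
Hypothesis X_spherical : spherical P X.
Hypothesis X_neq0 : P [set w | X w = [tuple 0 | _ < n]] = 0%E.
Variables (i0 i1 : 'I_n).
Hypothesis i01 : i0 != i1.

Lemma measurable_axis (f : n.-tuple R -> n.-tuple R) : measurable_fun setT f ->
  measurable [set w | axis_dist i0 (f (X w)) = 0].
Proof.
move=> mf; rewrite (_ : [set _ | _] = (@axis_dist R n i0 \o (f \o X)) @^-1` [set 0]) //.
rewrite -[Y in measurable Y]setTI.
have mg : measurable_fun setT (@axis_dist R n i0 \o (f \o X)).
  apply: measurableT_comp; first exact: measurable_axis_dist.
  exact: measurableT_comp.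
exact: mg.
Qed.

(* The law gives the same mass to the infinitely many lines [Q_h i0], which only meet at 0. *)
Lemma axis_null : pr P [set w | axis_dist i0 (X w) = 0] = 0.
Proof.
set q := pr P _.
(* Distinct values in ]0, 1[: the line number j is x1 (h^2 - 1) = 2 h x0, where h^2 - 1 does not
   vanish and the slopes 2 h / (h^2 - 1) are distinct. *)
pose h (j : nat) : R := j.+2%:R^-1.
have h0 j : 0 < h j by rewrite invr_gt0.
have h1 j : h j < 1 by rewrite invf_lt1// ltr1n.
pose Q j := householder (plane_vector i0 i1 (h j)).
have QQ j : Q j *m (Q j)^T = 1%:M by apply: householder_orthogonal; exact: plane_vector_neq0.
pose Z := [set w | dot (X w) (X w) = 0].
have mZ : measurable Z.
  rewrite (_ : Z = (fun w => dot (X w) (X w)) @^-1` [set 0]) // -[Y in measurable Y]setTI.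
  have mg : measurable_fun setT (fun w => dot (X w) (X w)) by exact: measurable_dot.
  exact: mg.
have Z0 z : dot z z = 0 -> forall k, tnth z k = 0.
  move=> /eqP; rewrite dotE inner_eq0 => /eqP/colP z0 k.
  by have := z0 k; rewrite !mxE.
have prZ : pr P Z = 0.
  rewrite /pr (_ : Z = [set w | X w = [tuple 0 | _ < n]]) ?X_neq0//.
  apply/seteqP; split=> w /=.
    by move=> /Z0 zk; apply/eq_from_tnth => k; rewrite zk tnth_mktuple.
  by rewrite /Z/= => ->; rewrite /dot big1// => k _; rewrite tnth_mktuple mul0r.
pose A j := [set w | axis_dist i0 (tuple_mulmx (Q j) (X w)) = 0].
have mA j : measurable (A j) by apply: measurable_axis; exact: measurable_tuple_mulmx.
have mE j : measurable (A j `\` Z) by exact: measurableD.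
have prE j : pr P (A j `\` Z) = q.
  have -> : q = pr P (A j).
    apply/esym; apply: (spherical_pr X_spherical (A := [set z | axis_dist i0 z = 0])) => //.
    rewrite (_ : [set _ | _] = (@axis_dist R n i0) @^-1` [set 0]) //.
    by rewrite -[Y in measurable Y]setTI; exact: measurable_axis_dist.
  rewrite (prID P (mA j) mZ) -[LHS]add0r; congr (_ + _); apply/eqP.
  by rewrite eq_le pr_ge0 -prZ le_pr//; exact: measurableI.
have line j w : (A j `\` Z) w ->
    tnth (X w) i1 * (h j ^+ 2 - 1) = 2 * h j * tnth (X w) i0 /\ tnth (X w) i0 != 0.
  move=> [/axis_dist_eq0 Aj nZ].
  have x1 : tnth (X w) i1 * (h j ^+ 2 - 1) = 2 * h j * tnth (X w) i0.
    have hh : 1 + h j ^+ 2 != 0 by rewrite gt_eqF// addr_gt0// exprn_gt0.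
    have := Aj i1; rewrite eq_sym i01 => /(_ isT); rewrite plane_reflectionE//.
    rewrite eqxx eq_sym (negbTE i01) mulr0 add0r mulr1 => /eqP; rewrite subr_eq add0r => /eqP.
    move=> /(congr1 ( *%R^~ (1 + h j ^+ 2))) /=; rewrite divfK// => E.
    have : tnth (X w) i1 * (h j ^+ 2 - 1) =
      tnth (X w) i1 * (1 + h j ^+ 2) - 2 * tnth (X w) i1 by ring.
    by rewrite E => ->; ring.
  split => //; apply/eqP => x0; apply: nZ; rewrite /Z/= /dot big1// => k _.
  have [->|ki0] := eqVneq k i0; first by rewrite x0 mul0r.
  have [->|ki1] := eqVneq k i1.
    move: x1; rewrite x0 mulr0 => /eqP; rewrite mulf_eq0 => /orP[/eqP->|]; first by rewrite mul0r.
    by rewrite subr_eq0 sqrp_eq1 ?ltW// lt_eqF.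
  have := Aj k ki0; rewrite plane_reflectionE// (negbTE ki0) (negbTE ki1) mulr0 addr0.
  by rewrite mulr0 subr0 => ->; rewrite mul0r.
have disj i j w : (A i `\` Z) w -> (A j `\` Z) w -> i = j.
  move=> /line[Ei x0] /line[Ej _].
  set x := tnth (X w) i0 in Ei Ej x0; set y := tnth (X w) i1 in Ei Ej.
  have xx : 2 * x != 0 by rewrite mulf_neq0.
  have E1 : (2 * x) * (h i * (h j ^+ 2 - 1)) = (2 * x) * (h j * (h i ^+ 2 - 1)).
    transitivity ((2 * h i * x) * (h j ^+ 2 - 1)); first by ring.
    by rewrite -Ei mulrAC Ej; ring.
  have {E1} := mulfI xx E1 => E1.
  have : (h j - h i) * (h i * h j + 1) = 0.
    by move: E1; move: (h i) (h j) => u v E1;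
      transitivity (u * (v ^+ 2 - 1) - v * (u ^+ 2 - 1)); [ring|rewrite E1 subrr].
  move=> /eqP; rewrite mulf_eq0 => /orP[|]; last first.
    by rewrite gt_eqF// addr_gt0// mulr_gt0.
  by rewrite subr_eq0 => /eqP/invr_inj/eqP; rewrite eqr_nat => /eqP[].
have Kq K : K%:R * q <= 1.
  apply: (@le_trans _ _ (\sum_(j <- iota 0 K) pr P (A j `\` Z))).
    rewrite (eq_bigr (fun=> q)) // big_const_seq count_predT size_iota iter_addr addr0.
    by rewrite mulr_natl.
  rewrite -(pr_setT P); apply: sum_le_pr => // [|i j w _ _]; first exact: iota_uniq.
  exact: disj.
apply/eqP; rewrite eq_le pr_ge0 andbT leNgt; apply/negP => q0.
have := Kq (Num.truncn q^-1).+1; apply/negP; rewrite -ltNge.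
by rewrite -ltr_pdivrMr// mul1r truncnS_gt.
Qed.

Local Notation U k := (fun w => axis_coord i0 k (X w)).

Lemma bounded_axis_coord k : k != i0 -> bounded_rv (U k).
Proof.
move=> ki; split; last by exists 1 => w; exact: axis_coord_norm.
by apply: measurableT_comp; [exact: measurable_axis_coord|].
Qed.

(* The reflections in [plane_vector i1 k (h)] and [plane_vector i1 k (- h)] move the
   coordinate [U i1] by [O(h)]; the second-order term of the Taylor expansion of
   [E[((U i1 - t)^+)^3]], which is invariant, gives the identity as [h] tends to 0. *)
Lemma stein_pair k t : k != i0 -> k != i1 ->
  Ex P (fun w => U k w ^+ 2 * pos (U i1 w - t)) =
  2^-1 * Ex P (fun w => U i1 w * pos (U i1 w - t) ^+ 2).
Proof.
move=> ki0 ki1; have i10 : i1 != i0 by rewrite eq_sym.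
have bU := bounded_axis_coord i10; have bk := bounded_axis_coord ki0.
have bpos (f : T -> R) : bounded_rv f -> bounded_rv (fun w => pos (f w)).
  exact: bounded_rv_pos.
have bp : bounded_rv (fun w => pos (U i1 w - t)).
  by apply/bpos/bounded_rvB => //; exact: bounded_rv_cst.
pose B1 := Ex P (fun w => U i1 w * pos (U i1 w - t) ^+ 2).
pose B2 := Ex P (fun w => U i1 w ^+ 2 * pos (U i1 w - t)).
pose B3 := Ex P (fun w => U k w ^+ 2 * pos (U i1 w - t)).
rewrite -/B1 -/B3.
have key h : 0 < h <= 1 -> `|B3 - 2^-1 * B1| <= h * (6 + `|B1| + `|B2|).
  move=> /andP[h0 h1]; pose r := 2 * h / (1 + h ^+ 2).
  (* This is the displacement of [U i1] under the reflection along [plane_vector i1 k (s * h)].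
     Adding the cases s = 1 and s = -1 cancels the part of first order in [U k] and the cross term
     of the squares; the surviving terms are both of order h^2. *)
  pose dl s w := - r * (h * U i1 w + s * U k w).
  have inv s : s = 1 \/ s = -1 ->
      Ex P (fun w => pos (U i1 w - t + dl s w) ^+ 3) = Ex P (fun w => pos (U i1 w - t) ^+ 3).
    move=> s1; pose v := plane_vector i1 k (s * h).
    have ik1 : i1 != k by rewrite eq_sym.
    have Hv : householder v *m (householder v)^T = 1%:M.
      by apply: householder_orthogonal; exact: plane_vector_neq0.
    have ss : s ^+ 2 = 1 by case: s1 => ->; rewrite ?expr1n ?sqrrN ?expr1n.
    pose f (z : n.-tuple R) := pos (axis_coord i0 i1 z - t) ^+ 3.
    have bf : bounded_rv f.
      apply/bounded_rvX/bounded_rv_pos/bounded_rvB; last exact: bounded_rv_cst.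
      split; first exact: measurable_axis_coord.
      by exists 1 => z; exact: axis_coord_norm.
    rewrite -(spherical_Ex X_spherical Hv bf); congr (Ex P _); apply/funext => w.
    rewrite /f; congr (pos _ ^+ 3); rewrite addrAC; congr (_ - t).
    rewrite /axis_coord axis_dist_fix//; last first.
      by rewrite plane_reflectionE// (negbTE i01) [i0 == k]eq_sym (negbTE ki0) mulr0 addr0 mulr0 subr0.
    rewrite plane_reflectionE// eqxx (negbTE ik1) mulr1 addr0 mulrBl; congr (_ + _).
    rewrite /dl /r exprMn ss mul1r /axis_coord.
    by case: s1 => ->; ring.
  have dlE w : dl 1 w + dl (-1) w = - (2 * r * h * U i1 w) by rewrite /dl; ring.
  have dl2E w : dl 1 w ^+ 2 + dl (-1) w ^+ 2 = 2 * r ^+ 2 * (h ^+ 2 * U i1 w ^+ 2 + U k w ^+ 2).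
    by rewrite /dl; ring.
  have r0 : 0 < r by rewrite divr_gt0 ?mulr_gt0// addr_gt0// exprn_gt0.
  have r2h : r <= 2 * h.
    by rewrite ler_pdivrMr ?addr_gt0 ?exprn_gt0// ler_peMr ?mulr_ge0 ?(ltW h0)// lerDl exprn_ge0 ?ltW.
  have dl_le s w : s = 1 \/ s = -1 -> `|dl s w| <= 2 * r.
    move=> s1; rewrite normrM normrN (gtr0_norm r0) mulrC ler_wpM2r ?(ltW r0)//.
    rewrite (le_trans (ler_normD _ _))// (normrM h) (normrM s) (gtr0_norm h0).
    have -> : `|s| = 1 by case: s1 => ->; rewrite ?normrN normr1.
    have := axis_coord_norm (X w) ki0; have := axis_coord_norm (X w) i10.
    move: (normr_ge0 (U i1 w)) => u0 u1 uk.
    have : h * `|U i1 w| <= 1 * 1 by apply: ler_pM => //; exact: ltW.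
    by rewrite !mul1r => hu; rewrite (_ : 2 = 1 + 1)// lerD.
  pose rem s w := pos (U i1 w - t + dl s w) ^+ 3 - pos (U i1 w - t) ^+ 3 -
    3 * dl s w * pos (U i1 w - t) ^+ 2 - 3 * dl s w ^+ 2 * pos (U i1 w - t).
  have rem_le s w : s = 1 \/ s = -1 -> `|rem s w| <= 8 * r ^+ 3.
    move=> s1; apply: (le_trans (pos_cube_taylor _ _)).
    have -> : 8 * r ^+ 3 = (2 * r) ^+ 3 by ring.
    by rewrite lerXn2r ?nnegrE// ?dl_le// mulr_ge0// ltW.
  have bdl s : bounded_rv (dl s).
    by apply: bounded_rvZ; apply: bounded_rvD; exact: bounded_rvZ.
  have bx : bounded_rv (fun w => U i1 w - t) by apply: bounded_rvB => //; exact: bounded_rv_cst.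
  have bc s : bounded_rv (fun w => pos (U i1 w - t + dl s w) ^+ 3).
    by apply/bounded_rvX/bpos/bounded_rvD.
  have b0 : bounded_rv (fun w => pos (U i1 w - t) ^+ 3) by exact/bounded_rvX.
  have b1 : bounded_rv (fun w => U i1 w * pos (U i1 w - t) ^+ 2).
    by apply: bounded_rvM => //; exact: bounded_rvX.
  have b2 : bounded_rv (fun w => U i1 w ^+ 2 * pos (U i1 w - t)).
    by apply: bounded_rvM => //; exact: bounded_rvX.
  have b3 : bounded_rv (fun w => U k w ^+ 2 * pos (U i1 w - t)).
    by apply: bounded_rvM => //; exact: bounded_rvX.
  have Erem : Ex P (fun w => rem 1 w + rem (-1) w) =
      6 * r * h * B1 - 6 * r ^+ 2 * (h ^+ 2 * B2 + B3).
    transitivity (Ex P (fun w => (pos (U i1 w - t + dl 1 w) ^+ 3 +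
        pos (U i1 w - t + dl (-1) w) ^+ 3 - 2 * pos (U i1 w - t) ^+ 3) +
        (6 * r * h * (U i1 w * pos (U i1 w - t) ^+ 2) -
        (6 * r ^+ 2 * h ^+ 2 * (U i1 w ^+ 2 * pos (U i1 w - t)) +
         6 * r ^+ 2 * (U k w ^+ 2 * pos (U i1 w - t)))))).
      congr (Ex P _); apply/funext => w.
      have h1' : dl (-1) w = - (2 * r * h * U i1 w) - dl 1 w by rewrite -dlE; ring.
      have h2' : dl (-1) w ^+ 2 =
        2 * r ^+ 2 * (h ^+ 2 * U i1 w ^+ 2 + U k w ^+ 2) - dl 1 w ^+ 2 by rewrite -dl2E; ring.
      rewrite /rem h2'; move: (pos (_ + dl (-1) w)) => c'.
      by rewrite h1'; ring.
    rewrite ExD; last 2 first.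
    - by apply: bounded_rvB; [exact: bounded_rvD|exact: bounded_rvZ].
    - by apply: bounded_rvB; [exact: bounded_rvZ|apply: bounded_rvD; exact: bounded_rvZ].
    rewrite ExB; [|exact: bounded_rvD|exact: bounded_rvZ].
    rewrite ExB; [|exact: bounded_rvZ|by apply: bounded_rvD; exact: bounded_rvZ].
    rewrite !ExD ?ExZ//; [|exact: bounded_rvZ|exact: bounded_rvZ].
    rewrite !inv; [|by right|by left].
    by rewrite -/B1 -/B2 -/B3; ring.
  have : `|Ex P (fun w => rem 1 w + rem (-1) w)| <= 16 * r ^+ 3.
    apply: norm_Ex_le => [|w].
      have br s : bounded_rv (rem s).
        apply: bounded_rvB.
          apply: bounded_rvB; first exact: bounded_rvB.
          by apply: bounded_rvM; [exact: bounded_rvZ|exact: bounded_rvX].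
        by apply: bounded_rvM => //; apply/bounded_rvZ/bounded_rvX.
      exact: bounded_rvD.
    rewrite (le_trans (ler_normD _ _))// (_ : 16 * r ^+ 3 = 8 * r ^+ 3 + 8 * r ^+ 3).
      by apply: lerD; apply: rem_le; [left|right].
    by ring.
  rewrite Erem => le1.
  (* Since r h = r^2 (1 + h^2) / 2, everything carries the factor 6 r^2; after division the
     remainder is (16 / 6) r, hence O(h). *)
  have E1 : 6 * r * h * B1 - 6 * r ^+ 2 * (h ^+ 2 * B2 + B3) =
      6 * r ^+ 2 * ((1 + h ^+ 2) / 2 * B1 - h ^+ 2 * B2 - B3).
    by rewrite /r; field; rewrite gt_eqF// addr_gt0// exprn_gt0.
  have E2 : 16 * r ^+ 3 = 6 * r ^+ 2 * (16 / 6 * r) by field.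
  have r20 : 0 < 6 * r ^+ 2 by rewrite mulr_gt0// exprn_gt0.
  rewrite E1 E2 normrM (gtr0_norm r20) ler_pM2l// in le1.
  have -> : B3 - 2^-1 * B1 = h ^+ 2 * (2^-1 * B1 - B2) -
      ((1 + h ^+ 2) / 2 * B1 - h ^+ 2 * B2 - B3) by field.
  apply: (le_trans (ler_normB _ _)); apply: (le_trans (lerD (lexx _) le1)).
  have hB : `|h ^+ 2 * (2^-1 * B1 - B2)| <= h * (`|B1| + `|B2|).
    rewrite normrM ger0_norm ?exprn_ge0 ?(ltW h0)// expr2 -mulrA ler_wpM2l ?(ltW h0)//.
    apply: (@le_trans _ _ (1 * (`|B1| + `|B2|))); last by rewrite mul1r.
    apply: ler_pM => //; first exact: ltW.
    apply: (le_trans (ler_normB _ _)); rewrite lerD2r normrM ler_piMl//.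
    by rewrite ger0_norm ?invr_ge0// invf_le1// ler1n.
  apply: (le_trans (lerD hB (lexx _))).
  have h6 : 16 / 6 * r <= 6 * h by lra.
  have -> : h * (6 + `|B1| + `|B2|) = h * (`|B1| + `|B2|) + 6 * h by ring.
  by rewrite lerD2l.
set D := `|_| in key; set C := 6 + _ + _ in key.
have C0 : 0 < C by rewrite /C -addrA ltr_pwDl// addr_ge0.
apply/eqP; rewrite -subr_eq0 -normr_eq0 -/D; apply: contraT => Dn0.
have D0 : 0 < D by rewrite lt_neqAle eq_sym Dn0 normr_ge0.
have hm0 : 0 < Num.min 1 (D / (2 * C)) by rewrite lt_min ltr01 divr_gt0// mulr_gt0.
have hm1 : Num.min 1 (D / (2 * C)) <= 1 by rewrite ge_min lexx.
have hm : 0 < Num.min 1 (D / (2 * C)) <= 1 by rewrite hm0 hm1.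
have := key _ hm.
have : Num.min 1 (D / (2 * C)) * C <= D / (2 * C) * C.
  by rewrite ler_pM2r// ge_min lexx orbT.
move=> /[swap] /le_trans /[apply].
have -> : D / (2 * C) * C = D / 2 by field; rewrite gt_eqF.
by rewrite leNgt ltr_pdivrMr// ltr_pMr// ltr1n.
Qed.

(** [stein_pair] is summed over the n - 2 = m - 1 coordinates k other than [i0] and [i1]. Their
    squares add up to 1 - U_{i1}^2 except where [axis_dist] vanishes and the default value 0 of
    [axis_coord] intervenes; the indicator of that null set repairs the identity pointwise. *)
Lemma spherical_stein t :
  let A k := pos_moment P (U i1) k t in let m : R := n%:R - 1 in
  (1 - t ^+ 2) * A 1 = (m + 3) / 2 * t * A 2 + (m + 1) / 2 * A 3.
Proof.
move=> A m; have i10 : i1 != i0 by rewrite eq_sym.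
have bU := bounded_axis_coord i10.
have bp : bounded_rv (fun w => pos (U i1 w - t)).
  by apply/bounded_rv_pos/bounded_rvB => //; exact: bounded_rv_cst.
have bpk k : bounded_rv (fun w => pos (U i1 w - t) ^+ k) by exact: bounded_rvX.
have bk k : k != i0 -> bounded_rv (fun w => U k w ^+ 2 * pos (U i1 w - t)).
  by move=> ki0; apply: bounded_rvM => //; apply/bounded_rvX/bounded_axis_coord.
pose Z := [set w | axis_dist i0 (X w) = 0].
have mZ : measurable Z by exact: (measurable_axis (@measurable_id _ _ _)).
have bZ : bounded_rv (fun w => \1_Z w * pos (U i1 w - t)).
  by apply: bounded_rvM => //; exact: bounded_rv_indic.
have Z0 : Ex P (fun w => \1_Z w * pos (U i1 w - t)) = 0.
  have [_ [M pM]] := bp.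
  apply/eqP; rewrite eq_le; apply/andP; split; last first.
    by apply: Ex_ge0 => w; rewrite mulr_ge0 ?pos_ge0// indicE.
  rewrite -[leRHS](mulr0 `|M|) -axis_null -Ex_indic// -ExZ; last exact: bounded_rv_indic.
  apply: le_Ex => // [|w]; first by apply/bounded_rvZ/bounded_rv_indic.
  rewrite mulrC ler_wpM2r// ?indicE//.
  by rewrite (le_trans (ler_norm _))// (le_trans (pM w))// ler_norm.
have sumE : \sum_(k | (k != i0) && (k != i1)) Ex P (fun w => U k w ^+ 2 * pos (U i1 w - t)) =
    Ex P (fun w => (1 - U i1 w ^+ 2) * pos (U i1 w - t)).
  have b1 : bounded_rv (fun w => (1 - U i1 w ^+ 2) * pos (U i1 w - t)).
    apply: bounded_rvM => //; apply: bounded_rvB; first exact: bounded_rv_cst.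
    exact: bounded_rvX.
  rewrite -[RHS]subr0 -[in RHS]Z0 -ExB//.
  pose F k w := if (k != i0) && (k != i1) then U k w ^+ 2 * pos (U i1 w - t) else 0.
  have bF k : bounded_rv (F k).
    rewrite /F; case E: (_ && _); last exact: bounded_rv_cst.
    by apply: bk; case/andP: E.
  have -> : \sum_(k | (k != i0) && (k != i1)) Ex P (fun w => U k w ^+ 2 * pos (U i1 w - t)) =
      \sum_k Ex P (F k).
    rewrite big_mkcond; apply: eq_bigr => k _; rewrite /F.
    by case E: (_ && _) => //; rewrite Ex_cst.
  rewrite -(Ex_sum P _ bF); congr (Ex P _); apply/funext => w.
  rewrite -mulrBl /F -big_mkcond/= -mulr_suml; congr (_ * _).
  rewrite indicE; have [Zw|nZ] := pselect (Z w).
    rewrite mem_set//= /axis_coord Zw invr0 mulr0 expr0n subr0 subrr big1// => k _.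
    by rewrite mulr0 expr0n.
  rewrite memNset// subr0 -(@axis_coord_sqr_sum _ _ i0 (X w)); last exact/eqP.
  by rewrite [in RHS](bigD1 i1)//= addrC addrK.
have : Ex P (fun w => (1 - U i1 w ^+ 2) * pos (U i1 w - t)) =
    (m - 1) / 2 * Ex P (fun w => U i1 w * pos (U i1 w - t) ^+ 2).
  rewrite -sumE (eq_bigr (fun=> 2^-1 * Ex P (fun w => U i1 w * pos (U i1 w - t) ^+ 2))).
    rewrite sumr_const -[_ *+ _]mulr_natl mulrA; congr (_ / 2 * _).
    have := cardC (pred2 i0 i1); rewrite card2 i01 card_ord => /(congr1 (fun k => k%:R : R)).
    rewrite natrD /m => <-; rewrite (_ : #|[predC pred2 i0 i1]| = #|[pred k | (k != i0) && (k != i1)]|).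
      by rewrite /=; ring.
    by apply: eq_card => k; rewrite !inE negb_or.
  by move=> k /andP[ki0 ki1]; exact: stein_pair.
have -> : Ex P (fun w => (1 - U i1 w ^+ 2) * pos (U i1 w - t)) =
    (1 - t ^+ 2) * A 1 - 2 * t * A 2 - A 3.
  rewrite /A /pos_moment -!ExZ// -!ExB//; try exact: bounded_rvZ.
    congr (Ex P _); apply/funext => w; set y := U i1 w; rewrite expr1.
    have [yt|ty] := leP y t; first by rewrite pos0 ?subr_le0// !expr0n/= !mulr0 !subr0.
    by rewrite pos_id ?subr_ge0 ?(ltW ty)//; ring.
  by apply: bounded_rvB; exact: bounded_rvZ.
have -> : Ex P (fun w => U i1 w * pos (U i1 w - t) ^+ 2) = A 3 + t * A 2.
  rewrite /A /pos_moment -ExZ// -ExD//; last exact: bounded_rvZ.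
  congr (Ex P _); apply/funext => w; set y := U i1 w.
  have [yt|ty] := leP y t; first by rewrite pos0 ?subr_le0// !expr0n/= !mulr0 addr0.
  by rewrite pos_id ?subr_ge0 ?(ltW ty)//; ring.
move=> h; have -> : (1 - t ^+ 2) * A 1 =
    ((1 - t ^+ 2) * A 1 - 2 * t * A 2 - A 3) + 2 * t * A 2 + A 3 by ring.
by rewrite h; field.
Qed.

End spherical_stein.

(** * Independence *)

Section tuple_rectangles.
Context d (S : measurableType d) (p : nat).

Definition rect (B : 'I_p -> set S) : set (p.-tuple S) :=
  [set t | forall i, B i (tnth t i)].

Definition rects : set (set (p.-tuple S)) :=
  [set A | exists2 B, forall i, measurable (B i) & A = rect B].

Lemma measurable_rect B : (forall i, measurable (B i)) -> measurable (rect B).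
Proof.
move=> mB.
rewrite (_ : rect B = \bigcap_(i in [set: 'I_p]) ((@tnth p S)^~ i @^-1` B i)).
  apply: fin_bigcap_measurable => [|i _]; first exact: finite_finset.
  by rewrite -[X in measurable X]setTI; exact: measurable_tnth.
by apply/seteqP; split=> t /= h i; [move=> _|]; exact: h.
Qed.

Lemma measurable_tuple_rects : @measurable _ (p.-tuple S) = <<s rects >>.
Proof.
apply/seteqP; split; last first.
  apply: smallest_sub; first exact: sigma_algebra_measurable.
  by move=> _ [B mB ->]; exact: measurable_rect.
apply: smallest_sub; first exact: smallest_sigma_algebra.
rewrite -bigcup_seq => A [i _ [C mC <-]]; apply: sub_sigma_algebra.
exists (fun j => if j == i then C else setT).
  by move=> j; case: ifP.
apply/seteqP; split=> t; rewrite /rect/=.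
  by move=> [_ Ct] j; case: ifPn => // /eqP ->.
by move=> /(_ i); rewrite eqxx.
Qed.

Lemma rects_setI_closed : setI_closed rects.
Proof.
move=> _ _ [B mB ->] [C mC ->]; exists (fun i => B i `&` C i).
  by move=> i; exact: measurableI.
apply/seteqP; split=> t /=.
  by move=> [hB hC] i; split.
by move=> h; split=> i; have [] := h i.
Qed.

Lemma rects_setT : rects setT.
Proof. by exists (fun=> setT) => //; apply/seteqP; split. Qed.

End tuple_rectangles.

Section independence.
Context d (T : measurableType d) (R : realType) (P : probability T R).
Context d' (S : measurableType d') (p : nat).

(** Both sides are finite measures in A, and rectangles form a generating pi-system that contains
    the whole space. *)
Lemma indep_of_rects (Y : {mfun T >-> p.-tuple S}) (E : set T) : measurable E ->
  (forall B, (forall i, measurable (B i)) ->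
    pr P (Y @^-1` rect B `&` E) = pr P (Y @^-1` rect B) * pr P E) ->
  forall A, measurable A -> pr P (Y @^-1` A `&` E) = pr P (Y @^-1` A) * pr P E.
Proof.
move=> mE rE A mA.
have mY (B : set (p.-tuple S)) : measurable B -> measurable (Y @^-1` B).
  by move=> mB; rewrite -[X in measurable X]setTI; exact: measurable_funP.
have E0 : 0 <= pr P E by exact: pr_ge0.
pose m1 := pushforward (mrestr P mE) Y.
pose m2 := mscale (NngNum E0) (distribution P Y).
have m1E B : measurable B -> m1 B = (pr P (Y @^-1` B `&` E))%:E.
  by move=> mB; rewrite -prE//; apply: measurableI => //; exact: mY.
have m2E B : measurable B -> m2 B = (pr P (Y @^-1` B) * pr P E)%:E.
  by move=> mB; rewrite mulrC EFinM -[in RHS](prE P (mY _ mB)).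
apply: EFin_inj; rewrite -m1E// -m2E//.
apply: (measure_unique (@rects _ S p) (fun=> setT)) => //.
- exact: measurable_tuple_rects.
- exact: rects_setI_closed.
- by move=> _; exact: rects_setT.
- by rewrite bigcup_const.
- move=> B [C mC ->]; have mR := measurable_rect mC.
  by rewrite -[LHS]/(m1 _) -[RHS]/(m2 _) m1E// m2E// rE.
- by move=> _; rewrite -[X in (X < _)%E]/(m1 _) m1E// ltry.
Qed.

Variable X : 'I_p -> {RV P >-> S}.
Hypothesis X_indep : mutually_independent P X.
Variable s0 : S.

(* The subfamily indexed by [J], padded with a constant so that all subfamilies have
   the same type. *)
Definition block (J : {set 'I_p}) (w : T) : p.-tuple S :=
  [tuple if i \in J then X i w else s0 | i < p].

Lemma measurable_block J : measurable_fun setT (block J).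
Proof.
apply/measurable_fun_tnthP => i.
rewrite (_ : _ \o _ = if i \in J then X i : T -> S else fun=> s0).
  by case: ifP.
by apply/funext => w /=; rewrite tnth_mktuple; case: ifP.
Qed.

HB.instance Definition _ J :=
  isMeasurableFun.Build _ _ _ _ (block J) (measurable_block J).

Lemma pr_rect_block (J : {set 'I_p}) (B : 'I_p -> set S) : (forall i, measurable (B i)) ->
  (forall i, i \notin J -> B i s0) ->
  pr P (block J @^-1` rect B) = \prod_(i in J) pr P (X i @^-1` B i).
Proof.
move=> mB Bs0; rewrite (_ : _ @^-1` _ = \bigcap_(i in [set` J]) X i @^-1` B i).
  have mXB i : measurable (X i @^-1` B i).
    by rewrite -[Y in measurable Y]setTI; exact: measurable_funP.
  apply: EFin_inj; rewrite -prE; last first.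
    by apply: fin_bigcap_measurable => [|i _] //; exact: finite_finset.
  by rewrite X_indep// -prodEFin; apply: eq_bigr => i _; rewrite prE.
apply/seteqP; split=> w /= h i.
  by move=> /= iJ; have := h i; rewrite tnth_mktuple iJ.
by rewrite tnth_mktuple; case: ifPn => [iJ|/Bs0//]; exact: h.
Qed.

Lemma block_indep (J K : {set 'I_p}) (A C : set (p.-tuple S)) :
  (forall i, i \in J -> i \notin K) -> measurable A -> measurable C ->
  pr P (block J @^-1` A `&` block K @^-1` C) =
  pr P (block J @^-1` A) * pr P (block K @^-1` C).
Proof.
move=> JnK mA mC.
have mblock L (B : set (p.-tuple S)) : measurable B -> measurable (block L @^-1` B).
  by move=> mB; rewrite -[Y in measurable Y]setTI; exact: measurable_block.
apply: (@indep_of_rects (block J)) => //; first exact: mblock.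
move=> B mB; rewrite setIC mulrC.
apply: (@indep_of_rects (block K)) => //; first by apply: mblock; exact: measurable_rect.
move=> D mD {A C mA mC}.
(* A padded coordinate is constantly [s0]; if some side of the rectangle outside [J] misses it, the
   event is empty and both members vanish. *)
have [Bs|nBs] := pselect (forall i, i \notin J -> B i s0); last first.
  have -> : block J @^-1` rect B = set0.
    apply/seteqP; split=> w //= h; apply: nBs => i iJ.
    by have := h i; rewrite tnth_mktuple (negbTE iJ).
  by rewrite setI0 pr_set0 mulr0.
have [Ds|nDs] := pselect (forall i, i \notin K -> D i s0); last first.
  have -> : block K @^-1` rect D = set0.
    apply/seteqP; split=> w //= h; apply: nDs => i iK.
    by have := h i; rewrite tnth_mktuple (negbTE iK).
  by rewrite set0I pr_set0 mul0r.
pose BD i := if i \in J then B i else if i \in K then D i else setT.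
have -> : block K @^-1` rect D `&` block J @^-1` rect B = block (J :|: K) @^-1` rect BD.
  apply/seteqP; split=> w /=.
    move=> [hD hB] i; rewrite tnth_mktuple inE /BD.
    have := hB i; have := hD i; rewrite !tnth_mktuple.
    by case: ifP => //= _; case: ifP.
  move=> h; split=> i; have := h i; rewrite !tnth_mktuple inE /BD.
    case: (boolP (i \in K)) => [iK|iK _]; last exact: Ds.
    by rewrite orbT; case: ifPn => // /JnK; rewrite iK.
  by case: (boolP (i \in J)) => [iJ|iJ _] //; exact: Bs.
rewrite !pr_rect_block//.
- rewrite (bigID (mem K))/=; congr (_ * _).
    apply: eq_big => i; first by rewrite finset.in_setU; case: (i \in K); rewrite ?orbT ?andbF.
    by move=> /andP[_ iK]; rewrite /BD iK ifN//; apply/negP => /JnK; rewrite iK.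
  apply: eq_big => i; last first.
    by rewrite finset.in_setU => /andP[/orP[iJ|->//] _]; rewrite /BD iJ.
  by rewrite finset.in_setU; case: (boolP (i \in J)) => [/JnK->//|_]; case: (i \in K).
- by move=> i; rewrite /BD; case: ifP => // _; case: ifP.
- by move=> i; rewrite inE negb_or /BD => /andP[/negbTE-> /negbTE->].
Qed.

End independence.

(** Conditioning on [Y] by Fubini: independence makes the joint law a product, and the sections of C
    have mass c for almost every value of [Y]. *)
Lemma pr_section_const d (T : measurableType d) (R : realType) (P : probability T R)
    d1 d2 (S1 : measurableType d1) (S2 : measurableType d2)
    (Y : {mfun T >-> S1}) (W : {mfun T >-> S2}) (C : set (S1 * S2)) (G : set S1) (c : R) :
  (forall A B, measurable A -> measurable B ->
    pr P (Y @^-1` A `&` W @^-1` B) = pr P (Y @^-1` A) * pr P (W @^-1` B)) ->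
  measurable C -> measurable G -> pr P (Y @^-1` (~` G)) = 0 ->
  (forall y, G y -> pr P [set w | C (y, W w)] = c) ->
  pr P [set w | C (Y w, W w)] = c.
Proof.
move=> YW mC mG G0 GC.
have mY A : measurable A -> measurable (Y @^-1` A).
  by move=> mA; rewrite -[X in measurable X]setTI; exact: measurable_funP.
have mW A : measurable A -> measurable (W @^-1` A).
  by move=> mA; rewrite -[X in measurable X]setTI; exact: measurable_funP.
have mYW : measurable_fun setT (fun w => (Y w, W w)).
  by apply: measurable_fun_pair; exact: measurable_funP.
pose YWf : {mfun T >-> (S1 * S2)%type} :=
  HB.pack (fun w => (Y w, W w)) (isMeasurableFun.Build _ _ _ _ _ mYW).
pose m1 := distribution P Y; pose m2 := distribution P W.
have E : (m1 \x m2)%E C = distribution P YWf C.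
  apply: product_measure_unique => // A B mA mB.
  transitivity (P (Y @^-1` A `&` W @^-1` B)) => //.
  transitivity (P (Y @^-1` A) * P (W @^-1` B))%E => //.
  rewrite !prE; [by rewrite -EFinM YW|exact: mW|exact: mY|].
  by apply: measurableI; [exact: mY|exact: mW].
apply: EFin_inj; rewrite -prE; last first.
  by rewrite -[X in measurable X]setTI; exact (mYW measurableT _ mC).
rewrite -[LHS]/(distribution P YWf C) -E /product_measure1.
rewrite (@ae_eq_integral _ _ _ m1 setT (cst c%:E))//.
- rewrite integral_cst//; transitivity (c%:E * P setT)%E => //.
  by rewrite probability_setT mule1.
- exact: (@measurable_fun_xsection _ _ _ _ _ (distribution P W)).
exists (~` G); split.
- exact: measurableC.
- by rewrite -[LHS]/(P (Y @^-1` (~` G))) prE ?G0//; apply/mY/measurableC.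
move=> y /= /not_implyP[_ ny] Gy; apply: ny.
rewrite -[LHS]/(P (W @^-1` xsection C y)) prE; last by apply: mW; exact: measurable_xsection.
congr EFin; rewrite -(GC y Gy); congr (pr P _); apply/seteqP; split=> w /=.
  by rewrite /xsection/= => /set_mem.
by rewrite /xsection/= => Cy; exact/mem_set.
Qed.

(** * The sample correlations *)

Section correlations.
Context d (T : measurableType d) (R : realType) (P : probability T R) (n p : nat).
Variable Z : 'I_p -> {RV P >-> n.-tuple R}.
Hypothesis Z_iid : iid P Z.
Hypothesis Z_spherical : forall i, spherical P (Z i).
Hypothesis Z_neq0 : forall i, P [set w | Z i w = [tuple 0 | _ < n]] = 0%E.
Variables (i0 i1 : 'I_n) (k0 : 'I_p).
Hypothesis i01 : i0 != i1.

Let U w := axis_coord i0 i1 (Z k0 w).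

(** Twice the one-sided tail, the form to which [regular_tail_two_sided] applies; for [0 <= r]
    symmetry makes it the tail of the absolute value. The choice of [k0] is immaterial as the
    vectors have the same law. *)
Definition corr_tail (r : R) : R := 2 * tail P U r.

Local Notation H := corr_tail.

Definition acorr i j w : R := `|sample_corr (Z i w) (Z j w)|.

Let i10 : i1 != i0. Proof. by rewrite eq_sym. Qed.

Let mU : measurable_fun setT U.
Proof. by apply: measurableT_comp; [exact: measurable_axis_coord|]. Qed.

Let U1 w : `|U w| <= 1. Proof. exact: axis_coord_norm. Qed.

Lemma U_sym t : pr P [set w | t < - U w] = pr P [set w | t < U w].
Proof.
have NN : (- 1%:M : 'M[R]_n) *m (- 1%:M)^T = 1%:M.
  by rewrite linearN/= trmx1 mulNmx mulmxN opprK mul1mx.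
have mA : measurable [set z : n.-tuple R | t < axis_coord i0 i1 z].
  exact: (measurable_gt (@measurable_axis_coord R n i0 i1)).
have E w : axis_coord i0 i1 (tuple_mulmx (- 1%:M) (Z k0 w)) = - U w.
  have NE k : tnth (tuple_mulmx (- 1%:M) (Z k0 w)) k = - tnth (Z k0 w) k.
    by rewrite tnth_mktuple mulNmx mul1mx !mxE.
  rewrite /U /axis_coord NE mulNr /axis_dist; congr (- (_ / Num.sqrt _)).
  by apply: eq_bigr => k _; rewrite NE sqrrN.
rewrite -[RHS](spherical_pr (@Z_spherical k0) NN mA); congr (pr P _).
by apply/seteqP; split=> w /=; rewrite E.
Qed.

Lemma corr_tail_regular : regular_tail (n%:R - 1) H.
Proof.
have n2 : (1 < n)%N.
  by move: (ltn_ord i0) (ltn_ord i1) i01; rewrite -val_eqE /=; lia.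
apply: regular_tail_two_sided => //; last exact: U_sym.
- by rewrite lerBrDr -[_ + _]/(2%:R) ler_nat.
- by move=> t; exact: (spherical_stein (@Z_spherical k0) (@Z_neq0 k0) i01).
Qed.

Lemma corr_tailE r : 0 <= r -> H r = pr P [set w | r < `|U w|].
Proof. by move=> r0; rewrite pr_norm_tail//; exact: U_sym. Qed.

Lemma corr_tail_norm i r : 0 <= r ->
  pr P [set w | r < `|axis_coord i0 i1 (Z i w)|] = H r.
Proof.
move=> r0; rewrite corr_tailE//.
have mA : measurable [set z : n.-tuple R | r < `|axis_coord i0 i1 z|].
  apply: measurable_gt; apply: measurableT_comp => //; exact: measurable_axis_coord.
by rewrite /pr; congr fine; have [_ h] := Z_iid; exact: (h i k0 _ mA).
Qed.

(** The value does not depend on [z]. This is the source of every independence statement about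
    correlations that share a vector. *)
Lemma corr_tail_fixed i z r : norm2 (centered z) != 0 -> 0 <= r ->
  pr P [set w | r < `|sample_corr (Z i w) z|] = H r.
Proof.
move=> z0 r0; have [Q [QQ zQ]] := sample_corr_axis_coord i01 z0.
rewrite -(corr_tail_norm i r0).
have mA : measurable [set z : n.-tuple R | r < `|axis_coord i0 i1 z|].
  apply: measurable_gt; apply: measurableT_comp => //; exact: measurable_axis_coord.
rewrite -(spherical_pr (@Z_spherical i) QQ mA); congr (pr P _).
by apply/seteqP; split=> w /=; rewrite zQ.
Qed.

Lemma sample_corrC (x y : n.-tuple R) : sample_corr x y = sample_corr y x.
Proof.
rewrite /sample_corr [norm2 _ * _]mulrC; congr (_ / _).
by apply: eq_bigr => k _; rewrite mulrC.
Qed.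

Lemma acorr_sym i j w : acorr i j w = acorr j i w.
Proof. by rewrite /acorr sample_corrC. Qed.

Lemma measurable_acorr i j : measurable_fun setT (acorr i j).
Proof. by apply: measurableT_comp => //; exact: measurable_sample_corr. Qed.

Lemma centered_null i : pr P [set w | norm2 (centered (Z i w)) = 0] = 0.
Proof.
have [Q [QQ Qd]] := @exists_centering R n i0.
have mA : measurable [set z : n.-tuple R | axis_dist i0 z = 0].
  rewrite (_ : [set _ | _] = (@axis_dist R n i0) @^-1` [set 0])//.
  by rewrite -[X in measurable X]setTI; exact: measurable_axis_dist.
rewrite -[RHS](axis_null (@Z_spherical i) (@Z_neq0 i) i01).
rewrite -(spherical_pr (@Z_spherical i) QQ mA); congr (pr P _).
by apply/seteqP; split=> w /=; rewrite Qd.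
Qed.

Local Notation block := (block Z [tuple 0 | _ < n]).

Lemma block_in (J : {set 'I_p}) i w : i \in J -> tnth (block J w) i = Z i w.
Proof. by move=> iJ; rewrite tnth_mktuple iJ. Qed.

Let Tp : Type := p.-tuple (n.-tuple R).

Lemma measurable_tnth_corr d' (T' : measurableType d') (f g : T' -> p.-tuple (n.-tuple R)) i j :
  measurable_fun setT f -> measurable_fun setT g ->
  measurable_fun setT (fun w => `|sample_corr (tnth (f w) i) (tnth (g w) j)|).
Proof.
move=> /measurable_fun_tnthP mf /measurable_fun_tnthP mg.
by apply: measurableT_comp => //; apply: measurable_sample_corr; [exact: mf|exact: mg].
Qed.

(** Freezes [Z i] at a value whose centered vector does not vanish, as happens almost surely by
    [centered_null]. *)
Lemma pr_block_pair (J : {set 'I_p}) i (E : n.-tuple R -> Tp -> Prop) c : i \notin J ->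
  measurable [set q : p.-tuple (n.-tuple R) * p.-tuple (n.-tuple R) | E (tnth q.1 i) q.2] ->
  (forall z, norm2 (centered z) != 0 -> pr P [set w | E z (block J w)] = c) ->
  pr P [set w | E (Z i w) (block J w)] = c.
Proof.
move=> iJ mE Ec.
have bi w : tnth (block (finset.set1 i) w) i = Z i w.
  by apply: block_in; rewrite finset.in_set1.
have h := @pr_section_const _ _ _ P _ _ _ _ (block (finset.set1 i)) (block J)
  [set q | E (tnth q.1 i) q.2] [set y | norm2 (centered (tnth y i)) != 0] c.
rewrite -[RHS]h//.
- by congr (pr P _); apply/seteqP; split=> w /=; rewrite bi.
- move=> A B mA mB; apply: block_indep => //; first by have [] := Z_iid.
  by move=> k; rewrite finset.in_set1 => /eqP->.
- pose f (y : p.-tuple (n.-tuple R)) := norm2 (centered (tnth y i)).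
  have mf : measurable_fun setT f.
    by apply: measurable_norm2; apply: measurable_centered; exact: measurable_tnth.
  rewrite (_ : [set _ | _] = ~` (f @^-1` [set 0])).
    by apply: measurableC; rewrite -[X in measurable X]setTI; exact: mf.
  by apply/seteqP; split=> y /= /eqP.
- transitivity (pr P [set w | norm2 (centered (Z i w)) = 0]); last exact: centered_null.
  congr (pr P _); apply/seteqP; split=> w /=; rewrite bi.
    by move=> /negP/negPn/eqP.
  by move=> ->; rewrite eqxx.
- by move=> y; exact: Ec.
Qed.

Lemma block_indep_pr (J K : {set 'I_p}) (A C : set (p.-tuple (n.-tuple R))) :
  (forall i, i \in J -> i \notin K) -> measurable A -> measurable C ->
  pr P [set w | A (block J w) /\ C (block K w)] =
  pr P [set w | A (block J w)] * pr P [set w | C (block K w)].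
Proof. by move=> *; apply: block_indep => //; have [] := Z_iid. Qed.

Lemma acorr_tail i j r : i != j -> 0 <= r -> pr P [set w | r < acorr i j w] = H r.
Proof.
move=> ij r0.
have bj w : tnth (block (finset.set1 j) w) j = Z j w.
  by apply: block_in; rewrite finset.in_set1.
rewrite -(@pr_block_pair (finset.set1 j) i
  (fun z t => r < `|sample_corr z (tnth t j)|) (H r)).
- by congr (pr P _); apply/seteqP; split=> w /=; rewrite bj.
- by rewrite finset.in_set1.
- apply: measurable_gt; apply: measurable_tnth_corr; [exact: measurable_fst|].
  exact: measurable_snd.
move=> z z0; rewrite -(@corr_tail_fixed j z r)//; congr (pr P _).
by apply/seteqP; split=> w /=; rewrite bj sample_corrC.
Qed.

Lemma acorr_slab i j s t : i != j -> 0 <= s -> s <= t ->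
  pr P [set w | s < acorr i j w <= t] = H s - H t.
Proof.
move=> ij s0 st; rewrite pr_between//; last exact: measurable_acorr.
by rewrite !acorr_tail// (le_trans s0).
Qed.

(** Given the shared vector [Z i], the two correlations are functions of the independent vectors
    [Z j] and [Z k], and their conditional probabilities do not depend on the value of [Z i]. *)
Lemma acorr_adjacent i j k s t r : i != j -> i != k -> j != k ->
  0 <= s -> s <= t -> 0 <= r ->
  pr P [set w | s < acorr i j w <= t /\ r < acorr i k w] = (H s - H t) * H r.
Proof.
move=> ij ik jk s0 st r0; pose J := [set j; k]%SET.
have bj w : tnth (block J w) j = Z j w by apply: block_in; rewrite !inE eqxx.
have bk w : tnth (block J w) k = Z k w by apply: block_in; rewrite !inE eqxx orbT.
rewrite -(@pr_block_pair J i (fun z u => s < `|sample_corr z (tnth u j)| <= t /\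
    r < `|sample_corr z (tnth u k)|) ((H s - H t) * H r)).
- by congr (pr P _); apply/seteqP; split=> w /=; rewrite bj bk.
- by rewrite !inE negb_or ij ik.
- apply: measurableI.
    by apply: measurable_between; apply: measurable_tnth_corr;
      [exact: measurable_fst|exact: measurable_snd].
  by apply: measurable_gt; apply: measurable_tnth_corr;
    [exact: measurable_fst|exact: measurable_snd].
move=> z z0.
have mz (l : 'I_p) : measurable_fun setT (fun u : p.-tuple (n.-tuple R) =>
    `|sample_corr z (tnth u l)|).
  apply: measurableT_comp => //; apply: measurable_sample_corr; first exact: measurable_cst.
  exact: measurable_tnth.
have bj' w : tnth (block (finset.set1 j) w) j = Z j w.
  by apply: block_in; rewrite finset.in_set1.
have bk' w : tnth (block (finset.set1 k) w) k = Z k w.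
  by apply: block_in; rewrite finset.in_set1.
have := @block_indep_pr (finset.set1 j) (finset.set1 k)
  [set u | s < `|sample_corr z (tnth u j)| <= t] [set u | r < `|sample_corr z (tnth u k)|].
move=> /(_ _ (measurable_between (mz j) _ _) (measurable_gt (mz k) _)) h.
transitivity (pr P [set w | s < `|sample_corr (Z j w) z| <= t] *
    pr P [set w | r < `|sample_corr (Z k w) z|]).
  transitivity (pr P [set w | [set u | s < `|sample_corr z (tnth u j)| <= t]
      (block (finset.set1 j) w) /\
      [set u | r < `|sample_corr z (tnth u k)|] (block (finset.set1 k) w)]).
    by congr (pr P _); apply/seteqP; split=> w /=; rewrite bj bk bj' bk'.
  rewrite h; last by move=> l; rewrite !finset.in_set1 => /eqP->.
  congr (pr P _ * pr P _); apply/seteqP; split=> w /=;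
    by rewrite ?bj' ?bk' (sample_corrC z).
rewrite pr_between//; last by apply: measurableT_comp => //; exact: measurable_sample_corr.
by rewrite !corr_tail_fixed// (le_trans s0).
Qed.

Lemma acorr_disjoint (q : 'I_p * 'I_p) s t r : q.1 != q.2 -> 0 <= s -> s <= t ->
  pr P (slab acorr q s t `&` below acorr (disjoint_pairs q) r) =
  (H s - H t) * pr P (below acorr (disjoint_pairs q) r).
Proof.
move=> q12 s0 st; rewrite -(acorr_slab q12 s0 st).
pose J := [set q.1; q.2]%SET.
pose A := [set u : p.-tuple (n.-tuple R) |
  s < `|sample_corr (tnth u q.1) (tnth u q.2)| <= t].
pose C := [set u : p.-tuple (n.-tuple R) |
  all (fun q' => `|sample_corr (tnth u q'.1) (tnth u q'.2)| <= r) (disjoint_pairs q)].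
have mcorr i j : measurable_fun setT (fun u : p.-tuple (n.-tuple R) =>
    `|sample_corr (tnth u i) (tnth u j)|) by exact: measurable_tnth_corr.
have AE : [set w | s < acorr q.1 q.2 w <= t] = [set w | A (block J w)].
  by apply/seteqP; split=> w /=; rewrite /A/= !block_in// !inE eqxx ?orbT.
have CE : below acorr (disjoint_pairs q) r = [set w | C (block (~: J)%SET w)].
  have E w : all (fun q' => acorr q'.1 q'.2 w <= r) (disjoint_pairs q) =
      all (fun q' => `|sample_corr (tnth (block (~: J)%SET w) q'.1)
        (tnth (block (~: J)%SET w) q'.2)| <= r) (disjoint_pairs q).
    apply: eq_in_all => q'; rewrite mem_filter => /andP[/and4P[h1 h2 h3 h4] _].
    by rewrite !block_in// !inE negb_or ?h1 ?h2 ?h3 ?h4.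
  by apply/seteqP; split=> w; rewrite /below /C /= E.
rewrite -[LHS]/(pr P ([set w | s < acorr q.1 q.2 w <= t] `&` _)) AE CE.
apply: block_indep_pr; first by move=> l; rewrite finset.in_setC negbK.
- exact: measurable_between.
- exact: (measurable_below mcorr).
Qed.

End correlations.

(** * Growth of the number of pairs *)

Section number_of_pairs.
Context {R : realType}.

Lemma size_pairs p : size (pairs p) = 'C(p, 2).
Proof.
rewrite /pairs size_filter -sum1_count big_enum_cond/=.
rewrite -(pair_big_dep xpredT (fun i j : 'I_p => (i < j)%N) (fun _ _ => 1%N))/=.
rewrite (exchange_big_dep xpredT)//= -bin2_sum big_mkord; apply: eq_bigr => j _.
rewrite sum1_card -[RHS]card_ord.
have -> : #|[pred i : 'I_p | (i < j)%N]| = #|[set widen_ord (ltnW (ltn_ord j)) i | i : 'I_j]%SET|.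
  apply: eq_card => i; rewrite inE; apply/idP/imsetP => [ij|[k _ ->]]; last exact: (ltn_ord k).
  by exists (Ordinal ij) => //; apply: val_inj.
rewrite card_imset ?card_ord// => a b /(congr1 val) /= ab; exact: val_inj.
Qed.

Lemma natr_pairs p : 2 * (size (pairs p))%:R = p%:R * (p%:R - 1) :> R.
Proof.
rewrite size_pairs; elim: p => [|p IH]; first by rewrite bin0n mulr0 mul0r.
by rewrite binS bin1 natrD mulrDr IH -natr1; ring.
Qed.

Variable p : nat -> nat.
Hypothesis p_infty : p n @[n --> \oo] --> \oo.
Hypothesis ln_p : ln (p n)%:R / n%:R @[n --> \oo] --> (0 : R).

Local Notation N n := ((size (pairs (p n)))%:R : R).

Lemma near_p_ge k : \forall n \near \oo, (k <= p n)%N.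
Proof. by move/cvgnyPge : p_infty; apply. Qed.

Lemma pairs_cvgy : N n @[n --> \oo] --> +oo.
Proof.
apply/cvgryPge => B; near=> n.
have p3 : 3 <= (p n)%:R :> R by rewrite ler_nat; near: n; exact: near_p_ge.
have pB : B <= (p n)%:R.
  rewrite (le_trans (ltW (truncnS_gt B)))// ler_nat; near: n; exact: near_p_ge.
by have := natr_pairs (p n); nra.
Unshelve. all: by end_near. Qed.

Lemma ln_pairs_cvg0 : ln (N n) / n%:R @[n --> \oo] --> (0 : R).
Proof.
have h : 2 * (ln (p n)%:R / n%:R) @[n --> \oo] --> (0 : R).
  by rewrite -[X in _ --> X](mulr0 2); apply: cvgM => //; exact: cvg_cst.
apply: (squeeze_cvgr _ (cvg_cst 0) h); near=> n.
have p3 : 3 <= (p n)%:R :> R by rewrite ler_nat; near: n; exact: near_p_ge.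
have NE := natr_pairs (p n).
have N1 : 1 <= N n by nra.
have n0 : 0 <= n%:R^-1 :> R by rewrite invr_ge0.
rewrite divr_ge0 ?ln_ge0//= mulrA ler_wpM2r//.
rewrite mulr_natl -lnXn; last by lra.
by rewrite ler_ln ?posrE ?exprn_gt0//; nra.
Unshelve. all: by end_near. Qed.

(** By [natr_pairs] the ratio is 4 / (p - 1). *)
Lemma pairs_ratio_cvg0 : 2 * (p n)%:R / N n @[n --> \oo] --> (0 : R).
Proof.
apply/cvgr0Pnorm_le => e e0; near=> n.
have p3 : 3 <= (p n)%:R :> R by rewrite ler_nat; near: n; exact: near_p_ge.
have pe : 1 + 4 / e <= (p n)%:R.
  rewrite (le_trans (ltW (truncnS_gt _)))// ler_nat; near: n; exact: near_p_ge.
have NE := natr_pairs (p n).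
have N1 : 0 < N n by nra.
rewrite ger0_norm; last by rewrite divr_ge0 ?mulr_ge0// ltW.
rewrite ler_pdivrMr//.
have : 4 <= ((p n)%:R - 1) * e by rewrite -ler_pdivrMr// lerBrDl.
move=> h; have : (p n)%:R * 4 <= (p n)%:R * (((p n)%:R - 1) * e) by rewrite ler_wpM2l.
have -> : (p n)%:R * (((p n)%:R - 1) * e) = 2 * N n * e by rewrite NE mulrA.
by lra.
Unshelve. all: by end_near. Qed.

End number_of_pairs.

(** The Cauchy-Schwarz inequality, read off the reduction to a coordinate of a unit vector. *)
Lemma sample_corr_norm (R : realType) n (x y : n.-tuple R) (i0 i1 : 'I_n) : i0 != i1 ->
  `|sample_corr x y| <= 1.
Proof.
move=> i01; have [y0|y0] := eqVneq (norm2 (centered y)) 0.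
  by rewrite /sample_corr y0 mulr0 invr0 mulr0 normr0.
have [Q [_ ->]] := sample_corr_axis_coord i01 y0.
by apply: axis_coord_norm; rewrite eq_sym.
Qed.

Lemma correlation_pair_bounds d (T : measurableType d) (R : realType) (P : probability T R)
    n p (Z : 'I_p -> {RV P >-> n.-tuple R}) : (1 < n)%N -> (1 < size (pairs p))%N ->
  iid P Z -> (forall i, spherical P (Z i)) ->
  (forall i, P [set w | Z i w = [tuple 0 | _ < n]] = 0%E) ->
  exists h, regular_tail (n%:R - 1) h /\
    pair_bounds P (V1 Z) (V2 Z) h (size (pairs p))%:R p.
Proof.
move=> n1 p1 Z_iid Z_sph Z_neq0.
pose i0 : 'I_n := Ordinal (ltnW n1); pose i1 : 'I_n := Ordinal n1.
have i01 : i0 != i1 by [].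
have p0 : (0 < p)%N by case: (p) p1 => //; rewrite size_pairs.
pose k0 : 'I_p := Ordinal p0.
pose h := corr_tail Z i0 i1 k0.
have hE r : 0 <= r -> h r = pr P [set w | r < `|axis_coord i0 i1 (Z k0 w)|].
  exact: corr_tailE.
have mU : measurable_fun setT (fun w => `|axis_coord i0 i1 (Z k0 w)|).
  by apply: measurableT_comp => //; apply: measurableT_comp => //; exact: measurable_axis_coord.
have m_acorr := measurable_acorr Z.
have a_sym := acorr_sym Z.
have a_tail i j r : i != j -> 0 <= r -> pr P [set w | r < acorr Z i j w] = h r.
  exact: acorr_tail.
have a_adj := acorr_adjacent Z_iid Z_sph Z_neq0 k0 i01.
have a_disj := acorr_disjoint Z_iid Z_sph Z_neq0 k0 i01.
exists h; split; first exact: corr_tail_regular.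
split.
- move=> w; have [q0 [q1 [q0p q1p q10 E0 [E1 [q1q0 _]]]]] :=
    ostat01_witness (fun q => acorr Z q.1 q.2 w) (pairs_uniq p) p1.
  rewrite -[V1 Z w]/(ostat [seq acorr Z q.1 q.2 w | q <- pairs p] 0).
  rewrite -[V2 Z w]/(ostat [seq acorr Z q.1 q.2 w | q <- pairs p] 1).
  by rewrite E0 E1 q1q0 normr_ge0; split => //; exact: sample_corr_norm i01.
- rewrite hE// (_ : [set _ | _] = set0) ?pr_set0//.
  apply/seteqP; split=> w //=; apply/negP; rewrite -leNgt.
  by apply: axis_coord_norm; rewrite eq_sym.
- move=> s t s0 st; rewrite !hE//; last exact: le_trans st.
  by apply: le_pr => [||w /= /(le_lt_trans st)//]; exact: measurable_gt.
- move=> s t r s0 st r0 rs; rewrite -[top_cdf _ _ _](max_below_top P (acorr Z) p1).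
  exact: (pair_lower m_acorr a_sym p1 a_tail a_adj a_disj).
- move=> s t r s0 st r0; rewrite -[top_cdf _ _ _](max_below_top P (acorr Z) p1).
  exact: (pair_upper m_acorr a_sym p1 a_tail a_disj).
Qed.

Lemma exp_law1E (R : realType) (x : R) :
  exp_law 1 `]-oo, x]%classic = (if x < 0 then 0 else 1 - expR (- x))%:E.
Proof.
rewrite /exp_law invr1.
have supp V : exponential_prob 1 V = exponential_prob 1 (V `&` `[0, +oo[%classic) :> \bar R.
  rewrite /exponential_prob integral_mkcond [RHS]integral_mkcond; congr integral.
  apply/funext => y; rewrite !patchE in_setI; case: (y \in V) => //=.
  by rewrite /exponential_pdf patchE; case: ifPn.
have [x0|x0] := ltP x 0.
  rewrite supp (_ : _ `&` _ = set0); first by rewrite /exponential_prob integral_set0.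
  apply/seteqP; split=> y //=; rewrite !in_itv/= andbT => -[yx y0].
  by move: x0; rewrite ltNge (le_trans y0 yx).
rewrite supp (_ : _ `&` _ = `[0, x]%classic); last first.
  by apply/seteqP; split=> y /=; rewrite !in_itv/= andbT andbC => /andP.
move: x0; rewrite le_eqVlt => /orP[/eqP<-|x0].
  by rewrite set_itv1 /exponential_prob integral_set1 oppr0 expR0 subrr.
by rewrite exponential_prob_itv0c// mulN1r.
Qed.

Theorem theorem1 (R : realType) (p : nat -> nat)
    (d : nat -> measure_display) (T : forall n, measurableType (d n))
    (P : forall n, probability (T n) R)
    (Z : forall n, 'I_(p n) -> {RV (P n) >-> n.-tuple R})
    (p_infty : p n @[n --> \oo] --> \oo)
    (log_p : ln (p n)%:R / n%:R @[n --> \oo] --> (0 : R))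
    (Z_iid : forall n, (0 < n)%N -> iid (P n) (Z n))
    (Z_spherical : forall n, (0 < n)%N -> forall i, spherical (P n) (Z n i))
    (Z_neq0 : forall n, (0 < n)%N -> forall i,
      P n [set w | Z n i w = [tuple 0 | _ < n]] = 0%E) :
  cvg_in_distribution P (fun n => nV1_gap (Z n)) (exp_law 1).
Proof.
pose N n : R := (size (pairs (p n)))%:R.
have N2 : \forall n \near \oo, (1 < size (pairs (p n)))%N.
  near=> n; have p3 : (3 <= p n)%N by near: n; exact: near_p_ge.
  have := @natr_pairs R (p n); have : (3 : R) <= (p n)%:R by rewrite ler_nat.
  move=> p3' NE; rewrite -(ltr_nat R); nra.
(* The tail depends on n and exists only for n >= 2 and at least two pairs; elsewhere it gets the
   default 0, which the eventual statements never see. *)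
have /choice[H HE] : forall n, exists h, (1 < n)%N -> (1 < size (pairs (p n)))%N ->
    regular_tail (n%:R - 1) h /\
    pair_bounds (P n) (V1 (Z n)) (V2 (Z n)) h (N n) (p n).
  move=> n.
  have [n1|n1] := ltnP 1 n; last by exists (fun=> 0).
  have [p1|p1] := ltnP 1 (size (pairs (p n))); last by exists (fun=> 0).
  have n0 := ltnW n1.
  have [h hE] := correlation_pair_bounds n1 p1 (Z_iid n n0) (Z_spherical n n0) (Z_neq0 n n0).
  by exists h.
have mV n k : measurable_fun setT (fun w => ostat (abs_corrs (Z n) w) k).
  apply: measurable_ostat => q; apply: measurableT_comp => //.
  exact: measurable_sample_corr.
have E : extreme_pairs P (fun n => V1 (Z n)) (fun n => V2 (Z n)) H N p.
  split => //.
  - split; [|exact: pairs_cvgy|exact: ln_pairs_cvg0].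
    by near=> n; apply: (HE n _ _).1; near: n; [exact: nbhs_infty_gt|].
  - exact: pairs_ratio_cvg0.
  - by move=> n; exact: mV.
  - by move=> n; exact: mV.
  - by near=> n; apply: (HE n _ _).2; near: n; [exact: nbhs_infty_gt|].
have cdfE n x : @cdf _ _ _ (P n) (nV1_gap (Z n)) x =
    (1 - pr (P n) [set w | x < nV1_gap (Z n) w])%:E.
  have mg := measurable_gt (measurable_nV1_gap (Z n)) x.
  rewrite -prC// -prE; last exact: measurableC.
  have -> : ~` [set w | x < nV1_gap (Z n) w] = nV1_gap (Z n) @^-1` `]-oo, x]%classic => //.
  by apply/seteqP; split=> w /=; rewrite in_itv/= leNgt => /negP.
(* For x < 0 both distribution functions are 0 eventually, because 0 <= V2 <= V1 makes the statistic
   nonnegative. *)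
move=> x _; rewrite exp_law1E; have [x0|x0] := ltP x 0.
  apply: cvg_near_cst; near=> n.
  have B : pair_bounds (P n) (V1 (Z n)) (V2 (Z n)) (H n) (N n) (p n).
    by near: n; exact: (ep_bounds E).
  rewrite cdfE (_ : [set _ | _] = setT) ?pr_setT ?subrr//.
  apply/seteqP; split=> w //= _; apply: lt_le_trans x0 _.
  have [/andP[V20 V21] _] := top_order B w.
  by rewrite /nV1_gap !mulr_ge0 ?subr_ge0// (le_trans V20).
under eq_fun do rewrite cdfE.
apply: cvg_EFin; first by near=> n.
apply: cvgB; first exact: cvg_cst.
exact: (gap_event_cvg E x0).
Unshelve. all: by end_near. Qed.
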